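(* Let $(M,g)$ be a pseudo-Riemannian manifold of dimension $n\ge 3$. Let $P_{2N}$ and $Q_{2N}$ denote the GJMS operators and $Q$-curvatures of $g$, let $W_{2N}$ denote the scalar invariants on $M$ defined from the Poincaré metric of $g$, and let $m_I$ be the constants, all as defined in the context. Then for every integer $N\ge 1$ (and $N\le n/2$ if $n$ is even), $$(-1)^NQ_{2N}=-\sum_{\substack{|(I,a)|=N\\ a<N}} m_{(I,a)}(-1)^a P_{2I}(Q_{2a})+N!\,(N-1)!\,2^{2N}\,W_{2N},$$ where the sum is over all compositions $(I,a)$ of $N$ with last entry $a$ satisfying $1\le a<N$.
   Context: Setting. $g$ is a pseudo-Riemannian metric of signature $(p,q)$, $p+q=n\ge 3$, on an $n$-dimensional manifold $M$. A Poincaré metric in normal form relative to $g$ is a metric on $M\times(0,\epsilon)$ of the form $g_+=r^{-2}(dr^2+h_r)$, where $h_r$ is a smooth 1-parameter family of metrics on $M$ with $h_0=g$, for which $\mathrm{Ric}(g_+)+ng_+=0$ asymptotically at $r=0$: if $n$ is odd, $\mathrm{Ric}(g_+)+ng_+=O(r^\infty)$; if $n$ is even, $\mathrm{Ric}(g_+)+ng_+=O(r^{n-2})$ and the tangential trace of $r^{2-n}(\mathrm{Ric}(g_+)+ng_+)$ vanishes at $r=0$. The family $h_r$ is even in $r$, in the sense that $h_r=g_\rho$ with $\rho=-r^2/2$ for a smooth 1-parameter family $g_\rho$ of metrics on $M$, $\rho\in(-\epsilon,\epsilon)$, $g_0=g$. The quantities defined below are independent of the remaining choices. Invariants $W_{2N}$.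 Set $V(r)=\sqrt{\det h_r/\det h_0}$ and $W(r)=\sqrt{V(r)}$. The functions $W_{2N}$ on $M$, for $N\ge1$ (and $N\le n/2$ if $n$ is even), are defined by the Taylor expansion at $r=0$ $$W(r)=1+\sum_{N\ge1}W_{2N}r^{2N}.$$ GJMS operators. Let $\widetilde g=2\rho\,dt^2+2t\,dt\,d\rho+t^2g_\rho$ on $\mathbb{R}_+\times M\times(-\epsilon,\epsilon)$ (coordinates $t,x,\rho$), with Laplacian $\widetilde\Delta$ (sign: trace of the Hessian). For $N\ge1$ (and $N\le n/2$ if $n$ is even), $P_{2N}f=\widetilde\Delta^N(t^{N-n/2}\widetilde f)|_{\rho=0,\,t=1}$, where $f\in C^\infty(M)$ and $\widetilde f\in C^\infty(M\times(-\epsilon,\epsilon))$ is any function with $\widetilde f(x,0)=f(x)$; the result is independent of the choice of $\widetilde f$. With this convention $P_{2N}=\Delta^N+\cdots$, where $\Delta=\delta(g^{-1}d)$ and $\delta\varphi=\nabla_i\varphi^i$ is the divergence with respect to $g$. $Q$-curvatures. For $N\ge1$ (and $N\le n/2$ if $n$ is even), $Q_{2N}$ is defined by $P_{2N}(1)=(-1)^N\left(\frac n2-N\right)Q_{2N}$ when $N\ne n/2$. When $n$ is even and $N=n/2$, $Q_n$ is defined by analytic continuation in the dimension (removing the factor $n/2-N$); equivalently, $(-1)^{n/2}Q_n=-\widetilde\Delta^{n/2}(\log t)|_{\rho=0,\,t=1}$. Compositions and constants. A composition is an ordered list $I=(I_1,\ldots,I_r)$ of positive integers, with $|I|=I_1+\cdots+I_r$.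 When a composition is written $(I,a)$, $a>0$ is its last entry (and $I$ is allowed to be empty). Set $P_{2I}=P_{2I_1}\circ\cdots\circ P_{2I_r}$ and $$m_I=(-1)^{r+1}|I|!\,(|I|-1)!\prod_{j=1}^r\frac{1}{I_j!\,(I_j-1)!}\prod_{j=1}^{r-1}\frac{1}{I_j+I_{j+1}}.$$ Empty products equal 1. *)

(* Defs.v *)
From HB Require Import structures.
From mathcomp Require Import all_boot all_order all_algebra.
From mathcomp Require Import all_classical all_reals all_analysis.

Set Implicit Arguments.
Unset Strict Implicit.
Unset Printing Implicit Defensive.

Import Order.TTheory GRing.Theory Num.Theory.
Import numFieldTopology.Exports numFieldNormedType.Exports.

Local Open Scope classical_set_scope.
Local Open Scope ring_scope.

Section Coordinates.
Variables (R : realType) (m : nat).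

Definition partial (i : 'I_m) (f : 'rV[R]_m -> R) (x : 'rV[R]_m) : R :=
  'D_(delta_mx 0 i) f x.

(* C^k on [A], for [A] open: the partial derivatives up to order k exist and
   are continuous. *)
Fixpoint Ck_on (k : nat) (A : set 'rV[R]_m) (f : 'rV[R]_m -> R) : Prop :=
  match k with
  | 0%N => forall x, A x -> {for x, continuous f}
  | k'.+1 => forall i : 'I_m,
      (forall x, A x -> derivable f x (delta_mx 0 i)) /\
      Ck_on k' A (partial i f)
  end.

Definition smooth_on (A : set 'rV[R]_m) (f : 'rV[R]_m -> R) : Prop :=
  forall k, Ck_on k A f.

(* A metric in coordinates: [G x i j] is the component G_ij at x. *)
Variable G : 'rV[R]_m -> 'M[R]_m.

(* Gamma^k_ij, the upper index coming first *)
Definition christoffel (k i j : 'I_m) (x : 'rV[R]_m) : R :=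
  2^-1 * \sum_(l < m) invmx (G x) k l *
    (partial i (fun y => G y j l) x + partial j (fun y => G y i l) x
     - partial l (fun y => G y i j) x).

(* Sign convention: the round sphere has positive Ricci tensor. *)
Definition ricci (x : 'rV[R]_m) : 'M[R]_m :=
  \matrix_(i < m, j < m)
   (\sum_(k < m) (partial k (christoffel k i j) x
                  - partial j (christoffel k i k) x)
    + \sum_(k < m) \sum_(l < m)
        (christoffel k k l x * christoffel l i j x
         - christoffel k j l x * christoffel l i k x)).

Definition hessian (f : 'rV[R]_m -> R) (i j : 'I_m) (x : 'rV[R]_m) : R :=
  partial i (partial j f) x
  - \sum_(k < m) christoffel k i j x * partial k f x.

Definition laplacian (f : 'rV[R]_m -> R) (x : 'rV[R]_m) : R :=
  \sum_(i < m) \sum_(j < m) invmx (G x) i j * hessian f i j x.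

End Coordinates.

(* [chart_pt a] is the inverse of the chart [chart_co a]; only its values on
   the open set [chart_co a @` chart_dom a] are meaningful.  [chart_at p] is
   some chart around p, used to evaluate at p objects which are defined by
   their expression in local coordinates. *)
Record manifold (R : realType) (n : nat) (M : topologicalType) := Manifold {
  chart : Type;
  chart_dom : chart -> set M;
  chart_co : chart -> M -> 'rV[R]_n;
  chart_pt : chart -> 'rV[R]_n -> M;
  chart_at : M -> chart;
  chart_dom_open : forall a, open (chart_dom a);
  chart_img_open : forall a, open (chart_co a @` chart_dom a);
  chart_coK : forall a p, chart_dom a p -> chart_pt a (chart_co a p) = p;
  chart_co_continuous : forall a p, chart_dom a p ->
    {for p, continuous (chart_co a)};
  chart_pt_continuous : forall a x, (chart_co a @` chart_dom a) x ->
    {for x, continuous (chart_pt a)};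
  chart_atP : forall p, chart_dom (chart_at p) p;
  chart_compatible : forall (a b : chart) (i : 'I_n),
    smooth_on (chart_co a @` (chart_dom a `&` chart_dom b))
              (fun x => chart_co b (chart_pt a x) 0 i);
  manifold_hausdorff : hausdorff_space M;
  manifold_second_countable : @second_countable M
}.

Section Manifold.
Variables (R : realType) (n : nat) (M : topologicalType).
Variable S : manifold R n M.

Definition chart_img (a : chart S) : set 'rV[R]_n :=
  chart_co a @` chart_dom a.

Definition transition (a b : chart S) (x : 'rV[R]_n) : 'rV[R]_n :=
  chart_co b (chart_pt a x).

Definition smooth_fun (f : M -> R) : Prop :=
  forall a : chart S, smooth_on (chart_img a) (fun x => f (chart_pt a x)).

(* The image of (dom a) x (-eps, eps) in R^(n + 1), with coordinates
   (x, rho). *)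
Definition strip (eps : R) (a : chart S) : set 'rV[R]_(n + 1) :=
  [set z | chart_img a (lsubmx z) /\ `|rsubmx z 0 0| < eps].

Definition smooth_fun_strip (eps : R) (f : M -> R -> R) : Prop :=
  forall a : chart S, smooth_on (strip eps a)
    (fun z => f (chart_pt a (lsubmx z)) (rsubmx z 0 0)).

Definition has_signature (p q : nat) (B : 'M[R]_n) : Prop :=
  (p + q = n)%N /\
  exists2 T : 'M[R]_n, T \in unitmx &
    T *m B *m T^T = diag_mx (\row_(i < n) (if (i < p)%N then 1 else -1)).

(* Covariant 2-tensors, given by their components in each chart *)
Definition tensor2 := chart S -> 'rV[R]_n -> 'M[R]_n.

(* ['J f x] acts on rows, so that its (i, c) entry is the i-th partial
   derivative of the c-th component of f. *)
Definition tensorial (g : tensor2) : Prop :=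
  forall (a b : chart S) (u : M), chart_dom a u -> chart_dom b u ->
    let x := chart_co a u in
    g a x = 'J (transition a b) x *m g b (chart_co b u)
            *m ('J (transition a b) x)^T.

Definition is_metric (p q : nat) (g : tensor2) : Prop :=
  [/\ tensorial g,
      forall a i j, smooth_on (chart_img a) (fun x => g a x i j) &
      forall a x, chart_img a x -> has_signature p q (g a x)].

Definition smooth_metric_family (p q : nat) (eps : R) (gr : R -> tensor2) :=
  (forall rho, `|rho| < eps -> is_metric p q (gr rho)) /\
  (forall a i j, smooth_on (strip eps a)
     (fun z => gr (rsubmx z 0 0) a (lsubmx z) i j)).

Variable gr : R -> tensor2.

Definition hr (r : R) : tensor2 := gr (- (r ^+ 2) / 2).

(* g_+ = r^-2 (dr^2 + h_r), in the coordinates (x, r) *)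
Definition gplus (a : chart S) (z : 'rV[R]_(n + 1)) : 'M[R]_(n + 1) :=
  let x := lsubmx z in let r := rsubmx z 0 0 in
  r ^- 2 *: block_mx (hr r a x) 0 0 1%:M.

(* Ric(g_+) + n g_+ *)
Definition einstein_defect (a : chart S) (x : 'rV[R]_n) (r : R) :
    'M[R]_(n + 1) :=
  let z := row_mx x r%:M in ricci (gplus a) z + n%:R *: gplus a z.

(* Ric(g_+) + n g_+ = O(r^k), locally uniformly on M *)
Definition einstein_defect_O (k : nat) : Prop :=
  forall a x i j, chart_img a x ->
    exists C : R, \forall y \near x & r \near 0^'+,
      `|einstein_defect a y r i j| <= C * r ^+ k.

Definition einstein_defect_trace0 : Prop :=
  forall a x, chart_img a x ->
    \tr (invmx (hr 0 a x) *m
         ulsubmx (r ^- (n - 2)%N *: einstein_defect a x r)) @[r --> 0^'+]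
      --> (0 : R).

(* [gr] is a family g_rho for which r^-2 (dr^2 + h_r), h_r = g_(-r^2/2), is a
   Poincaré metric in normal form relative to [g]. *)
Definition poincare_family (p q : nat) (g : tensor2) (eps : R) : Prop :=
  [/\ 0 < eps, smooth_metric_family p q eps gr,
      forall a x, chart_img a x -> gr 0 a x = g a x &
      if odd n then forall k, einstein_defect_O k
      else einstein_defect_O (n - 2)%N /\ einstein_defect_trace0].

Definition Vfun (u : M) (r : R) : R :=
  let a := chart_at S u in let x := chart_co a u in
  Num.sqrt (\det (hr r a x) / \det (hr 0 a x)).

Definition Wfun (u : M) (r : R) : R := Num.sqrt (Vfun u r).

(* The coefficient of r^2N in the Taylor expansion.  The derivatives may be
   taken on both sides of r = 0 because h_r is even in r. *)
Definition W2 (N : nat) (u : M) : R :=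
  derive1n N.*2 (Wfun u) 0 / ((N.*2)`!)%:R.

(* 2 rho dt^2 + 2 t dt drho + t^2 g_rho, in the coordinates (t, (x, rho)) *)
Definition ambient_metric (a : chart S) (z : 'rV[R]_(1 + (n + 1))) :
    'M[R]_(1 + (n + 1)) :=
  let t := lsubmx z 0 0 in
  let x := lsubmx (rsubmx z) in
  let rho := rsubmx (rsubmx z) 0 0 in
  block_mx (2 * rho)%:M        (row_mx 0 t%:M)
           (col_mx 0 t%:M)     (block_mx (t ^+ 2 *: gr rho a x) 0 0 0).

(* The argument is a function of (t, u, rho) in R_+ x M x (-eps, eps). *)
Definition ambient_laplacian (F : R -> M -> R -> R) (t : R) (u : M) (rho : R) :
    R :=
  let a := chart_at S u in
  laplacian (ambient_metric a)
    (fun z : 'rV[R]_(1 + (n + 1)) =>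
       F (lsubmx z 0 0) (chart_pt a (lsubmx (rsubmx z)))
         (rsubmx (rsubmx z) 0 0))
    (row_mx t%:M (row_mx (chart_co a u) rho%:M)).

(* [ext N f] is the extension of f to M x (-eps, eps) that is used to compute
   P_2N f. *)
Definition extension_operator (eps : R) (ext : nat -> (M -> R) -> M -> R -> R)
    : Prop :=
  forall N f, smooth_fun f ->
    smooth_fun_strip eps (ext N f) /\ forall u, ext N f u 0 = f u.

Definition gjms (ext : nat -> (M -> R) -> M -> R -> R) (N : nat)
    (f : M -> R) : M -> R :=
  fun u => iter N ambient_laplacian
    (fun t v rho => t `^ (N%:R - n%:R / 2) * ext N f v rho) 1 u 0.

Definition Qcurv (ext : nat -> (M -> R) -> M -> R -> R) (N : nat) : M -> R :=
  fun u =>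
  if N.*2 == n then
    (-1) ^+ N * - iter N ambient_laplacian (fun t _ _ => ln t) 1 u 0
  else
    (-1) ^+ N * gjms ext N (fun=> 1) u / (n%:R / 2 - N%:R).

End Manifold.

Definition is_composition (N : nat) (I : seq nat) : bool :=
  all (leq 1) I && (sumn I == N).

Definition mcoef (R : realType) (I : seq nat) : R :=
  (-1) ^+ (size I).+1 * ((sumn I)`!)%:R * ((sumn I).-1`!)%:R
  * (\prod_(i <- I) (i`! * i.-1`!)%:R^-1)
  * (\prod_(j < (size I).-1) (nth 0%N I j + nth 0%N I j.+1)%:R^-1).

(* Main.v *)
(** Let [w = (det g_rho / det g_0)^(1/4)].  Conjugation by [w] turns the ambient
    Laplacian on [t^b F / w] into [t^(b - 2) D_c F / w], where
    [D_c F = -2 rho F'' + 2 c F' + M F], [c = b + n/2 - 1], and [M], a family of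
    operators on the manifold, depends neither on [b] nor on rho-derivatives.
    Expanding [M = sum_j rho^j M_j] in powers of [rho] reduces everything to
    algebra with the linear maps [M_j].  With
    [L_N = (D_(1-N) ... D_(N-5) D_(N-3) .)|_(rho=0)] one finds
    [P_2N f = L_N (M f)] and [(-1)^N Q_2N = L_N (-2 w')], uniformly in the
    critical and non-critical cases, because [D_c w] is a multiple of [w'].

    [L_N phi] is the obstruction to solving [D_(N-1) F = phi], [F_0 = 0], in
    power series.  An explicit solution below the critical order expresses the
    coefficient [phi_(N-1)] through [L_1 phi, ..., L_N phi].  The operators in
    this formula are the Taylor coefficients of the solutions of [D_c F = 0], and
    expanding them by the same formula applied to [phi = M f] gives rise to the
    sums over compositions.
    For [phi = -2 w'] the coefficient [phi_(N-1)] is, up to a constant, the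
    coefficient of [rho^N] in [w], that is [W_2N]. *)

Require Import Defs.
From HB Require Import structures.
From mathcomp Require Import all_boot all_order all_algebra.
From mathcomp Require Import perm ring lra zify.
From mathcomp Require Import all_classical all_reals all_analysis.

Set Implicit Arguments.
Unset Strict Implicit.
Unset Printing Implicit Defensive.

Import Order.TTheory GRing.Theory Num.Theory.
Import numFieldTopology.Exports numFieldNormedType.Exports.

Local Open Scope classical_set_scope.
Local Open Scope ring_scope.

(** * Formal power series of operators *)

(** The explicit power series come from the indicial roots of [D_a], which are 0 and [a + 1]. The
    solution with exponent [a + 1] is [rho^(a+1) C_(a+1)(v)], where [C_d(v)] starts at [v] and
    solves [2 rho F'' + 2 (d + 1) F' = M F]. As [D_N - D_a = 2 (N - a) d/drho], the operator [D_N]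
    maps this solution to [2 (N - a)] times its derivative. Right-hand sides that are combinations
    of such derivatives are thus solved termwise, by dividing by [N - a]. The same division with
    [D_(-d-1)] in place of [D_N] yields the denominators [I_j + I_(j+1)] of [m_I]. On the analytic
    side the obstacle is that [ambient_laplacian] uses at each point a chart selected for that
    point, with no continuity in the selection. Its formula is pointwise and can be computed in that
    chart, but iterating it requires the outcome to be smooth again. This is where coordinate
    invariance enters, and it is needed only on [M]: for the Laplacian of [g_rho] and for the ratio
    of determinants. *)

Section FormalSeries.
Variables (R : numFieldType) (V : lmodType R) (M : nat -> {linear V -> V}).

(* Coefficients of [-2 rho F'' + 2 c F' + sum_j rho^j M_j F] for the formal
   series [F = sum_k F_k rho^k]. *)
Definition serD (c : R) (F : nat -> V) (k : nat) : V :=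
  (2 * k.+1%:R * (c - k%:R)) *: F k.+1 + \sum_(j < k.+1) M j (F (k - j)%N).

(** Multiplication by [rho]. *)
Definition serX (F : nat -> V) (k : nat) : V := if k is k'.+1 then F k' else 0.

(** The product [D_(c-2m+2) ... D_(c-2) D_c], with [D_c] acting first. The index falls by 2 because
    an ambient Laplacian lowers the degree in [t] by 2. *)
Fixpoint serDn (m : nat) (c : R) (F : nat -> V) : nat -> V :=
  if m is m'.+1 then serDn m' (c - 2) (serD c F) else F.

Definition serL (N : nat) (F : nat -> V) : V :=
  serDn N.-1 (N%:R - 3) F 0%N.

Definition serP (N : nat) (v : V) : V := serL N (fun j => M j v).

Lemma serD_lin c a F G :
  serD c (fun k => a *: F k + G k) = fun k => a *: serD c F k + serD c G k.
Proof.
apply/funext => k; rewrite /serD !scalerDr !scalerA [a * _]mulrC.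
rewrite addrACA; congr (_ + _); rewrite scaler_sumr -big_split /=.
by apply: eq_bigr => j _; rewrite linearP.
Qed.

Lemma serDn_lin m c a F G :
  serDn m c (fun k => a *: F k + G k)
  = fun k => a *: serDn m c F k + serDn m c G k.
Proof. by elim: m c F G => [|m IH] c F G //=; rewrite serD_lin IH. Qed.

Lemma serDn0 m c : serDn m c (fun=> 0) = fun=> 0.
Proof.
elim: m c => [|m IH] c //=; have -> // : serD c (fun=> 0) = fun=> 0.
apply/funext => k; rewrite /serD scaler0 add0r big1 // => j _.
exact: linear0.
Qed.

Lemma serDnZ m c a F :
  serDn m c (fun k => a *: F k) = fun k => a *: serDn m c F k.
Proof.
have -> : (fun k => a *: F k) = fun k => a *: F k + 0.
  by apply/funext => k; rewrite addr0.
by rewrite serDn_lin serDn0; apply/funext => k; rewrite addr0.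
Qed.

Lemma serD_X c F :
  serD c (serX F) = fun k => (2 * c) *: F k + serX (serD (c - 2) F) k.
Proof.
apply/funext => -[|k]; rewrite /serD /=.
  by rewrite big_ord1 /= [M _ _]linear0 !addr0 subr0 mulr1.
rewrite big_ord_recr /= subnn /= linear0 addr0 addrA -scalerDl.
congr (_ *: _ + _); first by rewrite -!natr1; ring.
by apply: eq_bigr => -[j jk] _ /=; rewrite subSn.
Qed.

(** Wherever [rho] is commuted past a factor, the operators that remain form the same product of [m]
    factors starting at [c - 2]. Only the scalars [2 c + 2 (c - 2) + ... + 2 (c - 2 m) = 2 (m + 1)
    (c - m)] have to be added. *)
Lemma serDn_X m c F :
  serDn m.+1 c (serX F) = fun k =>
    (2 * m.+1%:R * (c - m%:R)) *: serDn m (c - 2) F k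
    + serX (serDn m.+1 (c - 2) F) k.
Proof.
elim: m c F => [|m IH] c F; apply/funext => k.
  by rewrite /= serD_X mulr1 subr0.
rewrite -[LHS]/(serDn m.+1 (c - 2) (serD c (serX F)) _) serD_X serDn_lin IH.
rewrite addrA -[serDn m _ (serD _ _)]/(serDn m.+1 (c - 2) F) -scalerDl.
by congr (_ *: _ + _); rewrite -!natr1; ring.
Qed.

(* [D_c (rho F) = rho D_(c-2) F + 2 c F], and the terms produced by moving [rho]
   through [D_(-N) ... D_N] cancel. *)
Lemma serDn_congr N F G : F 0%N = G 0%N ->
  serDn N.+1 N%:R F 0%N = serDn N.+1 N%:R G 0%N.
Proof.
suff H F' : serDn N.+1 N%:R F' 0%N
    = serDn N.+1 N%:R (fun k => if k is 0 then F' 0%N else 0) 0%N.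
  by move=> FG; rewrite (H F) (H G) FG.
have {1}-> : F' = fun k => 1 *: serX (fun k => F' k.+1) k
                 + (if k is 0 then F' 0%N else 0).
  by apply/funext => -[|k]; rewrite /= ?scaler0 ?add0r ?scale1r ?addr0.
by rewrite serDn_lin serDn_X subrr mulr0 scale0r addr0 scaler0 add0r.
Qed.

(** Only [F_0] matters, so [F] may be taken constant; then [D_N F] reduces to the series [M_j F_0],
    and the other [N] factors are those of [serL N.+1]. This is also why the GJMS operator does not
    depend on the extension chosen. *)
Lemma serDn_serP N F : serDn N.+1 N%:R F 0%N = serP N.+1 (F 0%N).
Proof.
rewrite (@serDn_congr N F (fun k => if k is 0 then F 0%N else 0)) //.
rewrite /serP /serL /= (_ : N.+1%:R - 3 = N%:R - 2 :> R); last by rewrite -natr1; ring.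
congr (serDn _ _ _ _); apply/funext => k; rewrite /serD scaler0 add0r.
rewrite big_ord_recr /= subnn big1 ?add0r // => j _.
by rewrite (_ : k - j = (k - j).-1.+1)%N ?linear0 //; have := ltn_ord j; lia.
Qed.

(** Each factor lowers the order of vanishing by one. The [M_j] never reach the leading coefficient,
    which is therefore multiplied by the scalars of the derivative part alone. *)
Lemma serDn_lead N m F : (forall i, (i < m)%N -> F i = 0) ->
  serDn m (2 * m%:R - 1 - N%:R) F 0%N
  = (\prod_(k < m) (2 * k.+1%:R * (k.+1%:R - N%:R))) *: F m.
Proof.
elim: m F => [|m IH] F F0; first by rewrite big_ord0 scale1r.
have S0 k : (k <= m)%N -> \sum_(j < k.+1) M j (F (k - j)%N) = 0.
  move=> km; apply: big1 => j _; rewrite F0 ?linear0 //.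
  by rewrite ltnS (leq_trans _ km) // leq_subr.
rewrite /=; have -> : 2 * m.+1%:R - 1 - N%:R - 2 = 2 * m%:R - 1 - N%:R :> R.
  by rewrite -natr1; ring.
rewrite IH; last first.
  by move=> i im; rewrite /serD S0 1?ltnW // F0 // scaler0 addr0.
rewrite {1}/serD S0 // addr0 scalerA big_ord_recr /=.
by congr (_ * _ *: _); rewrite -natr1; ring.
Qed.

Definition serkappa (N : nat) : R := (-2) ^+ N.-1 * (N.-1`!)%:R ^+ 2.

Lemma prod_serkappa N :
  \prod_(k < N) (2 * k.+1%:R * (k.+1%:R - N.+1%:R)) = serkappa N.+1.
Proof.
rewrite /serkappa /= expr2 mulrA.
transitivity (\prod_(k < N) (-2 * k.+1%:R * (N - k)%:R) : R).
  apply: eq_bigr => k _; rewrite natrB ?(ltnW (ltn_ord _)) // -!natr1; ring.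
rewrite !big_split /= big_const_ord iter_mulr_1; congr (_ * _ * _).
  by rewrite fact_prod big_add1 /= big_mkord natr_prod.
rewrite fact_prod big_add1 /= big_mkord natr_prod.
rewrite [RHS](reindex_inj rev_ord_inj); apply: eq_bigr => k _ /=.
by rewrite subnSK.
Qed.

Lemma serkappa_neq0 N : serkappa N != 0.
Proof.
rewrite mulf_neq0 ?expf_neq0 ?oppr_eq0 ?pnatr_eq0 //.
by rewrite -lt0n fact_gt0.
Qed.

(* [F] solves [D_N F = phi] below order [N], where the coefficient of [F_(N+1)]
   in [D_N F] vanishes. *)
Lemma serL_obstruction N phi F : F 0%N = 0 ->
  (forall k, (k < N)%N -> phi k = (2 * k.+1%:R * (N%:R - k%:R)) *: F k.+1
     + \sum_(j < k.+1) M j (F (k - j)%N)) ->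
  serL N.+1 phi =
  serkappa N.+1 *: (phi N - \sum_(j < N.+1) M j (F (N - j)%N)).
Proof.
(* Subtracting [D_N F] does not change [serL N.+1], since [D_(-N) ... D_N F] at [rho = 0] depends
   only on [F_0 = 0]. The difference [psi] vanishes to order [N], so [serDn_lead] evaluates it. *)
move=> F0 Fk; pose psi := fun k => (-1) *: serD N%:R F k + phi k.
have psi0 i : (i < N)%N -> psi i = 0.
  by move=> iN; rewrite /psi scaleN1r Fk // addNr.
have cE : N.+1%:R - 3 = 2 * N%:R - 1 - N.+1%:R :> R by rewrite -natr1; ring.
have -> : serL N.+1 phi = serL N.+1 psi.
  rewrite /serL /psi serDn_lin.
  have -> : N.+1%:R - 3 = N%:R - 2 :> R by rewrite -natr1; ring.
  rewrite -[serDn N _ (serD _ _)]/(serDn N.+1 N%:R F).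
  rewrite (@serDn_congr _ _ (fun=> 0)) //.
  by rewrite serDn0 scaler0 add0r.
rewrite /serL cE serDn_lead // prod_serkappa; congr (_ *: _).
by rewrite /psi /serD subrr mulr0 scale0r add0r scaleN1r addrC.
Qed.

(** Course-of-values recursion: stage [k] is a table whose entries up to [k] are final, and stage
    [k + 1] extends it by one coefficient. The inverse is 0 at a resonance [k + 1 + d = 0], which
    [serCS] has to exclude. *)
Fixpoint serCrec (d : R) (v : V) (k : nat) : nat -> V :=
  if k is k'.+1 then fun i =>
    if (i <= k')%N then serCrec d v k' i else
    (2 * k'.+1%:R * (k'.+1%:R + d))^-1
      *: \sum_(j < k'.+1) M j (serCrec d v k' (k' - j)%N)
  else fun=> v.

(* [serC k d v] is the k-th coefficient of the solution [F] with [F_0 = v] of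
   [2 rho F'' + 2 (d + 1) F' = sum_j rho^j M_j F]. *)
Definition serC (k : nat) (d : R) (v : V) : V := serCrec d v k k.

Lemma serCrecE d v k i : (i <= k)%N -> serCrec d v k i = serC i d v.
Proof.
elim: k => [|k IH]; first by rewrite leqn0 => /eqP ->.
rewrite leq_eqVlt => /predU1P[-> //|ik].
by rewrite /= -ltnS ik IH.
Qed.

Lemma serC0 d v : serC 0 d v = v. Proof. by []. Qed.

Lemma serCS k d v : k.+1%:R + d != 0 ->
  (2 * k.+1%:R * (k.+1%:R + d)) *: serC k.+1 d v
  = \sum_(j < k.+1) M j (serC (k - j)%N d v).
Proof.
move=> kd; rewrite /serC /= ltnn scalerA mulfV ?scale1r; last first.
  by rewrite !mulf_neq0 // pnatr_eq0.
by apply: eq_bigr => j _; rewrite serCrecE // leq_subr.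
Qed.

(** The normalisation is forced by [serL_inversion]: its top term [-2 N alpha_N serL N phi] must
    contain the top coefficient of [phi] with factor 1, and [serL N] multiplies that coefficient by
    [serkappa N]. *)
Definition seralpha (a : nat) : R := ((-2) ^+ a * (a`!)%:R * (a.-1`!)%:R)^-1.

Lemma seralphaE N : seralpha N.+1 = - (2 * N.+1%:R * serkappa N.+1)^-1.
Proof.
rewrite /seralpha /serkappa /= -invrN; congr (_^-1).
by rewrite factS natrM exprS; ring.
Qed.

(** The coefficients of [sum_a x_a rho^(a+1) C_(a+1)(v_a)], a combination of the solutions of
    [D_a H = 0] that belong to the exponent [a + 1]. *)
Definition serE (x : nat -> R) (v : nat -> V) (k : nat) : V :=
  \sum_(a < k) x a *: serC (k.-1 - a) a.+1%:R (v a).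

(** Each summand [H] satisfies [M H = 2 rho H'' - 2 a H'], whose coefficient at [rho^k] is
    [2 (k + 1) (k - a) H_(k+1)]. Thus [M] is traded for scalars. *)
Lemma serE_convol x v k :
  \sum_(j < k.+1) M j (serE x v (k - j)) =
  \sum_(a < k.+1) (2 * (k - a)%:R * k.+1%:R * x a)
      *: serC (k - a) a.+1%:R (v a).
Proof.
pose X j a : V := M j (x a *: serC ((k - j).-1 - a) a.+1%:R (v a)).
transitivity (\sum_(j < k.+1) \sum_(a < k.+1 | (a < k - j)%N) X j a).
  apply: eq_bigr => j _; rewrite /serE linear_sum.
  by rewrite (big_ord_widen k.+1 (X j)) // leqW // leq_subr.
rewrite (exchange_big_dep xpredT) //=; apply: eq_bigr => -[a ak] _ /=.
transitivity (\sum_(j < k - a) X j a).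
  rewrite (big_ord_widen k.+1 (X^~ a)) ?leqW ?leq_subr //.
  by apply: eq_bigl => -[j jk] /=; lia.
case E : (k - a)%N => [|m]; first by rewrite big_ord0 mulr0 !mul0r scale0r.
have kE : k.+1%:R = m.+1%:R + a.+1%:R :> R.
  by rewrite -natrD; congr (_%:R); lia.
rewrite kE mulrC -scalerA serCS; last by rewrite -kE pnatr_eq0.
rewrite scaler_sumr; apply: eq_bigr => -[j jm] _ /=.
by rewrite /X linearZ /=; congr (_ *: M _ (serC _ _ _)); lia.
Qed.

(* In the proof, [serE x v] is an explicit solution [F] of the equation in
   [serL_obstruction], obtained from the induction hypothesis. *)
Lemma serL_inversion phi N :
  phi N = - (2 * N.+1%:R) *: serE (fun a => seralpha a.+1)
                                  (fun a => serL a.+1 phi) N.+1.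
Proof.
elim/ltn_ind: N => N IH.
set v := fun a => serL a.+1 phi.
(* By induction [phi] agrees below order [N] with [-2] times the derivative of
   [sum_a alpha_(a+1) rho^(a+1) C_(a+1)(v_a)]. Since [D_N] acts on the summand [a] as
   [2 (N - a) d/drho], the solution has coefficients [alpha_(a+1) / (a - N)]. *)
pose x a := seralpha a.+1 / (a.+1%:R - N.+1%:R).
have aN a : (a < N)%N -> a.+1%:R - N.+1%:R != 0 :> R.
  by move=> aN; rewrite subr_eq0 eqr_nat; lia.
have vN : v N = serkappa N.+1 *: (phi N - \sum_(j < N.+1) M j (serE x v (N - j))).
  apply: serL_obstruction => [|k kN]; first by rewrite /serE big_ord0.
  rewrite serE_convol IH // /serE !scaler_sumr -big_split /=.
  apply: eq_bigr => -[a ak] _ /=; rewrite !scalerA -scalerDl; congr (_ *: _).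
  have := aN a (leq_trans ak kN); rewrite /x natrB // -!natr1 => H.
  by field; move: H; congr (~~ (_ == _)); ring.
move: vN; rewrite serE_convol big_ord_recr /= subnn mulr0 !mul0r scale0r addr0.
rewrite /serE big_ord_recr /= subnn serC0.
set S2 := \sum_(i < N) _; set S1 := \sum_(i < N) _ => ->.
have N0 : N.+1%:R != 0 :> R by rewrite pnatr_eq0.
have k0 := serkappa_neq0 N.+1.
have -> : S2 = - (2 * N.+1%:R) *: S1.
  rewrite /S2 /S1 scaler_sumr; apply: eq_bigr => -[a ak] _ /=.
  rewrite scalerA; congr (_ *: _).
  have := aN a ak; rewrite /x natrB 1?ltnW // -!natr1 => H.
  by field; move: H; congr (~~ (_ == _)); ring.
rewrite seralphaE scalerDr !scalerA.
have -> : - (2 * N.+1%:R) * (- (2 * N.+1%:R * serkappa N.+1)^-1 * serkappa N.+1) = 1.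
  by field; rewrite k0 addrC natr1.
by rewrite scale1r scaleNr opprK addrCA addNr addr0.
Qed.

(** Writing the solution as [v + U] turns its equation into an inhomogeneous one for [U] with source
    [M v]. [serL_inversion] applied to that source writes it as a combination of derivatives of the
    special solutions, and on these the equation for [U] divides by [-(d + a + 1)]. *)
Lemma serC_expansion k d v :
  serC k.+1 d%:R v = - serE (fun a => seralpha a.+1 / (d + a.+1)%:R)
                            (fun a => serP a.+1 v) k.+1.
Proof.
elim/ltn_ind: k => k IH.
have kd : k.+1%:R + d%:R != 0 :> R by rewrite -natrD pnatr_eq0.
have c0 : 2 * k.+1%:R * (k.+1%:R + d%:R) != 0 :> R.
  by rewrite !mulf_neq0 // pnatr_eq0.
apply: (scalerI c0); rewrite serCS // big_ord_recr /= subnn serC0.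
pose x a : R := seralpha a.+1 / (d + a.+1)%:R; pose u a := serP a.+1 v.
have -> : \sum_(j < k) M j (serC (k - j) d%:R v)
    = - \sum_(j < k.+1) M j (serE x u (k - j)).
  rewrite [in RHS]big_ord_recr /= subnn {2}/serE big_ord0 [M _ _]linear0 addr0.
  rewrite -sumrN; apply: eq_bigr => -[j jk] _ /=.
  have -> : (k - j = (k - j.+1).+1)%N by lia.
  by rewrite -linearN -IH //; lia.
rewrite (serL_inversion (fun j => M j v)) serE_convol /serE -/u.
rewrite scalerN !scaler_sumr -!sumrN -big_split /=.
apply: eq_bigr => -[a ak] _ /=; rewrite !scalerA.
rewrite -[RHS]scaleNr -[X in X + _ = _]scaleNr -[LHS]scalerDl.
congr (_ *: _).
have da : d%:R + a%:R + 1 != 0 :> R by rewrite -natrD natr1 pnatr_eq0.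
by rewrite /x natrB // natrD -!natr1; field; rewrite addrA.
Qed.

(** The weights of the iterated [serC_expansion]. The second index of [serC] becomes the entry just
    used, so that consecutive entries are added in the denominators. *)
Fixpoint serw (d : nat) (J : seq nat) : R :=
  if J is b :: J' then - (seralpha b / (d + b)%:R) * serw b J' else 1.

(* The compositions of [k], for [k <= m]; [m] only serves as fuel. *)
Fixpoint compositions (m k : nat) : seq (seq nat) :=
  match k, m with
  | 0, _ => [:: [::]]
  | _, 0 => [::]
  | k'.+1, m'.+1 =>
      [seq rcons J b | b <- iota 1 k, J <- compositions m' (k - b)]
  end.

(** In [serC_expansion] the operator [serP b] reaches [v] before all others, so [b] is the last
    entry of the composition. Hence [compositions] appends at the end, while [serw] reads the
    reversed list. *)
Lemma serC_compositions m k d v : (k <= m)%N ->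
  serC k d%:R v =
  \sum_(I <- compositions m k) serw d (rev I) *: foldr serP v I.
Proof.
elim: m k d v => [|m IH] [|k] d v //.
- by rewrite big_seq1 scale1r.
- by rewrite big_seq1 scale1r.
move=> km; rewrite serC_expansion /serE big_allpairs_dep.
rewrite -sumrN (iotaDl 1 0) big_map -[iota 0 k.+1]/(index_iota 0 k.+1) big_mkord.
apply: eq_bigr => -[a ak] _ /=; rewrite IH; last by lia.
rewrite subSS -scaleNr scaler_sumr; apply: eq_bigr => I _.
by rewrite rev_rcons foldr_rcons scalerA.
Qed.

Lemma serPZ N c v : serP N (c *: v) = c *: serP N v.
Proof.
rewrite /serP /serL (_ : (fun j => _) = fun j => c *: M j v) ?serDnZ //.
by apply/funext => j; rewrite linearZ.
Qed.

Lemma foldr_serPZ I c v : foldr serP (c *: v) I = c *: foldr serP v I.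
Proof. by elim: I => //= N I ->; rewrite serPZ. Qed.

(** [serL_inversion] solved for its last term [a = N], in which [serC 0] is the identity; the other
    [serC] are expanded over compositions. This is the algebraic form of the final identity. *)
Lemma serL_recursion N phi :
  serL N.+1 phi = serkappa N.+1 *: phi N
  - \sum_(a < N) \sum_(I <- compositions N.+1 (N - a))
      (seralpha a.+1 / seralpha N.+1 * serw a.+1 (rev I))
        *: foldr serP (serL a.+1 phi) I.
Proof.
have k0 := serkappa_neq0 N.+1.
have N0 : N.+1%:R != 0 :> R by rewrite pnatr_eq0.
rewrite (serL_inversion phi) /serE big_ord_recr /= subnn serC0 scalerDr.
rewrite seralphaE !scalerA mulrNN.
have -> : 2 * N.+1%:R / (2 * N.+1%:R * serkappa N.+1) = (serkappa N.+1)^-1.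
  by field; rewrite k0 addrC natr1.
rewrite scalerDr !scalerA mulfV // scale1r addrAC -[LHS]add0r; congr (_ + _).
rewrite scaler_sumr -sumrB big1 // => -[a aN] _ /=.
rewrite (@serC_compositions N.+1) ?leqW ?leq_subr // !scaler_sumr -sumrB.
rewrite big1 // => I _; rewrite !scalerA -scalerBl.
rewrite (_ : _ - _ = 0) ?scale0r //.
by field; rewrite k0 addrC natr1.
Qed.

End FormalSeries.

(** * Compositions as a finite index set *)

Lemma mem_compositions m k I : (k <= m)%N ->
  (I \in compositions m k) = all (leq 1) I && (sumn I == k).
Proof.
elim: m k I => [|m IH] [|k] I // km.
- rewrite inE; case: I => [|i I] //=; rewrite ?andbF //.
  by case: i => //= i; rewrite andbF.
- rewrite inE; case: I => [|i I] //=; rewrite ?andbF //.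
  by case: i => //= i; rewrite andbF.
apply/allpairsPdep/idP => [[b [J [bk Jk ->]]]|].
  rewrite mem_iota in bk; rewrite IH in Jk; last by lia.
  case/andP: Jk => J1 /eqP Jk; rewrite all_rcons J1 sumn_rcons Jk.
  by apply/andP; split; lia.
case/lastP: I => [|J b] //; rewrite all_rcons sumn_rcons => /andP[/andP[b1 J1]] /eqP E.
exists b, J; split=> //; first by rewrite mem_iota; lia.
by rewrite IH ?J1; [apply/eqP|]; lia.
Qed.

Lemma uniq_compositions m k : uniq (compositions m k).
Proof.
elim: m k => [|m IH] [|k] //.
apply: allpairs_uniq_dep => [|b _|]; [exact: iota_uniq|exact: IH|].
move=> [b I] [c J] _ _ /= /rcons_inj[-> bc].
by rewrite bc.
Qed.

(** The bounds in the index type lose nothing: the entries are positive with sum [k <= N], so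
    neither the length nor any entry exceeds [N]. *)
Lemma sum_compositions (V : nmodType) N k (G : seq nat -> V) : (k <= N)%N ->
  \sum_(I : {bseq N of 'I_N.+1} | all (leq 1) (map val I) && (sumn (map val I) == k))
    G (map val I)
  = \sum_(I <- compositions N k) G I.
Proof.
move=> kN; rewrite -big_filter.
rewrite -(big_map (fun I : {bseq N of 'I_N.+1} => map val I) xpredT G).
apply: perm_big; apply: uniq_perm; [|exact: uniq_compositions|].
  rewrite map_inj_in_uniq ?filter_uniq ?index_enum_uniq // => I J _ _ E.
  exact/val_inj/(inj_map val_inj).
move=> I; rewrite mem_compositions //; apply/mapP/idP => [[J]|Ik].
  by rewrite mem_filter => /andP[Jk _] ->.
have [I1 /eqP sI] := andP Ik.
have sz : (size I <= N)%N.
  apply: leq_trans kN; rewrite -sI; elim: I I1 {Ik sI} => //= i I IH /andP[i1 I1].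
  by have := IH I1; lia.
have bd i : i \in I -> (i < N.+1)%N.
  move=> iI; rewrite ltnS; apply: leq_trans kN; rewrite -sI.
  elim: I iI {Ik I1 sI sz} => //= j I IH; rewrite inE => /predU1P[->|/IH]; lia.
have E : map val (map (@inord N) I) = I.
  rewrite -map_comp -[RHS]map_id; apply/eq_in_map => i /bd iN /=.
  by rewrite inordK.
have sz' : (size (map (@inord N) I) <= N)%N by rewrite size_map.
exists (Bseq sz') => //=; rewrite mem_filter mem_index_enum andbT /=.
by rewrite E.
Qed.

(** * Continuously differentiable functions *)

Section Lines.
Variables (R : realType) (V : normedModType R).
Implicit Types (f : V -> R) (x v : V).

Lemma derivable_line f x v (s : R) :
  derivable (fun h : R => f (x + h *: v)) s 1 <-> derivable f (x + s *: v) v.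
Proof.
rewrite /derivable; set F := fun h => _; set G := fun h => _.
suff -> : F = G by [].
apply/funext => h; rewrite /F /G /= [_%:A]mulr1 scalerDl.
by rewrite addrCA.
Qed.

Lemma derive_line f x v (s : R) :
  derive1 (fun h : R => f (x + h *: v)) s = 'D_v f (x + s *: v).
Proof.
rewrite derive1E /derive; set F := fun h => _; set G := fun h => _.
suff -> : F = G by [].
by apply/funext => h; rewrite /F /G /= [_%:A]mulr1 scalerDl addrCA.
Qed.

(** The symmetric interval treats both signs of [b] at once, as is needed when [b] is a coordinate
    of an arbitrary increment. *)
Lemma mean_value0 (g : R -> R) b :
  (forall s, `|s| <= `|b| -> derivable g s 1) ->
  exists2 c, `|c| <= `|b| & g b - g 0 = derive1 g c * b.
Proof.
move=> gd.
have cont a c : `|a| <= `|b| -> `|c| <= `|b| -> {within `[a, c], continuous g}.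
  rewrite !ler_norml => ab cb; apply: derivable_within_continuous => s.
  by rewrite in_itv /= => sac; apply: gd; rewrite ler_norml; lra.
have [b0|/ltW b0] := leP 0 b.
  have bE := ger0_norm b0.
  have [||c] := @MVT_segment _ g (derive1 g) 0 b b0.
  - move=> s; rewrite in_itv /= => sb; rewrite derive1E.
    by apply/derivableP/gd; rewrite bE ler_norml; lra.
  - by apply: cont; rewrite ?normr0 ?bE.
  rewrite in_itv /= subr0 => cb ->; exists c => //.
  by rewrite bE ler_norml; lra.
have bE := ler0_norm b0.
have [||c] := @MVT_segment _ g (derive1 g) b 0 b0.
- move=> s; rewrite in_itv /= => sb; rewrite derive1E.
  by apply/derivableP/gd; rewrite bE ler_norml; lra.
- by apply: cont; rewrite ?normr0 ?normr_ge0.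
rewrite in_itv /= => cb E; exists c; first by rewrite bE ler_norml; lra.
by rewrite -opprB E; ring.
Qed.

Lemma mean_value_line f x v (b : R) :
  (forall s, `|s| <= `|b| -> derivable f (x + s *: v) v) ->
  exists2 c, `|c| <= `|b| & f (x + b *: v) - f x = 'D_v f (x + c *: v) * b.
Proof.
move=> fd; have [|c cb E] := @mean_value0 (fun h => f (x + h *: v)) b.
  by move=> s sb; apply/derivable_line/fd.
by exists c => //; rewrite -derive_line -E scale0r addr0.
Qed.

End Lines.

Section C1.
Variables (R : realType) (m : nat).
Implicit Types (A : set 'rV[R]_m) (f : 'rV[R]_m -> R).

Lemma norm_coord_le (v : 'rV[R]_m) i : `|v 0 i| <= `|v|.
Proof. by rewrite [leRHS]/Num.Def.normr /= mx_normrE; apply/bigmax_geP; right; exists (0, i). Qed.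

Lemma norm_row_le (v : 'rV[R]_m) (e : R) : 0 <= e ->
  (forall i, `|v 0 i| <= e) -> `|v| <= e.
Proof.
move=> e0 ve; rewrite [leLHS]/Num.Def.normr /= mx_normrE; apply/bigmax_leP; split=> //.
by move=> [i j] _ /=; rewrite ord1.
Qed.

Lemma linear_approx_differentiable (V W : normedModType R) (f : V -> W)
    (L : {linear V -> W}) x : continuous L ->
  (forall e, 0 < e ->
    \forall v \near 0, `|f (v + x) - f x - L v| <= e * `|v|) ->
  differentiable f x.
Proof.
move=> cL H; suff E : f \o shift x = cst (f x) + L +o_ 0 id.
  by apply/diff_locallyP; rewrite (diff_unique cL E).
apply/eqaddoP => e e0; rewrite -nbhs_nearE near_simpl.
by apply: filterS (H e e0) => v /=; rewrite opprD addrA.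
Qed.

(** The increment is telescoped along a path from [x] to [x + v] that changes one coordinate at a
    time. On each leg the mean value theorem produces a partial derivative at a point near [x],
    which continuity compares with its value at [x]. *)
Lemma C1_differentiable A f x : open A -> A x ->
  (forall i y, A y -> derivable f y (delta_mx 0 i)) ->
  (forall i, {for x, continuous (partial i f)}) ->
  differentiable f x.
Proof.
move=> oA Ax fd fc.
pose L (v : 'rV[R]_m) : R := \sum_i v 0 i * partial i f x.
have linL : linear L.
  move=> a u v; rewrite /L scaler_sumr -big_split /=.
  by apply: eq_bigr => i _; rewrite !mxE mulrDl -mulrA.
pose LM := GRing.isLinear.Build _ _ _ _ _ linL.
pose LL : {linear _ -> _} := HB.pack L LM.
have cL : continuous L.
  apply: continuous_big => [z|i _ y]; first exact: add_continuous.
  apply: (@continuousM _ _ (fun y : 'rV[R]_m => y 0 i) (cst (partial i f x)) y).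
    exact: coord_continuous.
  exact: cst_continuous.
apply: (@linear_approx_differentiable _ _ f LL) => // e e0.
(* The successor avoids division by zero for [m = 0]; the [m] errors together still stay below
   [e]. *)
pose e' := e / m.+1%:R.
have e'0 : 0 < e' by rewrite divr_gt0.
have FF : Filter (nbhs x) := nbhs_filter x.
have near1 : \forall y \near x, forall i, `|partial i f x - partial i f y| < e'.
  apply: (@filter_forall 'rV[R]_m 'I_m (fun i y => `|partial i f x - partial i f y| < e') (nbhs x) FF).
  by move=> i; have /cvgrPdist_lt := fc i; apply.
have near2 : \forall y \near x, A y by exact: open_nbhs_nbhs.
have /(@nbhs_ballP R)[d /= d0 near] := @filterI _ _ FF _ _ near2 near1.
rewrite -ball_normE /= in near.
apply/nbhs_ballP; exists d => //=.
rewrite -ball_normE /= => v /=; rewrite sub0r normrN => vd.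
pose p k : 'rV[R]_m := x + \row_j (if (j < k)%N then v 0 j else 0).
have pd (i : 'I_m) s : `|s| <= `|v 0 i| -> `|x - (p i + s *: delta_mx 0 i)| < d.
  move=> sv; apply: le_lt_trans vd; rewrite /p -addrA opprD addNKr.
  rewrite normrN.
  apply: norm_row_le => // j; rewrite !mxE eqxx /=.
  have [->|ji] := eqVneq j i; first by rewrite ltnn add0r mulr1 (le_trans sv) ?norm_coord_le.
  by rewrite mulr0 addr0; case: ifP => _; rewrite ?normr0 // norm_coord_le.
have pS (i : 'I_m) : p i.+1 = p i + v 0 i *: delta_mx 0 i.
  rewrite /p -addrA; congr (_ + _); apply/rowP => j; rewrite !mxE eqxx /=.
  have [->|ji] := eqVneq j i; first by rewrite ltnSn ltnn add0r mulr1.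
  by rewrite mulr0 addr0 ltnS leq_eqVlt (negbTE (ji : (j : nat) != i)).
have p0 : p 0%N = x.
  by rewrite /p; apply/rowP => j; rewrite !mxE addr0.
have pm : p m = v + x.
  by rewrite /p addrC; congr (_ + _); apply/rowP => j; rewrite !mxE ltn_ord.
have E : f (v + x) - f x = \sum_(i < m) (f (p i.+1) - f (p i)).
  by rewrite -(big_mkord xpredT (fun i => f (p i.+1) - f (p i))) telescope_sumr // pm p0.
have inA (i : 'I_m) s : `|s| <= `|v 0 i| -> A (p i + s *: delta_mx 0 i) /\
    `|partial i f x - partial i f (p i + s *: delta_mx 0 i)| < e'.
  by move=> sv; have [? H] := near _ (pd i s sv); split.
rewrite E /= /L -sumrB.
apply: (le_trans (ler_norm_sum _ _ _)).
apply: (@le_trans _ _ (\sum_(i < m) e' * `|v|)); last first.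
  rewrite sumr_const card_ord -[X in X <= _]mulr_natr /e'.
  rewrite mulrAC; apply: ler_wpM2r => //.
  by rewrite -mulrA ler_piMr ?(ltW e0) // mulrC ler_pdivrMr // mul1r ler_nat.
apply: ler_sum => i _; rewrite pS.
have [|c cv ->] := @mean_value_line _ _ f (p i) (delta_mx 0 i) (v 0 i).
  by move=> s sv; apply: fd; have [] := inA i s sv.
have [_ {}H] := inA i c cv.
rewrite mulrC -mulrBr normrM mulrC ler_pM ?norm_coord_le //.
by rewrite distrC ltW.
Qed.

(* d2f/dv du and d2f/du dv both appear as the mean value of the same second
   difference of f over small parallelograms. *)
Lemma derive_comm A f x (u v : 'rV[R]_m) : open A -> A x ->
  (forall y, A y -> derivable f y u) -> (forall y, A y -> derivable f y v) ->
  (forall y, A y -> derivable ('D_u f) y v) ->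
  (forall y, A y -> derivable ('D_v f) y u) ->
  {for x, continuous ('D_v ('D_u f))} -> {for x, continuous ('D_u ('D_v f))} ->
  'D_v ('D_u f) x = 'D_u ('D_v f) x.
Proof.
move=> oA Ax fu fv fuv fvu cuv cvu.
have close (e a b y : R) : `|a - y| < e / 2 -> `|b - y| < e / 2 -> `|a - b| <= e.
  rewrite [`|b - y|]distrC [e in _ <= e]splitr => ay yb.
  by rewrite -(subrKA y) (le_trans (ler_normD _ _)) // ltW // ltrD.
apply/eqP; rewrite -subr_eq0 -normr_le0; apply/ler_addgt0Pl => e e0.
rewrite addr0.
have e2 : 0 < e / 2 by rewrite divr_gt0.
have n1 : nbhs x A by exact: open_nbhs_nbhs.
have FF : Filter (nbhs x) := nbhs_filter x.
have n2 : \forall t \near x, `|'D_v ('D_u f) x - 'D_v ('D_u f) t| < e / 2.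
  by move/cvgrPdist_lt : cuv; apply.
have n3 : \forall t \near x, `|'D_u ('D_v f) x - 'D_u ('D_v f) t| < e / 2.
  by move/cvgrPdist_lt : cvu; apply.
have /(@nbhs_ballP R)[d /= d0 near] := @filterI _ _ FF _ _ n1 (@filterI _ _ FF _ _ n2 n3).
rewrite -ball_normE /= in near.
pose C := `|u| + `|v| + 1.
have C0 : 0 < C by rewrite ltr_wpDl // addr_ge0.
have [h h0 hC] : exists2 h, 0 < h & h * C < d.
  exists (d / C / 2); first by rewrite !divr_gt0.
  by rewrite mulrAC divfK ?gt_eqF // ltr_pdivrMr //; lra.
have inb (a b : R) : `|a| <= `|h| -> `|b| <= `|h| -> `|x - (x + a *: u + b *: v)| < d.
  rewrite (gtr0_norm h0) => ah bh.
  rewrite -addrA opprD addNKr normrN.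
  apply: (le_lt_trans (ler_normD _ _)); rewrite !normrZ.
  apply: le_lt_trans hC; rewrite /C !mulrDr mulr1 -[X in X <= _]addr0; apply: lerD; last exact: ltW.
  by apply: lerD; apply: ler_wpM2r.
have inA (a b : R) : `|a| <= `|h| -> `|b| <= `|h| -> A (x + a *: u + b *: v).
  by move=> ah bh; have [] := near _ (inb a b ah bh).
have hh : `|h| <= `|h| by [].
have h00 : `|0 : R| <= `|h| by rewrite normr0.
(* The mean value theorem is used twice: along [a] for the difference [G] of two parallel slices,
   then along [b] for the derivative so obtained. *)
have mixed (a b : 'rV[R]_m) (g : R -> R -> 'rV[R]_m) :
   (forall s t, g s t = x + s *: a + t *: b) ->
   (forall s t : R, `|s| <= `|h| -> `|t| <= `|h| -> A (g s t)) ->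
   (forall y, A y -> derivable f y a) ->
   (forall y, A y -> derivable ('D_a f) y b) ->
   exists s t : R, [/\ `|s| <= `|h|, `|t| <= `|h| &
     f (g h h) - f (g h 0) - f (g 0 h) + f (g 0 0) = 'D_b ('D_a f) (g s t) * h * h].
  move=> gE gA fa fab.
  pose G (s : R) := f (g s h) - f (g s 0).
  have dG (s : R) : `|s| <= `|h| -> is_derive s (1 : R) G ('D_a f (g s h) - 'D_a f (g s 0)).
    move=> sh.
    have gl t : (fun s => f (g s t)) = (fun s => f (x + t *: b + s *: a)).
      by apply/funext => s'; rewrite gE addrAC.
    have dl (t : R) : `|t| <= `|h| -> is_derive s (1 : R) (fun s => f (g s t)) ('D_a f (g s t)).
      move=> th; rewrite gl; split.
        by apply/derivable_line; apply: fa; rewrite addrAC -gE; exact: gA.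
      by rewrite -derive1E derive_line gE addrAC.
    exact: (is_deriveB (dl h hh) (dl 0 h00)).
  have [|s sh] := @mean_value0 R G h.
    by move=> s sh; have [] := dG s sh.
  rewrite derive1E; have [_ ->] := dG s sh.
  have [|t th] := @mean_value_line _ _ ('D_a f) (x + s *: a) b h.
    by move=> t th; apply: fab; rewrite -gE; exact: gA.
  rewrite -!gE [g s 0]gE scale0r addr0 => -> E.
  by exists s, t; split=> //; rewrite -E /G; ring.
have [s [t [sh th E1]]] := mixed u v (fun s t => x + s *: u + t *: v)
  (fun _ _ => erefl) inA fu fuv.
have [||s' [t' [sh' th' E2]]] := mixed v u (fun s t => x + t *: u + s *: v) _ _ fv fvu.
- by move=> *; rewrite addrAC.
- by move=> *; apply: inA.
have E : 'D_v ('D_u f) (x + s *: u + t *: v) = 'D_u ('D_v f) (x + t' *: u + s' *: v).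
  have hn : h * h != 0 by rewrite mulf_neq0 ?gt_eqF.
  apply: (mulIf hn); rewrite [LHS]mulrA [RHS]mulrA -[LHS]E1 -[RHS]E2 /=.
  by congr (_ + _); rewrite addrAC.
have [_ [H1 _]] := near _ (inb s t sh th).
have [_ [_ H2]] := near _ (inb t' s' th' sh').
rewrite E /= in H1; rewrite /= in H2.
exact: close H1 H2.
Qed.

End C1.

(** Only a directional derivative of [f] is assumed, so the composition is restricted to the line
    through [x], where the chain rule in one variable applies. *)
Lemma is_derive_comp1 (R : realType) (V : normedModType R) (phi : R -> R)
    (f : V -> R) x v : derivable f x v -> derivable phi (f x) 1 ->
  is_derive x v (fun y => phi (f y)) (derive1 phi (f x) * 'D_v f x).
Proof.
suff H s : derivable f (x + s *: v) v -> derivable phi (f (x + s *: v)) 1 ->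
    is_derive (x + s *: v) v (fun y => phi (f y))
      (derive1 phi (f (x + s *: v)) * 'D_v f (x + s *: v)).
  by have := H 0; rewrite scale0r addr0.
move=> /(derivable_line f x v s).2 df dphi.
have dG : derivable (fun h : R => phi (f (x + h *: v))) s 1.
  have /derivable1_diffP d1 := df; have /derivable1_diffP d2 := dphi.
  exact/derivable1_diffP/(differentiable_comp d1 d2).
split; first exact: (derivable_line (fun y => phi (f y)) x v s).1.
rewrite -(derive_line (fun y => phi (f y))) -derive_line.
exact: (derive1_comp df dphi).
Qed.

(** * Smooth functions in coordinates *)

Section SmoothOn.
Variables (R : realType) (m : nat) (A : set 'rV[R]_m).
Hypothesis oA : open A.
Implicit Types (f g : 'rV[R]_m -> R).

Lemma open_near_eq f g x : A x -> (forall y, A y -> f y = g y) ->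
  \forall y \near x, f y = g y.
Proof. by move=> Ax fg; apply: filterS (open_nbhs_nbhs (conj oA Ax)). Qed.

Lemma eq_partial f g i x : A x -> (forall y, A y -> f y = g y) ->
  partial i f x = partial i g x.
Proof. by move=> Ax fg; apply: near_eq_derive; exact: open_near_eq. Qed.

Lemma eq_Ck k f g : (forall y, A y -> f y = g y) -> Ck_on k A f -> Ck_on k A g.
Proof.
elim: k f g => [|k IH] f g fg /=.
  move=> fc x Ax; rewrite /prop_for /continuous_at -fg //.
  have gf : {near x, f =1 g} by exact: open_near_eq.
  exact: (cvg_trans (near_eq_cvg gf) (fc x Ax)).
move=> fC i; have [fd fk] := fC i; split=> [x Ax|].
  by apply: near_eq_derivable (fd x Ax); exact: open_near_eq.
by apply: IH fk => y Ay; exact: eq_partial.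
Qed.

Lemma eq_smooth f g : (forall y, A y -> f y = g y) ->
  smooth_on A f -> smooth_on A g.
Proof. by move=> fg fs k; exact: eq_Ck (fs k). Qed.

(** Coinduction for smoothness: a class of continuous functions that is stable under partial
    derivatives, up to equality on [A], consists of smooth functions. It avoids Leibniz or chain
    rules of order [k]. *)
Lemma smooth_coind (P : ('rV[R]_m -> R) -> Prop) :
  (forall f, P f -> (forall x, A x -> {for x, continuous f}) /\
     forall i, (forall x, A x -> derivable f x (delta_mx 0 i)) /\
       exists2 g, P g & forall x, A x -> g x = partial i f x) ->
  forall f, P f -> smooth_on A f.
Proof.
move=> HP f Pf k; elim: k f Pf => [|k IH] f /HP[fc fd] //= i.
have [fi [g Pg gE]] := fd i; split=> //.
exact: eq_Ck gE (IH g Pg).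
Qed.

Lemma smooth_continuous f x : smooth_on A f -> A x -> {for x, continuous f}.
Proof. by move=> fs; exact: fs 0%N x. Qed.

Lemma smooth_derivable f i x : smooth_on A f -> A x ->
  derivable f x (delta_mx 0 i).
Proof. by move=> fs; exact: (fs 1%N i).1. Qed.

Lemma smooth_partial f i : smooth_on A f -> smooth_on A (partial i f).
Proof. by move=> fs k; exact: (fs k.+1 i).2. Qed.

Lemma smooth_differentiable f x : smooth_on A f -> A x -> differentiable f x.
Proof.
move=> fs Ax; apply: (C1_differentiable oA Ax) => [i y Ay|i].
  exact: smooth_derivable.
exact/(smooth_continuous _ Ax)/smooth_partial.
Qed.

Lemma partialC f i j x : smooth_on A f -> A x ->
  partial i (partial j f) x = partial j (partial i f) x.
Proof.
by move=> fs Ax; apply: (derive_comm oA) => // [y Ay|y Ay|y Ay|y Ay||];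
  do ?[exact: smooth_derivable | exact/smooth_derivable/Ay/smooth_partial
      |exact/(smooth_continuous _ Ax)/smooth_partial/smooth_partial].
Qed.

End SmoothOn.

Section ChangeOfCoordinates.
Variables (R : realType) (m : nat) (A B : set 'rV[R]_m).
Variable psi : 'rV[R]_m -> 'rV[R]_m.
Hypotheses (oA : open A) (oB : open B).
Hypothesis psiAB : forall y, A y -> B (psi y).
Hypothesis psis : forall c, smooth_on A (fun y => psi y 0 c).

Definition jac (y : 'rV[R]_m) : 'M[R]_m :=
  \matrix_(i, c) partial i (fun z => psi z 0 c) y.

Lemma chart_differentiable y : A y -> differentiable psi y.
Proof.
move=> Ay.
have -> : psi = \sum_(c < m) (fun z => psi z 0 c *: delta_mx 0 c).
  apply/funext => z; rewrite fct_sumE [LHS]row_sum_delta.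
  by apply: eq_bigr => c _.
apply: differentiable_sum => c; apply: differentiableZl.
exact: smooth_differentiable (psis c) Ay.
Qed.

(** Tensoriality is stated with the matrix of the differential, while the entries of [jac] are
    partial derivatives and can be differentiated again. *)
Lemma jac_jacobian y : A y -> 'J psi y = jac y.
Proof.
move=> Ay; have dpsi := chart_differentiable Ay.
apply/matrixP => i c; rewrite /jacobian /lin1_mx !mxE.
rewrite -deriveE // derive_mx ?mxE //; exact: diff_derivable.
Qed.

Lemma chain_rule (F : 'rV[R]_m -> R) i y : smooth_on B F -> A y ->
  is_derive y (delta_mx 0 i) (fun z => F (psi z))
    (\sum_c jac y i c * partial c F (psi y)).
Proof.
move=> Fs Ay; have dpsi := chart_differentiable Ay.
have dF := smooth_differentiable oB Fs (psiAB Ay).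
have dFp : differentiable (fun z => F (psi z)) y.
  exact: (differentiable_comp dpsi dF).
split; first exact: diff_derivable.
rewrite deriveE // (diff_comp dpsi dF) /=.
rewrite -(deriveE _ dpsi) derive_mx; last exact: diff_derivable.
rewrite [X in 'd F _ X]row_sum_delta linear_sum /=; apply: eq_bigr => c _.
by rewrite linearZ /= -(deriveE _ dF) !mxE.
Qed.

End ChangeOfCoordinates.

Section SmoothClosure.
Variables (R : realType) (m : nat) (A : set 'rV[R]_m).
Hypothesis oA : open A.
Implicit Types (f g : 'rV[R]_m -> R).

Lemma smooth_cst (c : R) : smooth_on A (fun=> c).
Proof.
apply: (@smooth_coind R m A oA (fun f => exists c, f = fun=> c)); last by exists c.
move=> _ [{}c ->]; split=> [x _|i]; first exact: cst_continuous.
split=> [x _|]; first exact: derivable_cst.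
by exists (fun=> 0) => [|x _]; [exists 0|rewrite /partial derive_cst].
Qed.

(* Each constructor is chosen so that partial derivatives stay in the class,
   which makes [smooth_coind] applicable. *)
Inductive smooth_gen : ('rV[R]_m -> R) -> Prop :=
| Smooth_gen f : smooth_on A f -> smooth_gen f
| Smooth_genD f g : smooth_gen f -> smooth_gen g -> smooth_gen (fun x => f x + g x)
| Smooth_genM f g : smooth_gen f -> smooth_gen g -> smooth_gen (fun x => f x * g x)
| Smooth_genV f : smooth_gen f -> (forall x, A x -> f x != 0) ->
    smooth_gen (fun x => (f x)^-1)
| Smooth_gen_sqrt f : smooth_gen f -> (forall x, A x -> 0 < f x) ->
    smooth_gen (fun x => Num.sqrt (f x))
| Smooth_gen_comp (B : set 'rV[R]_m) (psi : 'rV[R]_m -> 'rV[R]_m) f : open B ->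
    (forall x, A x -> B (psi x)) ->
    (forall c, smooth_on A (fun x => psi x 0 c)) -> smooth_on B f ->
    smooth_gen (fun x => f (psi x)).

Lemma smooth_gen_sum (I : Type) (r : seq I) (F : I -> 'rV[R]_m -> R) :
  (forall i, smooth_gen (F i)) -> smooth_gen (fun x => \sum_(i <- r) F i x).
Proof.
move=> FG; elim: r => [|i r IH].
  rewrite (_ : (fun x => _) = fun=> 0); last by apply/funext => x; rewrite big_nil.
  exact/Smooth_gen/smooth_cst.
rewrite (_ : (fun x => _) = fun x => F i x + \sum_(j <- r) F j x).
  exact: Smooth_genD.
by apply/funext => x; rewrite big_cons.
Qed.

Lemma smooth_gen_smooth f : smooth_gen f -> smooth_on A f.
Proof.
move: f; apply: (smooth_coind oA) => f; elim=> {f}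
  [f fs|f g fg [fc fd] gg [gc gd]|f g fg [fc fd] gg [gc gd]|f fg [fc fd] f0
  |f fg [fc fd] f0|B psi f oB psiAB psis fs].
- split=> [x Ax|i]; first exact: smooth_continuous.
  split=> [x Ax|]; first exact: smooth_derivable.
  by exists (partial i f) => //; exact/Smooth_gen/smooth_partial.
- split=> [x Ax|i]; first by apply: continuousD; [exact: fc|exact: gc].
  have [df [f' f'g f'E]] := fd i; have [dg [g' g'g g'E]] := gd i.
  split=> [x Ax|]; first by apply: derivableD; [exact: df|exact: dg].
  exists (fun x => f' x + g' x) => [|x Ax]; first exact: Smooth_genD.
  rewrite f'E // g'E // /partial -deriveD //; [exact: df|exact: dg].
- split=> [x Ax|i]; first by apply: continuousM; [exact: fc|exact: gc].
  have [df [f' f'g f'E]] := fd i; have [dg [g' g'g g'E]] := gd i.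
  split=> [x Ax|]; first by apply: derivableM; [exact: df|exact: dg].
  exists (fun x => f x * g' x + g x * f' x) => [|x Ax].
    by apply: Smooth_genD; apply: Smooth_genM.
  rewrite f'E // g'E // /partial.
  by rewrite [RHS](deriveM (df x Ax) (dg x Ax)).
- split=> [x Ax|i]; first by apply: continuousV; [exact: f0|exact: fc].
  have [df [f' f'g f'E]] := fd i.
  split=> [x Ax|]; first by apply: derivableV; [exact: f0|exact: df].
  exists (fun x => (-1) * ((f x)^-1 * (f x)^-1 * f' x)) => [|x Ax].
    apply: Smooth_genM; first exact/Smooth_gen/smooth_cst.
    by apply: Smooth_genM => //; apply: Smooth_genM; exact: Smooth_genV.
  rewrite f'E // /partial [RHS](deriveV (f0 x Ax) (df x Ax)).
  by rewrite mulN1r -exprVn scaleNr expr2.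
- have s0 x : A x -> Num.sqrt (f x) != 0.
    by move=> Ax; rewrite gt_eqF // sqrtr_gt0 f0.
  split=> [x Ax|i].
    by apply: (continuous_comp (fc x Ax)); exact: sqrt_continuous.
  have [df [f' f'g f'E]] := fd i.
  have H x : A x -> is_derive x (delta_mx 0 i) (fun y => Num.sqrt (f y))
      ((2 * Num.sqrt (f x))^-1 * partial i f x).
    move=> Ax; have ds := is_derive1_sqrt (f0 x Ax).
    have := @is_derive_comp1 R _ Num.sqrt f x (delta_mx 0 i) (df x Ax).
    by rewrite derive1E derive_val => /(_ (ex_derive (is_derive := ds))).
  split=> [x /H[]//|].
  exists (fun x => (2 * Num.sqrt (f x))^-1 * f' x) => [|x Ax].
    apply: Smooth_genM => //; apply: Smooth_genV.
      apply: Smooth_genM; first exact/Smooth_gen/smooth_cst.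
      exact: Smooth_gen_sqrt.
    by move=> x Ax; rewrite mulf_neq0 ?s0.
  by have [_ E] := H x Ax; rewrite f'E //; exact/esym/E.
- have cr i x (Ax : A x) := chain_rule oA oB psiAB psis i fs Ax.
  split=> [x Ax|i].
    apply: differentiable_continuous.
    apply: (differentiable_comp (chart_differentiable oA psis Ax)).
    exact: (smooth_differentiable oB fs (psiAB x Ax)).
  split=> [x Ax|]; first by have [] := cr i x Ax.
  exists (fun x => \sum_c jac psi x i c * partial c f (psi x)) => [|x Ax].
    apply: smooth_gen_sum => c; apply: Smooth_genM.
      apply: Smooth_gen; apply: (eq_smooth oA _ (smooth_partial i (psis c))).
      by move=> x _; rewrite mxE.
    exact: (Smooth_gen_comp oB psiAB psis (smooth_partial c fs)).
  by have [_ E] := cr i x Ax; exact/esym/E.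
Qed.

Lemma smoothD f g : smooth_on A f -> smooth_on A g ->
  smooth_on A (fun x => f x + g x).
Proof. by move=> fs gs; apply/smooth_gen_smooth/Smooth_genD; exact: Smooth_gen. Qed.

Lemma smoothM f g : smooth_on A f -> smooth_on A g ->
  smooth_on A (fun x => f x * g x).
Proof. by move=> fs gs; apply/smooth_gen_smooth/Smooth_genM; exact: Smooth_gen. Qed.

Lemma smoothV f : smooth_on A f -> (forall x, A x -> f x != 0) ->
  smooth_on A (fun x => (f x)^-1).
Proof. by move=> fs f0; apply/smooth_gen_smooth/Smooth_genV => //; exact: Smooth_gen. Qed.

Lemma smooth_sqrt f : smooth_on A f -> (forall x, A x -> 0 < f x) ->
  smooth_on A (fun x => Num.sqrt (f x)).
Proof. by move=> fs f0; apply/smooth_gen_smooth/Smooth_gen_sqrt => //; exact: Smooth_gen. Qed.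

Lemma smooth_comp (B : set 'rV[R]_m) (psi : 'rV[R]_m -> 'rV[R]_m) f : open B ->
  (forall x, A x -> B (psi x)) -> (forall c, smooth_on A (fun x => psi x 0 c)) ->
  smooth_on B f -> smooth_on A (fun x => f (psi x)).
Proof. by move=> oB psiAB psis fs; apply/smooth_gen_smooth/Smooth_gen_comp; eassumption. Qed.

Lemma smoothZ c f : smooth_on A f -> smooth_on A (fun x => c * f x).
Proof. by move=> fs; apply: smoothM => //; exact: smooth_cst. Qed.

Lemma smooth_sum (I : Type) (r : seq I) (P : pred I) (F : I -> 'rV[R]_m -> R) :
  (forall i, P i -> smooth_on A (F i)) ->
  smooth_on A (fun x => \sum_(i <- r | P i) F i x).
Proof.
move=> Fs; elim: r => [|i r IH].
  by apply: (eq_smooth oA _ (smooth_cst 0)) => y _; rewrite big_nil.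
have [Pi|nPi] := boolP (P i).
  by apply: (eq_smooth oA _ (smoothD (Fs i Pi) IH)) => y _; rewrite big_cons Pi.
by apply: (eq_smooth oA _ IH) => y _; rewrite big_cons (negbTE nPi).
Qed.

Lemma smooth_prod (I : Type) (r : seq I) (P : pred I) (F : I -> 'rV[R]_m -> R) :
  (forall i, P i -> smooth_on A (F i)) ->
  smooth_on A (fun x => \prod_(i <- r | P i) F i x).
Proof.
move=> Fs; elim: r => [|i r IH].
  by apply: (eq_smooth oA _ (smooth_cst 1)) => y _; rewrite big_nil.
have [Pi|nPi] := boolP (P i).
  by apply: (eq_smooth oA _ (smoothM (Fs i Pi) IH)) => y _; rewrite big_cons Pi.
by apply: (eq_smooth oA _ IH) => y _; rewrite big_cons (negbTE nPi).
Qed.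

Lemma smooth_det n (B : 'rV[R]_m -> 'M[R]_n) :
  (forall i j, smooth_on A (fun x => B x i j)) ->
  smooth_on A (fun x => \det (B x)).
Proof.
move=> Bs; rewrite /determinant; apply: smooth_sum => s _.
by apply: smoothZ; exact: smooth_prod.
Qed.

Lemma smooth_invmx n (B : 'rV[R]_m -> 'M[R]_n) :
  (forall i j, smooth_on A (fun x => B x i j)) ->
  (forall x, A x -> B x \in unitmx) ->
  forall i j, smooth_on A (fun x => invmx (B x) i j).
Proof.
move=> Bs Bu i j.
have dV : smooth_on A (fun x => (\det (B x))^-1).
  by apply: smoothV => [|x /Bu]; [exact: smooth_det|rewrite unitmxE unitfE].
have cof : smooth_on A (fun x => cofactor (B x) j i).
  apply: smoothZ; apply: smooth_det => k l.
  by apply: (eq_smooth oA _ (Bs (lift j k) (lift i l))) => y _; rewrite !mxE.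
apply: (eq_smooth oA _ (smoothM dV cof)) => x /Bu Ux.
by rewrite /invmx Ux !mxE.
Qed.

Lemma partial_cst c (i : 'I_m) (x : 'rV[R]_m) : partial i (fun=> c : R) x = 0.
Proof. exact: derive_cst. Qed.

Lemma partialD f g i x : smooth_on A f -> smooth_on A g -> A x ->
  partial i (fun x => f x + g x) x = partial i f x + partial i g x.
Proof. by move=> fs gs Ax; rewrite /partial -deriveD //; exact: smooth_derivable. Qed.

Lemma partialM f g i x : smooth_on A f -> smooth_on A g -> A x ->
  partial i (fun x => f x * g x) x = partial i f x * g x + f x * partial i g x.
Proof.
move=> fs gs Ax; rewrite addrC [X in _ + X]mulrC /partial.
by rewrite [LHS](deriveM (smooth_derivable (i:=i) fs Ax) (smooth_derivable (i:=i) gs Ax)).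
Qed.

Lemma partialZ c f i x : smooth_on A f -> A x ->
  partial i (fun x => c * f x) x = c * partial i f x.
Proof.
move=> fs Ax; rewrite (partialM _ (smooth_cst c) fs) //.
by rewrite partial_cst mul0r add0r.
Qed.

End SmoothClosure.

(* The [w i] are zero or basis vectors, as for inclusions and projections of
   coordinate subspaces. *)
Lemma smooth_comp_affine (R : realType) k m (A : set 'rV[R]_m)
    (B : set 'rV[R]_k) (L : 'rV[R]_k -> 'rV[R]_m) (w : 'I_k -> 'rV[R]_m) f :
  open A -> open B -> continuous L ->
  (forall x i (h : R), L (x + h *: delta_mx 0 i) = L x + h *: w i) ->
  (forall i, w i = 0 \/ exists j, w i = delta_mx 0 j) ->
  (forall x, B x -> A (L x)) ->
  smooth_on A f -> smooth_on B (fun x => f (L x)).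
Proof.
move=> oA oB cL Lw wE BA fs.
apply: (@smooth_coind _ _ _ oB (fun g => exists2 f, smooth_on A f & g = fun x => f (L x)));
  last by exists f.
move=> _ [{fs}f fs ->]; split=> [x Bx|i].
  apply: continuous_comp; first exact: cL.
  exact: smooth_continuous fs (BA _ Bx).
have DL x : derivable (fun x => f (L x)) x (delta_mx 0 i) = derivable f (L x) (w i)
     /\ 'D_(delta_mx 0 i) (fun x => f (L x)) x = 'D_(w i) f (L x).
  rewrite /derivable /derive; set F := fun h => _; set G := fun h => _.
  suff -> : F = G by [].
  by apply/funext => h; rewrite /F /G /= [h *: _ + x]addrC Lw [L x + _]addrC.
have [w0|[j wj]] := wE i.
  split=> [x Bx|]; first by rewrite (DL x).1 w0; exact: derivable0.
  exists (fun=> 0) => [|x Bx]; first by exists (fun=> 0) => //; exact: smooth_cst.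
  by rewrite /partial (DL x).2 w0 derive0.
split=> [x Bx|].
  by rewrite (DL x).1 wj; exact: smooth_derivable fs (BA _ Bx).
exists (fun x => partial j f (L x)) => [|x Bx].
  by exists (partial j f) => //; exact: smooth_partial.
by rewrite /partial (DL x).2 wj.
Qed.

Lemma is_derive_line (R : realType) (V : normedModType R) (f : V -> R) x v df :
  is_derive (0 : R) (1 : R) (fun s : R => f (x + s *: v)) df -> is_derive x v f df.
Proof.
case=> fd E; have x0 : x + 0 *: v = x by rewrite scale0r addr0.
split; first by have := (derivable_line f x v 0).1 fd; rewrite x0.
by rewrite -E -derive1E derive_line x0.
Qed.

Lemma partial_is_derive (R : realType) m (f : 'rV[R]_m -> R) i x df :
  is_derive x (delta_mx 0 i) f df -> partial i f x = df.
Proof. by case. Qed.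

(** The affine functions of one coordinate include the constants and so form a class stable under
    partial derivatives. *)
Lemma smooth_coord (R : realType) m (A : set 'rV[R]_m) (j : 'I_m) : open A ->
  smooth_on A (fun z => z 0 j).
Proof.
move=> oA.
apply: (@smooth_coind _ _ _ oA (fun f => exists b c : R, f = fun z => c + b * z 0 j)); last first.
  by exists 1, 0; apply/funext => z; rewrite add0r mul1r.
move=> _ [b [c ->]].
have dz i x : is_derive x (delta_mx 0 i) (fun z : 'rV[R]_m => c + b * z 0 j) (b * (j == i)%:R).
  apply: is_derive_line.
  rewrite (_ : (fun s => _) = fun s => (c + b * x 0 j) + (b * (j == i)%:R) * s).
    rewrite -[X in is_derive _ _ _ X]add0r; apply: is_deriveD.
    by rewrite -[X in is_derive _ _ _ X]mulr1; exact: is_deriveZ.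
  by apply/funext => s; rewrite !mxE eqxx /=; ring.
split=> [x _|i].
  apply: (@continuousD _ _ _ (fun=> c) (fun z : 'rV[R]_m => b * z 0 j)).
    exact: cst_continuous.
  apply: (@continuousM _ _ (fun=> b) (fun z : 'rV[R]_m => z 0 j)).
    exact: cst_continuous.
  exact: coord_continuous.
split=> [x _|]; first by have [] := dz i x.
exists (fun=> b * (j == i)%:R) => [|x _].
  by exists 0, (b * (j == i)%:R); apply/funext => z; rewrite mul0r addr0.
by rewrite (partial_is_derive (dz i x)).
Qed.

(** * Coordinate invariance of the Laplacian *)

Section Laplacian.
Variables (R : realType) (m : nat).
Implicit Types (G : 'rV[R]_m -> 'M[R]_m) (f : 'rV[R]_m -> R) (x : 'rV[R]_m).

Definition grad f x : 'cV[R]_m := \col_k partial k f x.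

Definition dmx G (i : 'I_m) x : 'M[R]_m :=
  \matrix_(j, l) partial i (fun y => G y j l) x.

Definition hmx f x : 'M[R]_m := \matrix_(i, j) partial i (partial j f) x.

(* The Laplacian as a function of the inverse metric, the Hessian matrix of
   second derivatives, the derivatives of the metric, and the gradient. *)
Definition lapform (ga X : 'M[R]_m) (D : 'I_m -> 'M[R]_m) (p : 'cV[R]_m) : R :=
  \sum_i \sum_j ga i j * X i j
  - \sum_i (row i ga *m D i *m (ga *m p)) 0 0
  + 2^-1 * \sum_l (ga *m p) l 0 * \tr (ga *m D l).

(** Contraction with the symmetric inverse metric identifies the first two terms of the Christoffel
    symbol; this gives the coefficients 1 and [2^-1] in [lapform]. The matrix form makes later
    changes of variables and block computations possible without indices. *)
Lemma laplacianE G f x : (invmx (G x))^T = invmx (G x) ->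
  laplacian G f x = lapform (invmx (G x)) (hmx f x) (dmx G ^~ x) (grad f x).
Proof.
move=> gT; set ga := invmx (G x) in gT *.
have -> : lapform ga (hmx f x) (dmx G ^~ x) (grad f x)
  = \sum_i \sum_j ga i j * partial i (partial j f) x
    - \sum_i (row i ga *m dmx G i x *m (ga *m grad f x)) 0 0
    + 2^-1 * \sum_l (ga *m grad f x) l 0 * \tr (ga *m dmx G l x).
  rewrite /lapform; congr (_ - _ + _).
  by do 2![apply: eq_bigr => ? _]; rewrite mxE.
have gs i j : ga i j = ga j i.
  by have := congr1 (fun B : 'M[R]_m => B i j) gT; rewrite mxE => ->.
pose d i j l := partial i (fun y => G y j l) x.
pose Y l := (ga *m grad f x) l 0.
have YE l : Y l = \sum_k ga l k * partial k f x.
  by rewrite /Y mxE; apply: eq_bigr => k _; rewrite mxE.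
have U1 : \sum_i (row i ga *m dmx G i x *m (ga *m grad f x)) 0 0
   = \sum_l Y l * \sum_i \sum_j ga i j * d i j l.
  transitivity (\sum_i \sum_l Y l * \sum_j ga i j * d i j l).
    apply: eq_bigr => i _; rewrite mxE; apply: eq_bigr => l _.
    rewrite mulrC; congr (_ * _); rewrite mxE; apply: eq_bigr => j _.
    by rewrite !mxE.
  by rewrite exchange_big; apply: eq_bigr => l _; rewrite mulr_sumr.
have U2 l : \tr (ga *m dmx G l x) = \sum_i \sum_j ga i j * d l i j.
  rewrite exchange_big /mxtrace; apply: eq_bigr => i _; rewrite mxE.
  by apply: eq_bigr => j _; rewrite mxE gs.
have U3 l : \sum_i \sum_j ga i j * d j i l = \sum_i \sum_j ga i j * d i j l.
  by rewrite exchange_big; do 2![apply: eq_bigr => ? _]; rewrite gs.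
have inner i j : \sum_k christoffel G k i j x * partial k f x
   = \sum_l Y l * (2^-1 * (d i j l + d j i l - d l i j)).
  transitivity (\sum_k \sum_l ga l k * partial k f x
                  * (2^-1 * (d i j l + d j i l - d l i j))).
    apply: eq_bigr => k _; rewrite /christoffel -/ga mulr_sumr mulr_suml.
    by apply: eq_bigr => l _; rewrite gs /d; ring.
  rewrite exchange_big; apply: eq_bigr => l _ /=.
  by rewrite YE mulr_suml.
have -> : laplacian G f x = \sum_i \sum_j ga i j * partial i (partial j f) x
    - \sum_l Y l * (2^-1 * \sum_i \sum_j ga i j * (d i j l + d j i l - d l i j)).
  rewrite /laplacian -/ga.
  transitivity (\sum_i \sum_j (ga i j * partial i (partial j f) x -
     \sum_l Y l * (2^-1 * (ga i j * (d i j l + d j i l - d l i j))))).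
    do 2![apply: eq_bigr => ? _]; rewrite /hessian mulrBr; congr (_ - _).
    by rewrite inner mulr_sumr; apply: eq_bigr => l _; ring.
  under eq_bigr => i _ do rewrite sumrB.
  rewrite sumrB; congr (_ - _).
  under eq_bigr => i _ do rewrite exchange_big /=.
  rewrite exchange_big /=; apply: eq_bigr => l _.
  rewrite !mulr_sumr; apply: eq_bigr => i _.
  by rewrite !mulr_sumr; apply: eq_bigr => j _.
rewrite -addrA; congr (_ + _); rewrite U1 mulr_sumr addrC -opprB; congr (- _).
rewrite -sumrB; apply: eq_bigr => l _; rewrite U2 -/(Y l).
transitivity (Y l * (2^-1 * (\sum_i \sum_j ga i j * d i j l
   + \sum_i \sum_j ga i j * d j i l - \sum_i \sum_j ga i j * d l i j))).
  congr (_ * (_ * _)); rewrite -big_split -sumrB; apply: eq_bigr => i _ /=.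
  by rewrite -big_split -sumrB; apply: eq_bigr => j _ /=; rewrite -mulrDr -mulrBr.
by rewrite U3; field.
Qed.

Lemma eq_laplacian (A : set 'rV[R]_m) G G' f f' x : open A -> A x ->
  (forall y, A y -> G y = G' y) -> (forall y, A y -> f y = f' y) ->
  laplacian G f x = laplacian G' f' x.
Proof.
move=> oA Ax GG ff.
have d1 i y : A y -> partial i f y = partial i f' y.
  by move=> Ay; exact: (eq_partial oA).
have d2 i j : partial i (partial j f) x = partial i (partial j f') x.
  by apply: (eq_partial oA _ Ax) => y Ay; exact: d1.
have dG i j k : partial i (fun y => G y j k) x = partial i (fun y => G' y j k) x.
  by apply: (eq_partial oA _ Ax) => y Ay; rewrite GG.
rewrite /laplacian; do 2![apply: eq_bigr => ? _]; rewrite GG //; congr (_ * _).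
rewrite /hessian d2; congr (_ - _).
apply: eq_bigr => k _; rewrite d1 //; congr (_ * _).
rewrite /christoffel GG //; congr (_ * _); apply: eq_bigr => l _.
by rewrite !dG.
Qed.

End Laplacian.

Lemma laplacian_lin (R : realType) m (A : set 'rV[R]_m) (G : 'rV[R]_m -> 'M[R]_m)
    f g (c : R) x : open A -> A x -> smooth_on A f -> smooth_on A g ->
  laplacian G (fun y => f y + c * g y) x = laplacian G f x + c * laplacian G g x.
Proof.
move=> oA Ax fs gs; have cgs := smoothZ oA c gs.
have d1 i y : A y ->
    partial i (fun y => f y + c * g y) y = partial i f y + c * partial i g y.
  by move=> Ay; rewrite (partialD _ fs cgs) // (partialZ oA _ _ gs).
have d2 i j : partial i (partial j (fun y => f y + c * g y)) x
   = partial i (partial j f) x + c * partial i (partial j g) x.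
  rewrite (eq_partial oA _ Ax (d1 j)).
  have fs' := smooth_partial j fs; have gs' := smooth_partial j gs.
  by rewrite (partialD _ fs' (smoothZ oA c gs')) // (partialZ oA _ _ gs').
rewrite /laplacian mulr_sumr -big_split /=; apply: eq_bigr => i _.
rewrite mulr_sumr -big_split /=; apply: eq_bigr => j _.
have -> : hessian G (fun y => f y + c * g y) i j x
    = hessian G f i j x + c * hessian G g i j x.
  rewrite /hessian d2.
  have -> : \sum_k christoffel G k i j x * partial k (fun y => f y + c * g y) x
     = \sum_k christoffel G k i j x * partial k f x
       + c * \sum_k christoffel G k i j x * partial k g x.
    rewrite mulr_sumr -big_split /=; apply: eq_bigr => k _.
    by rewrite d1 //; ring.
  by rewrite mulrBr opprD addrACA.
by ring.
Qed.

Lemma laplacian_cst (R : realType) m (G : 'rV[R]_m -> 'M[R]_m) (c : R) x :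
  laplacian G (fun=> c) x = 0.
Proof.
have d1 (i : 'I_m) : partial i (fun=> c) = (fun=> 0) :> ('rV[R]_m -> R).
  by apply/funext => y; rewrite partial_cst.
rewrite /laplacian big1 // => i _; rewrite big1 // => j _.
rewrite /hessian !d1 partial_cst big1 ?subr0 ?mulr0 // => k _.
by rewrite d1 mulr0.
Qed.

Section MatrixDerivative.
Variables (R : realType) (V : normedModType R) (x v : V).

Lemma is_derive_fsum (I : Type) (r : seq I) (h : I -> V -> R) (dh : I -> R) :
  (forall i, is_derive x v (h i) (dh i)) ->
  is_derive x v (fun y => \sum_(i <- r) h i y) (\sum_(i <- r) dh i).
Proof.
move=> hd; elim: r => [|i r IH].
  rewrite big_nil (_ : (fun y => _) = cst 0); first exact: is_derive_cst.
  by apply/funext => y; rewrite big_nil.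
rewrite big_cons (_ : (fun y => _) = h i + (fun y => \sum_(i <- r) h i y)).
  exact: is_deriveD.
by apply/funext => y; rewrite big_cons.
Qed.

Lemma is_derive_fmul (f g : V -> R) df dg :
  is_derive x v f df -> is_derive x v g dg ->
  is_derive x v (fun y => f y * g y) (df * g x + f x * dg).
Proof.
move=> fd gd; have := is_deriveM fd gd; rewrite addrC.
by congr is_derive; congr (_ + _); exact: mulrC.
Qed.

Definition is_mderive p q (M : V -> 'M[R]_(p, q)) (D : 'M[R]_(p, q)) :=
  forall i j, is_derive x v (fun y => M y i j) (D i j).

Lemma is_mderiveM p q r (M : V -> 'M[R]_(p, q)) (N : V -> 'M[R]_(q, r)) D E :
  is_mderive M D -> is_mderive N E ->
  is_mderive (fun y => M y *m N y) (D *m N x + M x *m E).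
Proof.
move=> MD NE i j; rewrite !mxE -big_split /=.
rewrite (_ : (fun y => _) = fun y => \sum_k M y i k * N y k j).
  by apply: is_derive_fsum => k; apply: is_derive_fmul.
by apply/funext => y; rewrite mxE.
Qed.

Lemma is_mderiveT p q (M : V -> 'M[R]_(p, q)) D :
  is_mderive M D -> is_mderive (fun y => (M y)^T) D^T.
Proof.
move=> MD i j; rewrite mxE (_ : (fun y => _) = fun y => M y j i) //.
by apply/funext => y; rewrite mxE.
Qed.

End MatrixDerivative.

Lemma sum_mul_tr (R : comPzRingType) m (g X : 'M[R]_m) :
  \sum_i \sum_j g i j * X i j = \tr (g *m X^T).
Proof.
apply: eq_bigr => i _; rewrite mxE; apply: eq_bigr => j _.
by rewrite mxE.
Qed.

(** Meant for the second derivatives [H] of a coordinate change, where [HC] is the symmetry of mixed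
    partials; it identifies the two ways in which [H] is contracted below. *)
Lemma sum_row_tr (R : comPzRingType) m (K : 'M[R]_m) (H : 'I_m -> 'M[R]_m)
    (Y : 'cV[R]_m) : (forall i l c, H i l c = H l i c) ->
  \sum_i (row i K *m (H i)^T *m Y) 0 0 = \sum_l Y l 0 * \tr (K *m (H l)^T).
Proof.
move=> HC; transitivity (\sum_i \sum_l \sum_c K i c * H l i c * Y l 0).
  apply: eq_bigr => i _; rewrite mxE; apply: eq_bigr => l _.
  rewrite mxE mulr_suml; apply: eq_bigr => c _.
  by rewrite mxE [(H i)^T c l]mxE HC.
rewrite exchange_big; apply: eq_bigr => l _ /=.
rewrite mulr_sumr; apply: eq_bigr => i _.
rewrite mxE mulr_sumr; apply: eq_bigr => c _.
by rewrite [(H l)^T c i]mxE; ring.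
Qed.

Section Invariance.
Variables (R : realType) (m : nat) (A B : set 'rV[R]_m).
Variable psi : 'rV[R]_m -> 'rV[R]_m.
Hypotheses (oA : open A) (oB : open B).
Hypothesis psiAB : forall y, A y -> B (psi y).
Hypothesis psis : forall c, smooth_on A (fun y => psi y 0 c).

(** The terms with second derivatives of [psi] cancel between the parts of [lapform]. The term [H p]
    of the Hessian reappears in the sum of metric derivatives with the opposite sign. The
    contraction [K H^T] occurs there once and in the trace part twice with factor [2^-1]. *)
Lemma laplacian_invariant (Ga Gb : 'rV[R]_m -> 'M[R]_m) (fa fb : 'rV[R]_m -> R) x :
  A x ->
  (forall i j, smooth_on B (fun y => Gb y i j)) -> smooth_on B fb ->
  (forall y, A y -> Ga y = jac psi y *m Gb (psi y) *m (jac psi y)^T) ->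
  (forall y, A y -> fa y = fb (psi y)) ->
  (Gb (psi x))^T = Gb (psi x) -> Ga x \in unitmx ->
  laplacian Ga fa x = laplacian Gb fb (psi x).
Proof.
move=> Ax Gbs fbs GaE faE Bsym Au.
set J := jac psi x; set Bm := Gb (psi x) in Bsym *.
have AE : Ga x = J *m Bm *m J^T := GaE x Ax.
have Asym : (Ga x)^T = Ga x.
  by rewrite AE !trmx_mul trmxK Bsym mulmxA.
have Ju : J \in unitmx.
  move: Au; rewrite AE !unitmxE !det_mulmx det_tr.
  by rewrite !unitfE !mulf_eq0 !negb_or => /andP[/andP[]].
have Bu : Bm \in unitmx.
  move: Au; rewrite AE !unitmxE !det_mulmx det_tr.
  by rewrite !unitfE !mulf_eq0 !negb_or => /andP[/andP[]].
pose ga := invmx (Ga x); pose gb := invmx Bm.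
have gaT : ga^T = ga by rewrite /ga trmx_inv Asym.
have gbT : gb^T = gb by rewrite /gb trmx_inv Bsym.
have JgaJ : J^T *m ga *m J = gb.
  have : J *m (Bm *m (J^T *m ga *m J)) = J *m 1%:M.
    by rewrite !mulmxA -AE mulmxV // mul1mx mulmx1.
  move=> /(congr1 (mulmx (invmx J))); rewrite !mulKmx //.
  by move=> /(congr1 (mulmx gb)); rewrite mulKmx // mulmx1.
pose H l : 'M[R]_m := \matrix_(i, c) partial l (fun y => jac psi y i c) x.
have HC i j c : H i j c = H j i c.
  have hE k l : H k l c = partial k (partial l (fun z => psi z 0 c)) x.
    rewrite /H [LHS]mxE; congr (partial k _ x); apply/funext => y.
    by rewrite /jac mxE.
  exact: etrans (hE i j) (etrans (partialC oA i j (psis c) Ax) (esym (hE j i))).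
have dJ l : is_mderive x (delta_mx 0 l) (jac psi) (H l).
  move=> i c; rewrite mxE; apply: derivableP.
  rewrite (_ : (fun y => _) = partial i (fun z => psi z 0 c)).
    exact: (smooth_derivable (smooth_partial i (psis c)) Ax).
  by apply/funext => y; rewrite mxE.
pose D l : 'M[R]_m := \sum_e J l e *: dmx Gb e (psi x).
have dB l : is_mderive x (delta_mx 0 l) (fun y => Gb (psi y)) (D l).
  move=> i j; have := chain_rule oA oB psiAB psis l (Gbs i j) Ax.
  congr is_derive; rewrite /D summxE; apply: eq_bigr => e _.
  by rewrite !mxE.
have dA l : dmx Ga l x = H l *m Bm *m J^T + J *m D l *m J^T + J *m Bm *m (H l)^T.
  apply/matrixP => i j; rewrite mxE.
  rewrite (eq_partial oA _ Ax (g := fun y => (jac psi y *m Gb (psi y) *m (jac psi y)^T) i j)); last first.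
    by move=> y /GaE ->.
  have := is_mderiveM (is_mderiveM (dJ l) (dB l)) (is_mderiveT (dJ l)).
  move=> /(_ i j)[_]; rewrite mulmxDl; exact.
have pfa i y : A y -> partial i fa y = \sum_c jac psi y i c * partial c fb (psi y).
  move=> Ay; rewrite (eq_partial oA _ Ay faE).
  by have [] := chain_rule oA oB psiAB psis i fbs Ay.
have gradE : grad fa x = J *m grad fb (psi x).
  apply/colP => i; rewrite !mxE pfa //; apply: eq_bigr => c _.
  by rewrite !mxE.
pose p := grad fb (psi x).
pose F : 'M[R]_m := hmx fb (psi x).
have ppfa i j : partial i (partial j fa) x = (H i *m p) j 0 + (J *m F *m J^T) i j.
  rewrite (eq_partial oA _ Ax (pfa j)) /partial.
  have := @is_derive_fsum R _ x (delta_mx 0 i) _ (index_enum 'I_m)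
    (fun c y => jac psi y j c * partial c fb (psi y))
    (fun c => H i j c * p c 0 + J j c * \sum_d J i d * F d c).
  case.
    move=> c; rewrite [p c 0]mxE; apply: is_derive_fmul; first exact: (dJ i j c).
    have := chain_rule oA oB psiAB psis i (smooth_partial c fbs) Ax.
    by congr is_derive; apply: eq_bigr => d _; rewrite [F d c]mxE.
  move=> _ ->; rewrite big_split /=; congr (_ + _).
    by rewrite [RHS]mxE; apply: eq_bigr => c _.
  rewrite [RHS]mxE; apply: eq_bigr => c _; rewrite [(J *m F) i c]mxE mulrC.
  by rewrite [_^T _ _]mxE.
rewrite (laplacianE (G := Ga)) ?trmx_inv ?Asym // laplacianE ?trmx_inv ?Bsym //.
rewrite /lapform gradE -/ga -/gb -/p.
have t1 : \sum_i \sum_j ga i j * hmx fa x i j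
   = \sum_i (row i ga *m H i *m p) 0 0 + \sum_i \sum_j gb i j * F i j.
  transitivity (\sum_i (row i ga *m H i *m p) 0 0
      + \sum_i \sum_j ga i j * (J *m F *m J^T) i j).
    rewrite -big_split; apply: eq_bigr => i _ /=.
    rewrite -mulmxA mxE -big_split; apply: eq_bigr => j _ /=.
    by rewrite [hmx fa x i j]mxE ppfa mulrDr [row i ga 0 j]mxE.
  rewrite !sum_mul_tr !trmx_mul trmxK !mulmxA -JgaJ.
  by congr (_ + _); rewrite mxtrace_mulC !mulmxA.
pose Y := ga *m (J *m p).
have JY : J^T *m Y = gb *m p by rewrite /Y !mulmxA JgaJ.
have BY : Bm *m (gb *m p) = p by rewrite mulKVmx.
pose K := ga *m J *m Bm.
have rowgb e : row e gb = \sum_i J i e *: (row i ga *m J).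
  rewrite -JgaJ -mulmxA row_mul mulmx_sum_row; apply: eq_bigr => i _.
  by rewrite row_mul; congr (_ *: _); rewrite !mxE.
have t2 : \sum_i (row i ga *m dmx Ga i x *m Y) 0 0
   = \sum_i (row i ga *m H i *m p) 0 0
   + \sum_e (row e gb *m dmx Gb e (psi x) *m (gb *m p)) 0 0
   + \sum_i (row i K *m (H i)^T *m Y) 0 0.
  transitivity (\sum_i ((row i ga *m H i *m p) 0 0
     + (row i ga *m J *m D i *m (gb *m p)) 0 0
     + (row i K *m (H i)^T *m Y) 0 0)).
    apply: eq_bigr => i _; rewrite dA !mulmxDr !mulmxDl.
    rewrite [LHS]mxE [X in X + _]mxE; congr (_ + _ + _).
    - by rewrite -!mulmxA JY BY.
    - by rewrite -!mulmxA JY.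
    - by rewrite /K row_mul row_mul !mulmxA.
  rewrite !big_split /=; congr (_ + _ + _).
  transitivity (\sum_i \sum_e J i e * (row i ga *m J *m dmx Gb e (psi x) *m (gb *m p)) 0 0).
    apply: eq_bigr => i _; rewrite /D mulmx_sumr mulmx_suml summxE.
    by apply: eq_bigr => e _; rewrite -scalemxAr -scalemxAl mxE.
  rewrite exchange_big; apply: eq_bigr => e _ /=.
  rewrite rowgb !mulmx_suml summxE; apply: eq_bigr => i _.
  by rewrite -!scalemxAl [RHS]mxE.
have t3 : \sum_l Y l 0 * \tr (ga *m dmx Ga l x)
   = 2 * \sum_l Y l 0 * \tr (K *m (H l)^T)
   + \sum_e (gb *m p) e 0 * \tr (gb *m dmx Gb e (psi x)).
  transitivity (\sum_l (2 * (Y l 0 * \tr (K *m (H l)^T))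
      + Y l 0 * \tr (gb *m D l))).
    apply: eq_bigr => l _; rewrite dA !mulmxDr !mxtraceD.
    have -> : \tr (ga *m (H l *m Bm *m J^T)) = \tr (K *m (H l)^T).
      rewrite -mxtrace_tr !trmx_mul trmxK gaT Bsym mxtrace_mulC /K !mulmxA.
      by [].
    have -> : \tr (ga *m (J *m D l *m J^T)) = \tr (gb *m D l).
      by rewrite -JgaJ !mulmxA mxtrace_mulC !mulmxA.
    have -> : \tr (ga *m (J *m Bm *m (H l)^T)) = \tr (K *m (H l)^T).
      by rewrite /K !mulmxA.
    by ring.
  rewrite big_split /= mulr_sumr; congr (_ + _).
  transitivity (\sum_l \sum_e J l e * Y l 0 * \tr (gb *m dmx Gb e (psi x))).
    apply: eq_bigr => l _; rewrite /D mulmx_sumr raddf_sum mulr_sumr /=.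
    by apply: eq_bigr => e _; rewrite -scalemxAr mxtraceZ; ring.
  rewrite exchange_big; apply: eq_bigr => e _ /=.
  rewrite -mulr_suml -JY [in RHS]mxE; congr (_ * _).
  by apply: eq_bigr => l _; rewrite [J^T e l]mxE.
have f3 (a b c a' b' c' : R) : a = a' -> b = b' -> c = c' ->
  a - b + 2^-1 * c = a' - b' + 2^-1 * c' by move=> -> -> ->.
apply: (etrans (f3 _ _ _ _ _ _ t1 t2 t3)).
have cancel (a b c d e : R) : a + b - (a + c + d) + 2^-1 * (2 * d + e) = b - c + 2^-1 * e.
  by field.
by rewrite (sum_row_tr K Y HC); exact: cancel.
Qed.

End Invariance.

Lemma is_derive_line_inv (R : realType) (V : normedModType R) (f : V -> R) x v df :
  is_derive x v f df -> is_derive (0 : R) (1 : R) (fun s : R => f (x + s *: v)) df.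
Proof.
case=> fd E; have x0 : x + 0 *: v = x by rewrite scale0r addr0.
split; first by apply: (derivable_line f x v 0).2; rewrite x0.
by rewrite -derive1E derive_line x0.
Qed.

(** * The ambient Laplacian in a chart *)

Section Separated.
Variables (R : realType) (k : nat).
Implicit Types (h : R -> R) (phi : 'rV[R]_k -> R) (z : 'rV[R]_(1 + k)).

(** Powers of [t], or [ln t], times a function of [(x, rho)]: a product form that is all the ambient
    Laplacian is applied to, and which partial derivatives preserve. *)
Definition sep h phi z : R := h (lsubmx z 0 0) * phi (rsubmx z).

Lemma is_derive_sepl h phi z (dh : R) :
  is_derive (lsubmx z 0 0) (1 : R) h dh ->
  is_derive z (delta_mx 0 (lshift k 0)) (sep h phi) (dh * phi (rsubmx z)).
Proof.
move=> hd; apply: is_derive_line.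
rewrite (_ : (fun s => _) = fun s => h (lsubmx z 0 0 + s *: 1) * phi (rsubmx z)).
  rewrite -[X in is_derive _ _ _ X]addr0 -[X in _ + X](mulr0 (h (lsubmx z 0 0 + 0 *: 1))).
  apply: is_derive_fmul.
  exact: is_derive_line_inv.
apply/funext => s; rewrite /sep; congr (h _ * phi _).
  by rewrite !mxE eqxx eq_refl.
apply/rowP => j; rewrite !mxE [rshift 1 j == _]eq_rlshift andbF mulr0 addr0.
by [].
Qed.

Lemma is_derive_sepr h phi j z (dphi : R) :
  is_derive (rsubmx z) (delta_mx 0 j) phi dphi ->
  is_derive z (delta_mx 0 (rshift 1 j)) (sep h phi) (h (lsubmx z 0 0) * dphi).
Proof.
move=> hd; apply: is_derive_line.
rewrite (_ : (fun s => _) = fun s => h (lsubmx z 0 0) * phi (rsubmx z + s *: delta_mx 0 j)).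
  rewrite -[X in is_derive _ _ _ X]add0r.
  rewrite -[X in X + _](mul0r (phi (rsubmx z + 0 *: delta_mx 0 j))).
  apply: is_derive_fmul.
  exact: is_derive_line_inv.
apply/funext => s; rewrite /sep; congr (h _ * phi _).
  by rewrite !mxE [lshift k 0 == _]eq_lrshift andbF mulr0 addr0.
by apply/rowP => i; rewrite !mxE eq_rshift.
Qed.

End Separated.

Section Strip.
Variables (R : realType) (n : nat) (f : 'rV[R]_(n + 1) -> R).

Lemma partial_lshift i (x : 'rV[R]_n) (r : 'M[R]_1) :
  partial (lshift 1 i) f (row_mx x r) = partial i (fun y => f (row_mx y r)) x.
Proof.
rewrite /partial /derive; set F := fun h => _; set G := fun h => _.
suff -> : F = G by [].
apply/funext => h; rewrite /F /G /=; congr (_ *: (f _ - _)).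
apply/rowP => j; case: (split_ordP j) => l ->.
  by rewrite !(row_mxEl, mxE) eq_lshift.
by rewrite !(row_mxEr, mxE) eq_rlshift andbF mulr0 add0r.
Qed.

Lemma partial_rshift (x : 'rV[R]_n) (r : R) :
  partial (rshift n 0) f (row_mx x r%:M) = derive1 (fun s => f (row_mx x s%:M)) r.
Proof.
rewrite /partial derive1E /derive; set F := fun h => _; set G := fun h => _.
suff -> : F = G by [].
apply/funext => h; rewrite /F /G /=; congr (_ *: (f _ - _)).
apply/rowP => j; case: (split_ordP j) => l ->.
  by rewrite !(row_mxEl, mxE) eq_lrshift andbF mulr0 add0r.
by rewrite !(row_mxEr, mxE) eq_rshift [l]ord1 eqxx !mulr1n [_%:A]mulr1 mulr1.
Qed.

End Strip.

Lemma is_mderive_block (R : realType) (V : normedModType R) (x v : V)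
    m1 m2 n1 n2 (a : V -> 'M[R]_(m1, n1)) (b : V -> 'M[R]_(m1, n2))
    (c : V -> 'M[R]_(m2, n1)) (d : V -> 'M[R]_(m2, n2)) A B C D :
  is_mderive x v a A -> is_mderive x v b B ->
  is_mderive x v c C -> is_mderive x v d D ->
  is_mderive x v (fun y => block_mx (a y) (b y) (c y) (d y)) (block_mx A B C D).
Proof.
move=> ha hb hc hd i j.
by case: (split_ordP i) => i' ->; case: (split_ordP j) => j' ->;
   rewrite ?block_mxEul ?block_mxEur ?block_mxEdl ?block_mxEdr;
   under eq_fun do rewrite ?block_mxEul ?block_mxEur ?block_mxEdl ?block_mxEdr;
   [exact: ha|exact: hb|exact: hc|exact: hd].
Qed.

Lemma is_mderive_row (R : realType) (V : normedModType R) (x v : V)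
    m n1 n2 (a : V -> 'M[R]_(m, n1)) (b : V -> 'M[R]_(m, n2)) A B :
  is_mderive x v a A -> is_mderive x v b B ->
  is_mderive x v (fun y => row_mx (a y) (b y)) (row_mx A B).
Proof.
move=> ha hb i j.
by case: (split_ordP j) => j' ->; rewrite ?row_mxEl ?row_mxEr;
   under eq_fun do rewrite ?row_mxEl ?row_mxEr; [exact: ha|exact: hb].
Qed.

Lemma is_mderive_col (R : realType) (V : normedModType R) (x v : V)
    m1 m2 n (a : V -> 'M[R]_(m1, n)) (b : V -> 'M[R]_(m2, n)) A B :
  is_mderive x v a A -> is_mderive x v b B ->
  is_mderive x v (fun y => col_mx (a y) (b y)) (col_mx A B).
Proof.
move=> ha hb i j.
by case: (split_ordP i) => i' ->; rewrite ?col_mxEu ?col_mxEd;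
   under eq_fun do rewrite ?col_mxEu ?col_mxEd; [exact: ha|exact: hb].
Qed.

Lemma is_mderive_cst (R : realType) (V : normedModType R) (x v : V)
    p q (C : 'M[R]_(p, q)) : is_mderive x v (fun=> C) 0.
Proof. by move=> i j; rewrite mxE; exact: is_derive_cst. Qed.

Lemma is_mderive_scalar (R : realType) (V : normedModType R) (x v : V)
    (f : V -> R) df :
  is_derive x v f df -> is_mderive x v (fun y => (f y)%:M : 'M[R]_1) df%:M.
Proof.
move=> fd i j; rewrite !ord1 mxE eqxx; under eq_fun do rewrite mxE eqxx.
exact: fd.
Qed.

(** The common shape of all first derivatives of the ambient metric; [al], [be] and [Ga] come from
    the entries [2 rho], [t] and [t^2 g_rho]. *)
Definition ambD (R : realType) n (al be : R) (Ga : 'M[R]_n) : 'M[R]_(1 + (n + 1)) :=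
  block_mx al%:M (row_mx 0 be%:M) (col_mx 0 be%:M) (block_mx Ga 0 0 0).

Section Ambient.
Variables (R : realType) (n : nat) (S : set 'rV[R]_(n + 1)).
Variable g : R -> 'rV[R]_n -> 'M[R]_n.
Hypothesis oS : open S.

Let gt (y : 'rV[R]_(n + 1)) : 'M[R]_n := g (rsubmx y 0 0) (lsubmx y).

(* [ambient_metric] in a fixed chart *)
Definition amb (z : 'rV[R]_(1 + (n + 1))) : 'M[R]_(1 + (n + 1)) :=
  let t := lsubmx z 0 0 in
  let x := lsubmx (rsubmx z) in
  let rho := rsubmx (rsubmx z) 0 0 in
  block_mx (2 * rho)%:M        (row_mx 0 t%:M)
           (col_mx 0 t%:M)     (block_mx (t ^+ 2 *: g rho x) 0 0 0).

Definition ambV (t rho : R) (gi : 'M[R]_n) : 'M[R]_(1 + (n + 1)) :=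
  block_mx 0 (row_mx 0 t^-1%:M)
           (col_mx 0 t^-1%:M) (block_mx (t ^- 2 *: gi) 0 0 (- (2 * rho / t ^+ 2))%:M).

Lemma invmx_amb z : lsubmx z 0 0 != 0 -> gt (rsubmx z) \in unitmx ->
  invmx (amb z) = ambV (lsubmx z 0 0) (rsubmx (rsubmx z) 0 0) (invmx (gt (rsubmx z))).
Proof.
rewrite /amb /ambV; move=> t0 Gu; set t := lsubmx z 0 0 in t0 *.
set rho := rsubmx (rsubmx z) 0 0; set G := gt _ in Gu *.
have -> : g rho (lsubmx (rsubmx z)) = G by [].
set P := block_mx _ _ _ _; set Q := block_mx 0 _ _ _.
suff PQ : P *m Q = 1%:M.
  by have [Pu _] := mulmx1_unit PQ; rewrite -[RHS](mulKmx Pu) PQ mulmx1.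
rewrite /P /Q mulmx_block mul_row_col mul_col_row !mul_mx_row !mul_row_block.
rewrite mul_block_col mulmx_block add_row_mx add_block_mx.
rewrite !(mulmx0, mul0mx, addr0, add0r) -!scalar_mxM -?scalemxAl -?scalemxAr.
rewrite scalerA mulmxV // -!raddfD /=.
have -> : t * t^-1 = 1 by rewrite mulfV.
have -> : 2 * rho * t^-1 + t * - (2 * rho / t ^+ 2) = 0.
  by rewrite expr2; field.
rewrite mulfV ?expf_neq0 // scale1r raddf0 row_mx0 col_mx0.
by rewrite -!scalar_mx_block.
Qed.

Let U : set 'rV[R]_(1 + (n + 1)) := [set z | 0 < lsubmx z 0 0 /\ S (rsubmx z)].

Lemma open_amb : open U.
Proof.
have cl : continuous (fun z : 'rV[R]_(1 + (n + 1)) => lsubmx z 0 0).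
  move=> z; apply: (@continuous_comp _ _ _ (fun z : 'rV[R]_(1 + (n + 1)) => lsubmx z) (fun y : 'M[R]_1 => y 0 0)).
    exact/differentiable_continuous/differentiable_lsubmx.
  exact: coord_continuous.
have cr : continuous (@rsubmx R 1 1 (n + 1)).
  move=> z; exact/differentiable_continuous/differentiable_rsubmx.
rewrite (_ : U = (fun z => lsubmx z 0 0) @^-1` [set t : R | t > 0] `&` rsubmx @^-1` S) //.
apply: openI.
  have og : open [set t : R | t > 0] by exact: open_gt.
  exact: ((continuousP _).1 cl _ og).
exact: ((continuousP _).1 cr _ oS).
Qed.

Variables (h dh : R -> R) (phi : 'rV[R]_(n + 1) -> R).
Hypothesis hd : forall t : R, 0 < t -> is_derive t (1 : R) h (dh t).
Hypothesis phis : smooth_on S phi.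

Lemma partial_sepl z : U z -> partial (lshift (n + 1) 0) (sep h phi) z = sep dh phi z.
Proof. by case=> t0 Sz; have [] := is_derive_sepl phi (hd t0). Qed.

Lemma partial_sepr j z : U z ->
  partial (rshift 1 j) (sep h phi) z = sep h (partial j phi) z.
Proof.
case=> t0 Sz; have [|_] := @is_derive_sepr R _ h phi j z (partial j phi (rsubmx z)) => //.
exact/derivableP/(smooth_derivable phis Sz).
Qed.

End Ambient.

Section Ambient2.
Variables (R : realType) (n : nat) (S : set 'rV[R]_(n + 1)).
Variable g : R -> 'rV[R]_n -> 'M[R]_n.
Hypothesis oS : open S.

Let gt (y : 'rV[R]_(n + 1)) : 'M[R]_n := g (rsubmx y 0 0) (lsubmx y).
Hypothesis gs : forall i j, smooth_on S (fun y => gt y i j).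

Let U : set 'rV[R]_(1 + (n + 1)) := [set z | 0 < lsubmx z 0 0 /\ S (rsubmx z)].

Lemma is_mderive_amb v z dt dr (dg : 'M[R]_n) :
  is_derive z v (fun z : 'rV[R]_(1 + (n + 1)) => lsubmx z 0 0) dt ->
  is_derive z v (fun z : 'rV[R]_(1 + (n + 1)) => rsubmx (rsubmx z) 0 0) dr ->
  is_mderive z v (fun z => lsubmx z 0 0 ^+ 2 *: gt (rsubmx z)) dg ->
  is_mderive z v (amb g)
    (ambD (2 * dr) dt dg).
Proof.
move=> td rd gd; apply: is_mderive_block.
- exact: is_mderive_scalar.
- by apply: is_mderive_row; [exact: is_mderive_cst|exact: is_mderive_scalar].
- by apply: is_mderive_col; [exact: is_mderive_cst|exact: is_mderive_scalar].
- by apply: is_mderive_block => //; exact: is_mderive_cst.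
Qed.

Let sep_t : (fun z : 'rV[R]_(1 + (n + 1)) => lsubmx z 0 0) = sep id (fun=> 1).
Proof. by apply/funext => z; rewrite /sep mulr1. Qed.

Let sep_r : (fun z : 'rV[R]_(1 + (n + 1)) => rsubmx (rsubmx z) 0 0)
  = sep (fun=> 1) (fun y => rsubmx y 0 0).
Proof. by apply/funext => z; rewrite /sep mul1r. Qed.

Let sep_g i j : (fun z : 'rV[R]_(1 + (n + 1)) => (lsubmx z 0 0 ^+ 2 *: gt (rsubmx z)) i j)
  = sep (fun t => t ^+ 2) (fun y => gt y i j).
Proof. by apply/funext => z; rewrite /sep mxE. Qed.

Lemma is_mderive_dmx (k : nat) (G : 'rV[R]_k -> 'M[R]_k) i z D :
  is_mderive z (delta_mx 0 i) G D -> dmx G i z = D.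
Proof. by move=> GD; apply/matrixP => a b; rewrite mxE; have [_] := GD a b. Qed.

Lemma is_derive_t_l z : is_derive z (delta_mx 0 (lshift (n + 1) 0))
  (fun z : 'rV[R]_(1 + (n + 1)) => lsubmx z 0 0) 1.
Proof.
by rewrite sep_t -[X in is_derive _ _ _ X](mulr1 1); exact: is_derive_sepl.
Qed.

Lemma is_derive_t_r z j : is_derive z (delta_mx 0 (rshift 1 j))
  (fun z : 'rV[R]_(1 + (n + 1)) => lsubmx z 0 0) 0.
Proof.
rewrite sep_t -[X in is_derive _ _ _ X](mulr0 (lsubmx z 0 0)).
exact: (is_derive_sepr (id)).
Qed.

Lemma is_derive_rho_l z : is_derive z (delta_mx 0 (lshift (n + 1) 0))
  (fun z : 'rV[R]_(1 + (n + 1)) => rsubmx (rsubmx z) 0 0) 0.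
Proof.
rewrite sep_r -[X in is_derive _ _ _ X](mul0r (rsubmx (rsubmx z) 0 0)).
exact: is_derive_sepl.
Qed.

Lemma is_derive_rho_r z j : is_derive z (delta_mx 0 (rshift 1 j))
  (fun z : 'rV[R]_(1 + (n + 1)) => rsubmx (rsubmx z) 0 0) (j == rshift n 0)%:R.
Proof.
rewrite sep_r -[X in is_derive _ _ _ X](mul1r _).
apply: (is_derive_sepr (fun=> 1)); apply: is_derive_line.
rewrite (_ : (fun s => _) = fun s => rsubmx (rsubmx z) 0 0 + (j == rshift n 0)%:R * s).
  rewrite -[X in is_derive _ _ _ X]add0r; apply: is_deriveD.
  rewrite -[X in is_derive _ _ _ X]mulr1.
  exact: is_deriveZ.
by apply/funext => s; rewrite !mxE eqxx /= mulrC eq_sym.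
Qed.

Lemma dmx_amb_t z : U z -> let t := lsubmx z 0 0 in
  dmx (amb g) (lshift (n + 1) 0) z
  = ambD 0 1 ((2 * t) *: gt (rsubmx z)).
Proof.
move=> [t0 Sz] t.
rewrite (is_mderive_dmx (is_mderive_amb (is_derive_t_l z) (is_derive_rho_l z) (dg := (2 * t) *: gt (rsubmx z)) _)).
  by rewrite mulr0.
move=> i j; rewrite sep_g mxE; apply: is_derive_sepl.
rewrite (_ : 2 * t = 1 * t + t * 1); last by rewrite mul1r mulr1 mulr_natl mulr2n.
rewrite (_ : (fun t => t ^+ 2) = fun t => t * t); last exact/funext/expr2.
exact: is_derive_fmul.
Qed.

Let dgt j y : 'M[R]_n := \matrix_(a, b) partial j (fun y => gt y a b) y.

Lemma dmx_amb_r z j : U z -> let t := lsubmx z 0 0 in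
  dmx (amb g) (rshift 1 j) z
  = ambD (2 * (j == rshift n 0)%:R) 0 (t ^+ 2 *: dgt j (rsubmx z)).
Proof.
move=> [t0 Sz] t.
rewrite (is_mderive_dmx (is_mderive_amb (is_derive_t_r z j) (is_derive_rho_r z j) (dg := t ^+ 2 *: dgt j (rsubmx z)) _)) //.
move=> a b; rewrite sep_g 2!mxE.
apply: (is_derive_sepr (fun t => t ^+ 2)).
exact/derivableP/(smooth_derivable (gs a b) Sz).
Qed.

End Ambient2.

Lemma invmx_adj (F : fieldType) n (A : 'M[F]_n) : A \in unitmx ->
  invmx A = (\det A)^-1 *: \adj A.
Proof. by rewrite /invmx => ->. Qed.

Local Opaque partial laplacian invmx.

Lemma sum_ambient (V : nmodType) n (E : 'I_(1 + (n + 1)) -> V) :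
  \sum_i E i = E (lshift (n + 1) 0) +
    (\sum_(i < n) E (rshift 1 (lshift 1 i)) + E (rshift 1 (rshift n 0))).
Proof. by rewrite big_split_ord /= big_ord1 big_split_ord /= big_ord1. Qed.

Lemma row_rshift1 (R : Type) n k (A : 'M[R]_(n, k)) (B : 'M[R]_(1, k)) :
  row (rshift n 0) (col_mx A B) = B.
Proof. by rewrite rowKd; apply/rowP => j; rewrite mxE. Qed.

Lemma row_lshift0 (R : Type) n k (A : 'M[R]_(1, k)) (B : 'M[R]_(n, k)) :
  row (lshift n 0) (col_mx A B) = A.
Proof. by rewrite rowKu; apply/rowP => j; rewrite mxE. Qed.

Lemma mul_ambD (R : realType) n (al be u w y0 y9 : R) (Ga : 'M[R]_n)
    (v : 'rV[R]_n) (Yx : 'cV[R]_n) :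
  (row_mx u%:M (row_mx v w%:M) *m ambD al be Ga
     *m col_mx y0%:M (col_mx Yx y9%:M)) 0 0
  = (u * al + w * be) * y0 + u * be * y9 + (v *m Ga *m Yx) 0 0.
Proof.
rewrite /ambD mul_row_block mul_row_col mul_mx_row mul_row_block.
rewrite !(mulmx0, mul0mx, addr0, add0r) add_row_mx !(addr0, add0r).
rewrite !mul_row_col mulmx0 add0r -!scalar_mxM -raddfD /= -scalar_mxM.
have sc (c : R) : (c%:M : 'M[R]_1) 0 0 = c by rewrite mxE eqxx.
by rewrite mxE sc mxE sc -addrA [X in _ + X]addrC.
Qed.

Lemma tr_ambVD (R : realType) n (t rho al be : R) (gi Ga : 'M[R]_n) :
  \tr (ambV t rho gi *m ambD al be Ga) = 2 * be / t + t ^- 2 * \tr (gi *m Ga).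
Proof.
rewrite /ambV /ambD mulmx_block mxtrace_block mul_row_col mul_col_row.
rewrite mulmx_block !(mulmx0, mul0mx, addr0, add0r).
rewrite add_block_mx mxtrace_block !(addr0, add0r) -!scalar_mxM.
rewrite !mxtrace_scalar -scalemxAl mxtraceZ; ring.
Qed.

(** The indices [a0], [ai], [a9] stand for [t], [x_i], [rho]. The Hessian entries that enter are
    those meeting a nonzero entry of the inverse metric. [T1], [T2], [T3] evaluate the three parts
    of [lapform]. *)
Lemma lapform_ambV (R : realType) n (t rho ht a b xr xrr : R)
    (gi G G9 Hx : 'M[R]_n) (Dx : 'I_n -> 'M[R]_n) (gx : 'cV[R]_n)
    (X : 'M[R]_(1 + (n + 1))) (D : 'I_(1 + (n + 1)) -> 'M[R]_(1 + (n + 1))) :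
  t != 0 -> gi *m G = 1%:M ->
  let a0 := lshift (n + 1) (0 : 'I_1) in let a9 := rshift 1 (rshift n (0 : 'I_1)) in
  let ai i := rshift 1 (lshift 1 i) in
  X a0 a9 = xr -> X a9 a0 = xr -> X a9 a9 = xrr ->
  (forall i j, X (ai i) (ai j) = ht * Hx i j) ->
  D a0 = ambD 0 1 ((2 * t) *: G) -> D a9 = ambD 2 0 (t ^+ 2 *: G9) ->
  (forall i, D (ai i) = ambD 0 0 (t ^+ 2 *: Dx i)) ->
  lapform (ambV t rho gi) X D (col_mx a%:M (col_mx (ht *: gx) b%:M)) =
  t ^- 2 * (ht * lapform gi Hx Dx gx + 2 * t * xr - 2 * rho * xrr
    + (n%:R - 2) * b + 2^-1 * \tr (gi *m G9) * (t * a - 2 * rho * b)).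
Proof.
move=> t0 giG a0 a9 ai X09 X90 X99 Xij D0 D9 Di.
set ga := ambV t rho gi.
have YE : ga *m col_mx a%:M (col_mx (ht *: gx) b%:M) = col_mx (b / t)%:M
   (col_mx (ht / t ^+ 2 *: (gi *m gx)) (a / t - 2 * rho * b / t ^+ 2)%:M).
  rewrite /ga /ambV mul_block_col mul0mx add0r mul_row_col mul0mx add0r.
  rewrite mul_col_mx mul_block_col !mul0mx addr0 add0r.
  rewrite -!scalar_mxM add_col_mx add0r -raddfD /=.
  congr (col_mx _%:M (col_mx _ _%:M)); [by rewrite mulrC| |by field].
  by rewrite -scalemxAl -scalemxAr scalerA mulrC.
rewrite /lapform YE.
have T1 : \sum_i \sum_j ga i j * X i j =
   2 / t * xr - 2 * rho / t ^+ 2 * xrr + ht / t ^+ 2 * \sum_i \sum_j gi i j * Hx i j.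
  have g00 : ga a0 a0 = 0 by rewrite block_mxEul mxE.
  have g0i i : ga a0 (ai i) = 0 by rewrite block_mxEur row_mxEl mxE.
  have g09 : ga a0 a9 = t^-1 by rewrite block_mxEur row_mxEr mxE eqxx.
  have gi0 i : ga (ai i) a0 = 0 by rewrite block_mxEdl col_mxEu mxE.
  have gij i j : ga (ai i) (ai j) = t ^- 2 * gi i j.
    by rewrite block_mxEdr block_mxEul mxE.
  have gi9 i : ga (ai i) a9 = 0 by rewrite block_mxEdr block_mxEur mxE.
  have g90 : ga a9 a0 = t^-1 by rewrite block_mxEdl col_mxEd mxE eqxx.
  have g9i i : ga a9 (ai i) = 0 by rewrite block_mxEdr block_mxEdl mxE.
  have g99 : ga a9 a9 = - (2 * rho / t ^+ 2) by rewrite block_mxEdr block_mxEdr mxE eqxx.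
  rewrite sum_ambient !sum_ambient -/a0 -/a9 g00 g09 g90 g99 X09 X90 X99.
  rewrite big1 => [|i _]; last by rewrite (g0i i) mul0r.
  rewrite [\sum_(i < n) (ga a9 _ * _)]big1 => [|i _]; last by rewrite (g9i i) mul0r.
  have -> : \sum_(i < n) \sum_j ga (ai i) j * X (ai i) j
     = ht / t ^+ 2 * \sum_i \sum_j gi i j * Hx i j.
    rewrite mulr_sumr; apply: eq_bigr => i _.
    rewrite sum_ambient -/a0 -/a9 gi0 gi9 !mul0r add0r addr0 mulr_sumr.
    by apply: eq_bigr => j _; rewrite (gij i j) (Xij i j); ring.
  by field.
have T2 : \sum_i (row i ga *m D i *m col_mx (b / t)%:M
      (col_mx (ht / t ^+ 2 *: (gi *m gx)) (a / t - 2 * rho * b / t ^+ 2)%:M)) 0 0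
   = 3 * b / t ^+ 2 + ht / t ^+ 2 * \sum_i (row i gi *m Dx i *m (gi *m gx)) 0 0.
  have r0 : row a0 ga = row_mx 0%:M (row_mx 0 t^-1%:M).
    by rewrite row_lshift0 raddf0.
  have ri i : row (ai i) ga = row_mx 0%:M (row_mx (t ^- 2 *: row i gi) 0%:M).
    rewrite /ga /ambV /block_mx /ai rowKd row_row_mx !rowKu row_row_mx !row0.
    by rewrite [row i (_ *: _)]linearZ raddf0.
  have r9 : row a9 ga = row_mx t^-1%:M (row_mx 0 (- (2 * rho / t ^+ 2))%:M).
    by rewrite /ga /ambV /block_mx /a9 rowKd row_row_mx !row_rshift1.
  rewrite sum_ambient -/a0 -/a9 r0 r9 D0 D9 !mul_ambD !mul0mx mxE.
  have -> : \sum_(i < n) (row (rshift 1 (lshift 1 i)) ga *m D (rshift 1 (lshift 1 i))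
     *m col_mx (b / t)%:M
      (col_mx (ht / t ^+ 2 *: (gi *m gx)) (a / t - 2 * rho * b / t ^+ 2)%:M)) 0 0
    = ht / t ^+ 2 * \sum_i (row i gi *m Dx i *m (gi *m gx)) 0 0.
    rewrite mulr_sumr; apply: eq_bigr => i _; rewrite (ri i) (Di i) mul_ambD.
    rewrite -!scalemxAl -!scalemxAr -!scalemxAl !scalerA mxE.
    by field.
  by field.
have T3 : \sum_l col_mx (b / t)%:M
      (col_mx (ht / t ^+ 2 *: (gi *m gx)) (a / t - 2 * rho * b / t ^+ 2)%:M) l 0
      * \tr (ga *m D l)
   = (2 + 2 * n%:R) * b / t ^+ 2
     + ht / t ^+ 2 * \sum_l (gi *m gx) l 0 * \tr (gi *m Dx l)
     + (a / t - 2 * rho * b / t ^+ 2) * \tr (gi *m G9).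
  rewrite sum_ambient -/a0 -/a9 D0 D9 !tr_ambVD.
  rewrite col_mxEu [_%:M 0 0]mxE eqxx mulr1n col_mxEd col_mxEd [_%:M 0 0]mxE eqxx mulr1n.
  rewrite -!scalemxAr !mxtraceZ giG mxtrace1.
  have -> : \sum_(i < n) col_mx (b / t)%:M
      (col_mx (ht / t ^+ 2 *: (gi *m gx)) (a / t - 2 * rho * b / t ^+ 2)%:M)
         (rshift 1 (lshift 1 i)) 0 * \tr (ga *m D (rshift 1 (lshift 1 i)))
     = ht / t ^+ 2 * \sum_l (gi *m gx) l 0 * \tr (gi *m Dx l).
    rewrite mulr_sumr; apply: eq_bigr => i _.
    rewrite (Di i) tr_ambVD col_mxEd col_mxEu mxE -scalemxAr mxtraceZ.
    by field.
  by field.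
(* The factor [n - 2] of [b] is [-3 + (2 + 2 n) / 2]: the 3 comes from the [t]-derivative (1) and
   the [rho]-derivative (2) of the metric, the rest from the trace of its [t]-derivative. *)
rewrite T1 T2 T3.
by field.
Qed.

Section AmbientLaplacian.
Variables (R : realType) (n : nat) (S : set 'rV[R]_(n + 1)).
Variable g : R -> 'rV[R]_n -> 'M[R]_n.
Hypothesis oS : open S.

Let gt (y : 'rV[R]_(n + 1)) : 'M[R]_n := g (rsubmx y 0 0) (lsubmx y).
Hypothesis gs : forall i j, smooth_on S (fun y => gt y i j).
Hypothesis gT : forall y, S y -> (gt y)^T = gt y.
Hypothesis gu : forall y, S y -> gt y \in unitmx.

Let U : set 'rV[R]_(1 + (n + 1)) := [set z | 0 < lsubmx z 0 0 /\ S (rsubmx z)].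

Definition dmetric j y : 'M[R]_n := \matrix_(a, b) partial j (fun y => gt y a b) y.

Variables (h dh : R -> R) (phi : 'rV[R]_(n + 1) -> R).
Hypothesis hd : forall t : R, 0 < t -> is_derive t (1 : R) h (dh t).
Hypothesis phis : smooth_on S phi.

Lemma laplacian_slice y : S y ->
  laplacian (g (rsubmx y 0 0)) (fun x => phi (row_mx x (rsubmx y))) (lsubmx y)
  = lapform (invmx (gt y))
      (\matrix_(i, j) partial (lshift 1 i) (partial (lshift 1 j) phi) y)
      (fun i => dmetric (lshift 1 i) y) (\col_i partial (lshift 1 i) phi y).
Proof.
move=> Sy; have yE : row_mx (lsubmx y) (rsubmx y) = y by rewrite hsubmxK.
rewrite laplacianE; last by rewrite trmx_inv gT.
have -> : grad (fun x => phi (row_mx x (rsubmx y))) (lsubmx y)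
    = \col_i partial (lshift 1 i) phi y.
  by apply/colP => i; rewrite !mxE -partial_lshift yE.
have -> : hmx (fun x => phi (row_mx x (rsubmx y))) (lsubmx y)
    = \matrix_(i, j) partial (lshift 1 i) (partial (lshift 1 j) phi) y.
  apply/matrixP => i j; rewrite [LHS]mxE [RHS]mxE -[in RHS]yE partial_lshift.
  congr (partial i _ (lsubmx y)).
  by apply/funext => x; rewrite partial_lshift.
have -> // : dmx (g (rsubmx y 0 0)) ^~ (lsubmx y) = fun i => dmetric (lshift 1 i) y.
apply/funext => i; apply/matrixP => a b.
rewrite [LHS]mxE [RHS]mxE -[in RHS]yE partial_lshift.
congr (partial i _ (lsubmx y)).
by apply/funext => x; rewrite /gt row_mxKl row_mxKr.
Qed.

Lemma laplacian_ambient z : U z ->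
  let t := lsubmx z 0 0 in let y := rsubmx z in let rho := rsubmx y 0 0 in
  let rr := rshift n 0 in
  laplacian (amb g) (sep h phi) z = t ^- 2 *
    (h t * laplacian (g rho) (fun x => phi (row_mx x (rsubmx y))) (lsubmx y)
     + 2 * t * dh t * partial rr phi y
     - 2 * rho * h t * partial rr (partial rr phi) y
     + (n%:R - 2) * h t * partial rr phi y
     + 2^-1 * \tr (invmx (gt y) *m dmetric rr y)
         * (t * dh t * phi y - 2 * rho * h t * partial rr phi y)).
Proof.
move=> Uz t y rho rr; have [t0 Sy] := Uz.
have tn0 : t != 0 by rewrite gt_eqF.
have oU : open U := open_amb oS.
pose gi := invmx (gt y); pose G := gt y.
have Gu : G \in unitmx := gu Sy.
have gaE : invmx (amb g z) = ambV t rho gi := invmx_amb tn0 Gu.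
have giT : gi^T = gi by rewrite /gi trmx_inv gT.
have gaT : (invmx (amb g z))^T = invmx (amb g z).
  rewrite gaE /ambV tr_block_mx tr_block_mx !(tr_row_mx, tr_col_mx) !trmx0.
  by rewrite !tr_scalar_mx linearZ /= giT.
rewrite (laplacianE _ gaT) gaE (laplacian_slice Sy) -/gi.
set a0 := lshift (n + 1) (0 : 'I_1); set a9 := rshift 1 rr.
pose gx := \col_i partial (lshift 1 i) phi y.
pose pr := partial rr phi y.
have pl w : U w -> partial a0 (sep h phi) w = sep dh phi w.
  exact: (partial_sepl phi hd).
have prr j w : U w -> partial (rshift 1 j) (sep h phi) w = sep h (partial j phi) w.
  exact: (partial_sepr h phis).
have gradE : grad (sep h phi) z =
    col_mx (dh t * phi y)%:M (col_mx (h t *: gx) (h t * pr)%:M).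
  apply/colP => i; rewrite mxE; case: (split_ordP i) => k ->.
    by rewrite [k]ord1 pl // col_mxEu mxE eqxx.
  rewrite prr // col_mxEd; case: (split_ordP k) => l ->.
    by rewrite col_mxEu !mxE.
  by rewrite col_mxEd [l]ord1 mxE eqxx.
rewrite gradE.
rewrite (@lapform_ambV R n t rho (h t) (dh t * phi y) (h t * pr) (dh t * pr)
  (h t * partial rr (partial rr phi) y) gi G (dmetric rr y)
  (\matrix_(i, j) partial (lshift 1 i) (partial (lshift 1 j) phi) y)
  (fun i => dmetric (lshift 1 i) y)) //.
- rewrite -/y -/gx -/pr; ring.
- exact: mulVmx.
- rewrite mxE (eq_partial oU _ Uz (prr _)).
  exact: (partial_sepl (partial rr phi) hd Uz).
- rewrite mxE (eq_partial oU _ Uz pl).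
  exact: (partial_sepr dh phis rr Uz).
- rewrite mxE (eq_partial oU _ Uz (prr _)).
  exact: (partial_sepr h (smooth_partial rr phis) rr Uz).
- move=> i j; rewrite !mxE (eq_partial oU _ Uz (prr _)).
  exact: (partial_sepr h (smooth_partial (lshift 1 j) phis) (lshift 1 i) Uz).
- exact: (dmx_amb_t g Uz).
- have := dmx_amb_r gs rr Uz; rewrite eqxx mulr1; exact.
- by move=> i; have := dmx_amb_r gs (lshift 1 i) Uz; rewrite eq_lrshift mulr0; exact.
Qed.

End AmbientLaplacian.

(** * Determinants and functions vanishing at rho = 0 *)

Section Signature.
Variables (R : realType) (n p q : nat).
Implicit Types B C : 'M[R]_n.

Definition det_signature : R := \prod_(i < n) (if (i < p)%N then 1 else -1).

Lemma det_signature_sqr : det_signature * det_signature = 1.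
Proof.
rewrite /det_signature -big_split big1 //= => i _.
by case: ifP => _; rewrite ?mulr1 ?mulrNN ?mulr1.
Qed.

Lemma signature_sym B : has_signature p q B -> B^T = B.
Proof.
case=> _ [T Tu TB]; have Tu' : T^T \in unitmx by rewrite unitmx_tr.
have BE : B = invmx T *m (T *m B *m T^T) *m invmx T^T.
  by rewrite -mulmxA mulmxK // mulKmx.
rewrite TB in BE; rewrite BE !trmx_mul tr_diag_mx.
by rewrite -!trmx_inv trmxK mulmxA.
Qed.

(** Taking determinants in the diagonalisation gives [(det T)^2 det B = det_signature]. The sign of
    the determinant is thus fixed by the signature, which makes ratios of determinants positive and
    the square roots in [W] genuine. *)
Lemma signature_det B : has_signature p q B -> 0 < det_signature * \det B.
Proof.
case=> _ [T Tu TB].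
have E : \det T ^+ 2 * \det B = det_signature.
  have := congr1 determinant TB; rewrite !det_mulmx det_tr det_diag.
  rewrite /det_signature => E.
  transitivity (\det T * \det B * \det T); first by ring.
  by rewrite E; apply: eq_bigr => i _; rewrite mxE.
have T0 : \det T != 0 by move: Tu; rewrite unitmxE unitfE.
have T2 : 0 < \det T ^+ 2 by rewrite exprn_even_gt0.
rewrite -(pmulr_rgt0 _ T2) mulrCA E det_signature_sqr.
exact: ltr01.
Qed.

Lemma signature_unit B : has_signature p q B -> B \in unitmx.
Proof.
move=> /signature_det B0; rewrite unitmxE unitfE.
by apply: contraTneq B0 => ->; rewrite mulr0 ltxx.
Qed.

Lemma signature_det_ratio B C : has_signature p q B -> has_signature p q C ->
  0 < \det B / \det C.
Proof.
move=> /signature_det B0 /signature_det C0.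
have := divr_gt0 B0 C0; have s0 : det_signature != 0.
  by apply: contraTneq B0 => ->; rewrite mul0r ltxx.
by rewrite -mulf_div mulfV // mul1r.
Qed.

End Signature.

Section Jacobi.
Variables (R : realType) (V : normedModType R) (x v : V).

Lemma is_derive_prod (I : eqType) (r : seq I) (f : I -> V -> R) (df : I -> R) :
  uniq r -> (forall i, is_derive x v (f i) (df i)) ->
  is_derive x v (fun y => \prod_(i <- r) f i y)
    (\sum_(k <- r) \prod_(i <- r) (if i == k then df k else f i x)).
Proof.
move=> ur fd; elim: r ur => [_|k r IH /= /andP[kr ur]].
  rewrite big_nil (_ : (fun y => _) = cst 1); first exact: is_derive_cst.
  by apply/funext => y; rewrite big_nil.
rewrite (_ : (fun y => _) = fun y => f k y * \prod_(i <- r) f i y); last first.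
  by apply/funext => y; rewrite big_cons.
rewrite (_ : \sum_(_ <- _) _ = df k * \prod_(i <- r) f i x
  + f k x * \sum_(k <- r) \prod_(i <- r) (if i == k then df k else f i x)).
  exact: is_derive_fmul (fd k) (IH ur).
rewrite big_cons big_cons eqxx; congr (_ * _ + _).
  rewrite big_seq [RHS]big_seq; apply: eq_bigr => i ir.
  by case: eqP => // ik; rewrite -ik ir in kr.
rewrite mulr_sumr big_seq [RHS]big_seq; apply: eq_bigr => i ir.
rewrite big_cons; case: eqP => // ki.
by rewrite ki ir in kr.
Qed.

(** Jacobi's formula. The Leibniz rule gives one determinant for each row that is replaced by its
    derivative, and expansion along that row yields the adjugate. *)
Lemma is_derive_det n (B : V -> 'M[R]_n) (D : 'M[R]_n) :
  is_mderive x v B D ->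
  is_derive x v (fun y => \det (B y)) (\tr (\adj (B x) *m D)).
Proof.
move=> BD.
pose B' k : 'M[R]_n := \matrix_(i, j) (if i == k then D k j else B x i j).
have -> : \tr (\adj (B x) *m D) = \sum_k \det (B' k).
  rewrite mxtrace_mulC; apply: eq_bigr => k _.
  rewrite (expand_det_row _ k) mxE; apply: eq_bigr => j _.
  rewrite [in RHS]mxE eqxx [\adj _ _ _]mxE; congr (_ * (_ * \det _)).
  by apply/matrixP => a b; rewrite !mxE eq_sym (negbTE (neq_lift _ _)).
rewrite (_ : \sum_k _ = \sum_(s : 'S_n) \sum_k (-1) ^+ s * \prod_i B' k i (s i)); last first.
  by rewrite exchange_big.
rewrite /determinant.
apply: is_derive_fsum => s.
rewrite (_ : \sum_k _ = 0 * \prod_i B x i (s i) + (-1) ^+ s * \sum_k \prod_i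
    (if i == k then D k (s k) else B x i (s i))); last first.
  rewrite mul0r add0r mulr_sumr; apply: eq_bigr => k _.
  congr (_ * _); apply: eq_bigr => i _; rewrite mxE.
  by case: eqP => // ->.
apply: is_derive_fmul.
apply: (@is_derive_prod _ (index_enum 'I_n) (fun i y => B y i (s i))
  (fun i => D i (s i))) => [|i]; first exact: index_enum_uniq.
exact: BD.
Qed.

End Jacobi.

Section Vanishing.
Variables (R : realType) (n : nat) (A : set 'rV[R]_n) (S : set 'rV[R]_(n + 1)).
Hypotheses (oA : open A) (oS : open S).
Hypothesis AS : forall x, A x -> S (row_mx x 0).

(* [f] is smooth on [S] and is O(rho^k), rho being the last coordinate. *)
Fixpoint vanishing (k : nat) (f : 'rV[R]_(n + 1) -> R) : Prop :=
  smooth_on S f /\ if k is k'.+1 then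
    (forall x, A x -> f (row_mx x 0) = 0) /\ vanishing k' (partial (rshift n 0) f)
  else True.

Lemma vanishing_smooth k f : vanishing k f -> smooth_on S f.
Proof. by case: k => [|k] []. Qed.

Lemma vanishing0 f : smooth_on S f -> vanishing 0 f.
Proof. by []. Qed.

Lemma vanishingW k f : vanishing k.+1 f -> vanishing k f.
Proof.
elim: k f => [|k IH] f; first by case.
by case=> fs [f0 f1]; split=> //; split=> //; exact: IH.
Qed.

Lemma eq_vanishing k f g : (forall y, S y -> f y = g y) ->
  vanishing k f -> vanishing k g.
Proof.
elim: k f g => [|k IH] f g fg [fs fk]; split; try exact: (eq_smooth oS fg).
  by [].
have [f0 f1] := fk; split=> [x Ax|]; first by rewrite -fg ?f0 //; exact: AS.
by apply: IH f1 => y Sy; exact: (eq_partial oS _ Sy fg).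
Qed.

Lemma vanishing_cst0 k : vanishing k (fun=> 0).
Proof.
elim: k => [|k IH]; split; try exact: smooth_cst; first by [].
split=> //; apply: eq_vanishing IH => y _.
by rewrite partial_cst.
Qed.

Lemma vanishingD k f g : vanishing k f -> vanishing k g ->
  vanishing k (fun y => f y + g y).
Proof.
elim: k f g => [|k IH] f g [fs fk] [gs gk]; split; try exact: smoothD; first by [].
have [f0 f1] := fk; have [g0 g1] := gk; split=> [x Ax|].
  by rewrite f0 // g0 // addr0.
apply: eq_vanishing (IH _ _ f1 g1) => y Sy.
by rewrite (partialD _ fs gs).
Qed.

Lemma vanishingM k f g : smooth_on S f -> vanishing k g ->
  vanishing k (fun y => f y * g y).
Proof.
elim: k f g => [|k IH] f g fs gk; first by split=> //; case: gk => gs _; exact: smoothM.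
have gW := vanishingW gk; have [gs [g0 g1]] := gk.
split; first exact: smoothM.
split=> [x Ax|]; first by rewrite g0 // mulr0.
apply: eq_vanishing (vanishingD (IH _ _ (smooth_partial (rshift n 0) fs) gW) (IH _ _ fs g1)) => y Sy.
by rewrite (partialM _ fs gs).
Qed.

(** A derivative along [x] commutes with the one in [rho], and it kills a function that is zero on
    the whole slice [rho = 0]. *)
Lemma vanishing_partial k f i : vanishing k f ->
  vanishing k (partial (lshift 1 i) f).
Proof.
elim: k f => [|k IH] f [fs fk]; split; try exact: smooth_partial; first by [].
have [f0 f1] := fk; split=> [x Ax|].
  rewrite partial_lshift.
  rewrite (eq_partial oA _ Ax (g := fun=> 0)); first exact: partial_cst.
  by move=> y Ay; rewrite f0.
apply: eq_vanishing (IH _ f1) => y Sy; exact: (partialC oS _ _ fs Sy).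
Qed.

Lemma vanishing_sum k (I : Type) (r : seq I) (F : I -> 'rV[R]_(n + 1) -> R) :
  (forall i, vanishing k (F i)) -> vanishing k (fun y => \sum_(i <- r) F i y).
Proof.
move=> Fk; elim: r => [|i r IH].
  by apply: eq_vanishing (vanishing_cst0 k) => y _; rewrite big_nil.
by apply: eq_vanishing (vanishingD (Fk i) IH) => y _; rewrite big_cons.
Qed.

Lemma vanishing_mulmx k a b c (P : 'rV[R]_(n + 1) -> 'M[R]_(a, b))
    (Q : 'rV[R]_(n + 1) -> 'M[R]_(b, c)) :
  (forall i j, smooth_on S (fun y => P y i j)) ->
  (forall i j, vanishing k (fun y => Q y i j)) ->
  forall i j, vanishing k (fun y => (P y *m Q y) i j).
Proof.
move=> Ps Qk i j.
apply: (@eq_vanishing _ (fun y => \sum_l P y i l * Q y l j)).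
  by move=> y _; rewrite mxE.
by apply: vanishing_sum => l; exact: vanishingM.
Qed.

Lemma vanishing_lapform k (ga X : 'rV[R]_(n + 1) -> 'M[R]_n)
    (D : 'I_n -> 'rV[R]_(n + 1) -> 'M[R]_n) (p : 'rV[R]_(n + 1) -> 'cV[R]_n) :
  (forall i j, smooth_on S (fun y => ga y i j)) ->
  (forall l i j, smooth_on S (fun y => D l y i j)) ->
  (forall i j, vanishing k (fun y => X y i j)) ->
  (forall i j, vanishing k (fun y => p y i j)) ->
  vanishing k (fun y => lapform (ga y) (X y) (D ^~ y) (p y)).
Proof.
move=> gs Ds Xk pk.
have smul a b c (P : 'rV[R]_(n + 1) -> 'M[R]_(a, b)) (Q : 'rV[R]_(n + 1) -> 'M[R]_(b, c)) :
    (forall i j, smooth_on S (fun y => P y i j)) ->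
    (forall i j, smooth_on S (fun y => Q y i j)) ->
    forall i j, smooth_on S (fun y => (P y *m Q y) i j).
  by move=> Ps Qs i j; apply: (vanishing_smooth (@vanishing_mulmx 0 _ _ _ P Q Ps _ i j)) => ? ?.
have Yk i j : vanishing k (fun y => (ga y *m p y) i j) by exact: vanishing_mulmx.
rewrite /lapform; apply: vanishingD; first apply: vanishingD.
- apply: vanishing_sum => i; apply: vanishing_sum => j; exact: vanishingM.
- apply: (@eq_vanishing _ (fun y => -1 * \sum_i (row i (ga y) *m D i y *m (ga y *m p y)) 0 0)).
    by move=> y _; rewrite mulN1r.
  apply: vanishingM; first exact: smooth_cst.
  apply: vanishing_sum => i.
  apply: (vanishing_mulmx (P := fun y => row i (ga y) *m D i y)) => // a b.
  apply: (smul _ _ _ (fun y => row i (ga y)) (D i)) => // c d.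
  apply: (eq_smooth oS _ (gs i d)) => y _; by rewrite mxE.
- apply: vanishingM; first exact: smooth_cst.
  apply: vanishing_sum => l.
  apply: (@eq_vanishing _ (fun y => \tr (ga y *m D l y) * (ga y *m p y) l 0)).
    by move=> y _; rewrite mulrC.
  apply: vanishingM => //; apply: smooth_sum => // i _.
  exact: (smul _ _ _ ga (D l)).
Qed.

End Vanishing.

Lemma continuous_row_mx (R : realType) n k (c : 'rV[R]_k) :
  continuous (fun x : 'rV[R]_n => row_mx x c).
Proof.
move=> x; have FF : Filter (nbhs x) := nbhs_filter x.
apply/(@cvgrPdist_le _ _ _ (nbhs x) FF) => e e0.
have := nbhsx_ballx x e e0; rewrite -ball_normE; apply: filterS => y /= xy.
apply: (norm_row_le (ltW e0)) => j; case: (split_ordP j) => l ->.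
  have := norm_coord_le (x - y) l.
  by rewrite !(row_mxEl, mxE) => /le_trans; apply; exact: ltW.
by rewrite !(row_mxEr, mxE) subrr normr0 ltW.
Qed.

(** * The Laplacians of the family on the manifold *)

Section Overlaps.
Variables (R : realType) (n : nat) (M : topologicalType) (S : manifold R n M).
Variables (p q : nat) (eps : R) (gr : R -> tensor2 S).
Hypothesis eps0 : 0 < eps.
Hypothesis fam : smooth_metric_family p q eps gr.

Lemma open_img (a : chart S) : open (chart_img a).
Proof. exact: chart_img_open. Qed.

Definition loc (F : M -> R -> R) (a : chart S) (z : 'rV[R]_(n + 1)) : R :=
  F (chart_pt a (lsubmx z)) (rsubmx z 0 0).

Lemma loc_row F a x r : loc F a (row_mx x r%:M) = F (chart_pt a x) r.
Proof. by rewrite /loc row_mxKl row_mxKr mxE eqxx. Qed.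

Lemma open_strip (a : chart S) : open (strip eps a).
Proof.
have cl : continuous (@lsubmx R 1 n 1).
  by move=> z; exact/differentiable_continuous/differentiable_lsubmx.
have cr : continuous (fun z : 'rV[R]_(n + 1) => rsubmx z 0 0).
  move=> z; apply: (@continuous_comp _ _ _ (fun z : 'rV[R]_(n + 1) => rsubmx z) (fun y : 'M[R]_1 => y 0 0)).
    exact/differentiable_continuous/differentiable_rsubmx.
  exact: coord_continuous.
have cn : continuous (fun z : 'rV[R]_(n + 1) => `|rsubmx z 0 0|).
  move=> z; apply: (@continuous_comp _ _ _ (fun z : 'rV[R]_(n + 1) => rsubmx z 0 0) Num.norm).
    exact: cr.
  exact: norm_continuous.
rewrite (_ : strip eps a = @lsubmx R 1 n 1 @^-1` chart_img a
  `&` (fun z : 'rV[R]_(n + 1) => `|rsubmx z 0 0|) @^-1` [set t : R | t < eps]) //.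
apply: openI; first exact: ((continuousP _).1 cl _ (@open_img a)).
have ol : open [set t : R | t < eps] by exact: open_lt.
exact: ((continuousP _).1 cn _ ol).
Qed.

Lemma strip_row (a : chart S) x r : chart_img a x -> `|r| < eps -> strip eps a (row_mx x r%:M).
Proof. by move=> ax re; split; rewrite ?row_mxKl // row_mxKr mxE eqxx. Qed.

Lemma strip0 (a : chart S) x : chart_img a x -> strip eps a (row_mx x 0).
Proof. by move=> ax; rewrite -(raddf0 (@scalar_mx R 1)); apply: strip_row; rewrite ?normr0. Qed.

Lemma chart_ptP (a : chart S) x : chart_img a x ->
  chart_dom a (chart_pt a x) /\ chart_co a (chart_pt a x) = x.
Proof. by case=> u au <-; rewrite chart_coK. Qed.

Lemma chart_coP (a : chart S) u : chart_dom a u -> chart_img a (chart_co a u).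
Proof. by move=> au; exists u. Qed.

Lemma gr_signature a x r : chart_img a x -> `|r| < eps -> has_signature p q (gr r a x).
Proof. by move=> ax re; have [_ _] := fam.1 r re; apply. Qed.

Lemma gr_smooth a r i j : `|r| < eps -> smooth_on (chart_img a) (fun x => gr r a x i j).
Proof. by move=> re; have [_] := fam.1 r re. Qed.

Definition met (a : chart S) (z : 'rV[R]_(n + 1)) : 'M[R]_n := gr (rsubmx z 0 0) a (lsubmx z).

Lemma met_signature a z : strip eps a z -> has_signature p q (met a z).
Proof. by case=> ax re; exact: gr_signature. Qed.

Lemma met_sym a z : strip eps a z -> (met a z)^T = met a z.
Proof. by move=> /met_signature; exact: signature_sym. Qed.

Lemma met_unit a z : strip eps a z -> met a z \in unitmx.
Proof. by move=> /met_signature; exact: signature_unit. Qed.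

Lemma met_smooth a i j : smooth_on (strip eps a) (fun z => met a z i j).
Proof. exact: fam.2. Qed.

Definition overlap (a b : chart S) : set 'rV[R]_n := chart_co a @` (chart_dom a `&` chart_dom b).

Lemma overlapE (a b : chart S) x :
  overlap a b x <-> chart_img a x /\ chart_dom b (chart_pt a x).
Proof.
split=> [[u [au bu] <-]|[[u au <-]]]; first by rewrite chart_coK //; split=> //; exists u.
by rewrite chart_coK // => bu; exists u => //; split.
Qed.

Lemma open_overlap (a b : chart S) : open (overlap a b).
Proof.
rewrite openE => x /overlapE[ax bx]; rewrite /interior.
have n1 : nbhs x (chart_img a) by exact: open_nbhs_nbhs (conj (@open_img a) ax).
have n2 : nbhs x (chart_pt a @^-1` chart_dom b).
  have ob : open (chart_dom b) by exact: chart_dom_open.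
  apply: (chart_pt_continuous ax).
  exact: open_nbhs_nbhs (conj ob bx).
by apply: filterS (filterI n1 n2) => y /= ?; exact/overlapE.
Qed.

Lemma gr_transition (a b : chart S) r : `|r| < eps -> forall y, overlap a b y ->
  gr r a y = jac (transition a b) y *m gr r b (transition a b y) *m (jac (transition a b) y)^T.
Proof.
move=> re y ov; have [_ [u [au bu] yE]] := (I, ov).
have [tens _ _] := fam.1 r re.
have := tens a b u au bu; rewrite /= yE.
rewrite (jac_jacobian (@open_overlap a b) (chart_compatible a b) ov).
by have -> : transition a b y = chart_co b u by rewrite /transition -yE chart_coK.
Qed.

Definition Lap (F : M -> R -> R) (u : M) (r : R) : R :=
  let a := chart_at S u in
  laplacian (gr r a) (fun x => F (chart_pt a x) r) (chart_co a u).

Lemma smooth_slice F (a : chart S) r : smooth_fun_strip S eps F -> `|r| < eps ->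
  smooth_on (chart_img a) (fun x => F (chart_pt a x) r).
Proof.
move=> Fs re.
have Es : smooth_on (chart_img a) (fun x => loc F a (row_mx x r%:M)).
  apply: (@smooth_comp_affine R n (n + 1) (strip eps a) (chart_img a)
     (fun x => row_mx x r%:M) (fun i => delta_mx 0 (lshift 1 i))) => //.
  - exact: open_strip.
  - exact: open_img.
  - exact: continuous_row_mx.
  - move=> x i h; apply/rowP => j; case: (split_ordP j) => l ->.
      by rewrite !(row_mxEl, mxE) eq_lshift.
    by rewrite !(row_mxEr, mxE) eq_rlshift andbF mulr0 addr0.
  - by move=> i; right; exists (lshift 1 i).
  - by move=> x ax; exact: strip_row.
apply: eq_smooth Es; first exact: open_img.
by move=> x ax; rewrite loc_row.
Qed.

(** [Lap] uses a chart that changes with [u]; smoothness of its result near a point can be seen only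
    after rewriting it in one chart, by coordinate invariance. *)
Lemma Lap_chart F (b : chart S) u r : smooth_fun_strip S eps F -> `|r| < eps ->
  chart_dom b u ->
  Lap F u r = laplacian (gr r b) (fun x => F (chart_pt b x) r) (chart_co b u).
Proof.
move=> Fs re bu; rewrite /Lap; set a := chart_at S u.
have au : chart_dom a u by exact: chart_atP.
have ov : overlap a b (chart_co a u) by exists u.
have tE : transition a b (chart_co a u) = chart_co b u by rewrite /transition chart_coK.
rewrite -tE; apply: (@laplacian_invariant R n (overlap a b) (chart_img b) (transition a b)) => //.
- exact: open_overlap.
- exact: open_img.
- by move=> y [v [av bv] <-]; exists v => //; rewrite /transition chart_coK.
- exact: chart_compatible.
- by move=> i j; exact: gr_smooth.
- exact: smooth_slice.
- exact: gr_transition.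
- by move=> y [v [av bv] <-]; rewrite /transition chart_coK // chart_coK.
- rewrite tE; apply: signature_sym; apply: gr_signature re; exact: chart_coP.
- apply: signature_unit; apply: gr_signature re; exact: chart_coP.
Qed.

Lemma loc_Lap F a z : smooth_fun_strip S eps F -> strip eps a z ->
  loc (Lap F) a z = lapform (invmx (met a z))
   (\matrix_(i, j) partial (lshift 1 i) (partial (lshift 1 j) (loc F a)) z)
   (fun i => dmetric (fun r => gr r a) (lshift 1 i) z)
   (\col_i partial (lshift 1 i) (loc F a) z).
Proof.
move=> Fs az; have [ax re] := az; have [pa pE] := chart_ptP ax.
rewrite /loc (Lap_chart Fs re pa) pE.
have := @laplacian_slice R n (strip eps a) (fun r => gr r a) (@met_sym a) (loc F a) z az.
rewrite -/(met a z) => <-; congr laplacian; apply/funext => x.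
by rewrite /loc row_mxKl row_mxKr.
Qed.

End Overlaps.

Section FamilyLaplacian.
Variables (R : realType) (n : nat) (M : topologicalType) (S : manifold R n M).
Variables (p q : nat) (eps : R) (gr : R -> tensor2 S).
Hypothesis eps0 : 0 < eps.
Hypothesis fam : smooth_metric_family p q eps gr.

Local Notation rr := (rshift n (0 : 'I_1)).
Local Notation sstrip := (smooth_fun_strip S eps).
Implicit Types (F G : M -> R -> R) (a : chart S).

Definition vanish k F := forall a, vanishing (chart_img a) (strip eps a) k (@loc R n M S F a).

Lemma vanish_smooth k F : vanish k F -> sstrip F.
Proof. by move=> Fk a; exact: (vanishing_smooth (Fk a)). Qed.

(** [Lap] differentiates only along [M], so in a fixed chart it is linear in the [x]-derivatives of
    [F] with smooth coefficients; such an expression keeps the order in [rho]. *)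
Lemma Lap_vanish k F : vanish k F -> vanish k (Lap gr F).
Proof.
move=> Fk a; have Fs := vanish_smooth Fk.
have oS := @open_strip R n M S eps a; have oA := @open_img R n M S a.
have S0 := @strip0 R n M S eps eps0 a.
apply: (eq_vanishing oS S0 (f := fun z => lapform (invmx (met gr a z))
   (\matrix_(i, j) partial (lshift 1 i) (partial (lshift 1 j) (loc F a)) z)
   (fun i => dmetric (fun r => gr r a) (lshift 1 i) z)
   (\col_i partial (lshift 1 i) (loc F a) z))).
  by move=> z az; rewrite (loc_Lap fam Fs az).
have ms i j : smooth_on (strip eps a) (fun z => met gr a z i j) by exact: (met_smooth fam).
apply: (vanishing_lapform oS S0 (X := fun z => \matrix_(i, j) partial (lshift 1 i) (partial (lshift 1 j) (loc F a)) z)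
  (D := fun i z => dmetric (fun r => gr r a) (lshift 1 i) z)
  (p := fun z => \col_i partial (lshift 1 i) (loc F a) z)).
- by apply: smooth_invmx => // z; exact: (met_unit fam).
- move=> l i j; apply: (eq_smooth oS _ (smooth_partial (lshift 1 l) (ms i j))).
  by move=> z _; rewrite mxE.
- move=> i j; apply: (eq_vanishing oS S0 _ (vanishing_partial oA oS S0 i (vanishing_partial oA oS S0 j (Fk a)))).
  by move=> z _; rewrite mxE.
- move=> i j; apply: (eq_vanishing oS S0 _ (vanishing_partial oA oS S0 i (Fk a))).
  by move=> z _; rewrite mxE.
Qed.

(** [rho] is frozen in [Lap], so the scalar may depend on it; with powers of [rho] this gives the
    action on Taylor polynomials. *)
Lemma Lap_lin F G (c : R -> R) u r : sstrip F -> sstrip G -> `|r| < eps ->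
  Lap gr (fun v s => F v s + c s * G v s) u r = Lap gr F u r + c r * Lap gr G u r.
Proof.
move=> Fs Gs re; have au := chart_atP S u; rewrite /Lap; set a := chart_at S u in au *.
have oA := @open_img R n M S a.
have fs := @smooth_slice R n M S eps F a r Fs re.
have gs := @smooth_slice R n M S eps G a r Gs re.
exact: (laplacian_lin (gr r a) (c r) oA (chart_coP au) fs gs).
Qed.

Lemma Lap_cst (c : R -> R) u r : Lap gr (fun=> c) u r = 0.
Proof. exact: laplacian_cst. Qed.

Lemma eq_Lap F G u r : (forall v, F v r = G v r) -> Lap gr F u r = Lap gr G u r.
Proof. by move=> FG; rewrite /Lap; congr laplacian; apply/funext. Qed.

Definition dR F u r : R := derive1 (F u) r.

Lemma loc_dR F a : loc (dR F) a = partial rr (loc F a).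
Proof.
apply/funext => z; rewrite -{2}(hsubmxK z) [rsubmx z]mx11_scalar partial_rshift.
by rewrite /loc /dR; congr (derive1 _ _); apply/funext => s; rewrite row_mxKl row_mxKr mxE eqxx.
Qed.

Lemma dR_smooth F : sstrip F -> sstrip (dR F).
Proof. by move=> Fs a; rewrite -/(loc (dR F) a) loc_dR; exact/smooth_partial/Fs. Qed.

Lemma derivable_dR F u r : sstrip F -> `|r| < eps -> derivable (F u) r 1.
Proof.
move=> Fs re; have au := chart_atP S u; set a := chart_at S u in au.
have az := strip_row (chart_coP au) re.
have [df _] := is_derive_line_inv (derivableP (smooth_derivable (i := rr) (Fs a) az)).
suff : derivable (F u) (r + 0 *: 1) 1 by rewrite scale0r addr0.
apply: (derivable_line (F u) r 1 0).1.
have -> // : (fun s : R => F u (r + s *: 1))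
  = (fun s => loc F a (row_mx (chart_co a u) r%:M + s *: delta_mx 0 rr)).
apply/funext => s; rewrite [s *: 1]mulr1.
have -> : row_mx (chart_co a u) r%:M + s *: delta_mx 0 rr = row_mx (chart_co a u) (r + s)%:M.
  apply/rowP => j; case: (split_ordP j) => l ->.
    by rewrite !(row_mxEl, mxE) eq_lrshift andbF mulr0 addr0.
  by rewrite !(row_mxEr, mxE) eq_rshift [l]ord1 eqxx !mulr1n mulr1.
by rewrite loc_row chart_coK.
Qed.

End FamilyLaplacian.

Local Opaque laplacian.

(** * The volume ratio of the family and its fourth root *)

Section VolumeDensity.
Variables (R : realType) (n : nat) (M : topologicalType) (S : manifold R n M).
Variables (p q : nat) (eps : R) (gr : R -> tensor2 S).
Hypothesis eps0 : 0 < eps.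
Hypothesis fam : smooth_metric_family p q eps gr.

Local Notation rr := (rshift n (0 : 'I_1)).
Local Notation sstrip := (smooth_fun_strip S eps).
Local Notation vanish := (@vanish R n M S eps).
Implicit Types (F G : M -> R -> R) (a b : chart S).

Lemma vanishS k F :
  vanish k.+1 F <-> [/\ sstrip F, forall u, F u 0 = 0 & vanish k (@dR R M F)].
Proof.
split=> [Fk|[Fs F0 Fk] a].
  split; first exact: vanish_smooth Fk.
    move=> u; have au := chart_atP S u.
    have [_ [F0 _]] := Fk (chart_at S u).
    have := F0 _ (chart_coP au).
    by rewrite -(raddf0 (@scalar_mx R 1)) loc_row chart_coK.
  by move=> a; rewrite loc_dR; have [_ []] := Fk a.
split; first exact: Fs.
split; last by rewrite -loc_dR; exact: Fk.
by move=> x ax; rewrite -(raddf0 (@scalar_mx R 1)) loc_row.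
Qed.

Definition vol u r : R :=
  \det (gr r (chart_at S u) (chart_co (chart_at S u) u)) /
  \det (gr 0 (chart_at S u) (chart_co (chart_at S u) u)).

Definition wfun u r : R := Num.sqrt (Num.sqrt (vol u r)).

Lemma abs0 : `|0 : R| < eps. Proof. by rewrite normr0. Qed.

(** Both determinants pick up the same factor, the squared Jacobian determinant, since the change of
    charts does not involve [rho]. *)
Lemma vol_chart b u r : `|r| < eps -> chart_dom b u ->
  vol u r = \det (gr r b (chart_co b u)) / \det (gr 0 b (chart_co b u)).
Proof.
move=> re bu; rewrite /vol; set a := chart_at S u.
have au : chart_dom a u by exact: chart_atP.
have [tr _ _] := fam.1 r re; have [t0 _ _] := fam.1 0 abs0.
have := t0 a b u au bu; have := tr a b u au bu.
rewrite /=; set J := jacobian _ _ => -> E0.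
have ua := signature_unit (gr_signature fam (chart_coP au) abs0).
move: ua; rewrite E0 unitmxE unitfE !det_mulmx det_tr !mulf_eq0 !negb_or.
by move=> /andP[/andP[J0 b0] _]; field; rewrite b0 J0.
Qed.

Lemma vol_gt0 u r : `|r| < eps -> 0 < vol u r.
Proof.
move=> re; have cu := chart_coP (chart_atP S u).
exact: (signature_det_ratio (gr_signature fam cu re) (gr_signature fam cu abs0)).
Qed.

Lemma wfun_gt0 u r : `|r| < eps -> 0 < wfun u r.
Proof. by move=> re; rewrite !sqrtr_gt0 vol_gt0. Qed.

Lemma wfun0 u : wfun u 0 = 1.
Proof.
rewrite /wfun /vol mulfV ?sqrtr1 //.
have := signature_unit (gr_signature fam (chart_coP (chart_atP S u)) abs0).
by rewrite unitmxE unitfE.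
Qed.

Lemma wfun4 u r : `|r| < eps -> wfun u r ^+ 4 = vol u r.
Proof.
move=> re; rewrite (exprM _ 2 2) sqr_sqrtr ?sqrtr_ge0 // sqr_sqrtr //.
exact/ltW/vol_gt0.
Qed.

Let gr0 a (z : 'rV[R]_(n + 1)) : 'M[R]_n := gr 0 a (lsubmx z).

Lemma smooth_pullback a (f : 'rV[R]_n -> R) : smooth_on (chart_img a) f ->
  smooth_on (strip eps a) (fun z => f (lsubmx z)).
Proof.
apply: (@smooth_comp_affine R (n + 1) n (chart_img a) (strip eps a)
   (fun z => lsubmx z)
   (fun k => match fintype.split k with inl l => delta_mx 0 l | inr _ => 0 end)).
- exact: open_img.
- exact: open_strip.
- by move=> z; exact/differentiable_continuous/differentiable_lsubmx.
- move=> z k h; apply/rowP => l; rewrite !mxE; case: split_ordP => k' ->.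
    by rewrite !mxE eq_lshift.
  by rewrite mxE eq_lrshift andbF.
- move=> k; case: split_ordP => k' _; last by left.
  by right; exists k'.
- by move=> z [].
Qed.

Lemma gr0_smooth a i j : smooth_on (strip eps a) (fun z => gr0 a z i j).
Proof.
apply: (smooth_pullback (f := fun x => gr 0 a x i j)).
by apply: (gr_smooth fam); exact: abs0.
Qed.

Lemma loc_vol a z : strip eps a z ->
  loc vol a z = \det (met gr a z) / \det (gr0 a z).
Proof.
move=> [ax re]; have [pa pE] := chart_ptP ax.
by rewrite /loc (vol_chart re pa) pE.
Qed.

Lemma gr0_det a z : strip eps a z -> \det (gr0 a z) != 0.
Proof.
move=> [ax re]; have := signature_unit (gr_signature fam ax abs0).
by rewrite unitmxE unitfE.
Qed.

Lemma vol_smooth : sstrip vol.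
Proof.
move=> a; have oS := @open_strip R n M S eps a.
apply: (eq_smooth oS (f := fun z => \det (met gr a z) * (\det (gr0 a z))^-1)).
  by move=> z az; rewrite -/(loc vol a z) loc_vol.
apply: smoothM => //; first by apply: smooth_det => // i j; exact: (met_smooth fam).
apply: smoothV => //; last exact: gr0_det.
by apply: smooth_det => // i j; exact: gr0_smooth.
Qed.

Lemma wfun_smooth : sstrip wfun.
Proof.
move=> a; have oS := @open_strip R n M S eps a.
have v0 z : strip eps a z -> 0 < loc vol a z.
  by move=> [_ re]; exact: vol_gt0.
apply: (@smooth_sqrt R _ _ oS (fun z => Num.sqrt (loc vol a z))).
  exact: smooth_sqrt (vol_smooth a) v0.
by move=> z az; rewrite sqrtr_gt0 v0.
Qed.

(** Jacobi's formula applied to [det g_rho = w^4 det g_0], in which the last factor is constant in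
    [rho], gives [4 w' / w] for the trace of [g^-1 g']. *)
Lemma tr_dmetric a z : strip eps a z ->
  2^-1 * \tr (invmx (met gr a z) *m dmetric (fun r => gr r a) rr z)
  = 2 * (loc (@dR R M wfun) a z / loc wfun a z).
Proof.
move=> az; have oS := @open_strip R n M S eps a.
have w0 : loc wfun a z != 0 by have [_ re] := az; rewrite gt_eqF // wfun_gt0.
have d0 := gr0_det az.
have detE y : strip eps a y -> \det (met gr a y) = loc wfun a y ^+ 4 * \det (gr0 a y).
  move=> ay; have [_ re] := ay.
  rewrite [loc wfun a y ^+ 4](wfun4 (chart_pt a (lsubmx y)) re) -/(loc vol a y).
  by rewrite loc_vol // divfK // gr0_det.
have dz : is_derive z (delta_mx 0 rr) (fun y => \det (met gr a y))
    (\tr (\adj (met gr a z) *m dmetric (fun r => gr r a) rr z)).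
  apply: is_derive_det => i j; rewrite mxE; apply: derivableP.
  exact: smooth_derivable (met_smooth fam a i j) az.
have dg0 : partial rr (fun y => \det (gr0 a y)) z = 0.
  rewrite -(hsubmxK z) [rsubmx z]mx11_scalar partial_rshift.
  rewrite (_ : (fun s => _) = cst (\det (gr 0 a (lsubmx z)))) ?derive1_cst //.
  by apply/funext => s; rewrite /gr0 row_mxKl.
have ws : smooth_on (strip eps a) (loc wfun a) := wfun_smooth a.
have w2s := smoothM oS ws ws; have w4s := smoothM oS w2s w2s.
have g0s : smooth_on (strip eps a) (fun y => \det (gr0 a y)).
  by apply: smooth_det => // i j; exact: gr0_smooth.
have E : \tr (\adj (met gr a z) *m dmetric (fun r => gr r a) rr z)
   = 4 * loc wfun a z ^+ 3 * partial rr (loc wfun a) z * \det (gr0 a z).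
  rewrite -(partial_is_derive dz).
  rewrite (eq_partial oS _ az (g := fun y => loc wfun a y * loc wfun a y
     * (loc wfun a y * loc wfun a y) * \det (gr0 a y))); last first.
    by move=> y ay; rewrite (detE y ay); ring.
  rewrite (partialM _ w4s g0s) // dg0 (partialM _ w2s w2s) // (partialM _ ws ws) //.
  by ring.
have mu : \det (met gr a z) != 0.
  by have := met_unit fam az; rewrite unitmxE unitfE.
rewrite (invmx_adj (met_unit fam az)) -scalemxAl mxtraceZ E loc_dR (detE _ az).
by field; rewrite d0 w0.
Qed.

End VolumeDensity.

(** * Conjugation of the ambient Laplacian *)

Section Conjugation.
Variables (R : realType) (n : nat) (M : topologicalType) (S : manifold R n M).
Variables (p q : nat) (eps : R) (gr : R -> tensor2 S).
Hypothesis eps0 : 0 < eps.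
Hypothesis fam : smooth_metric_family p q eps gr.

Local Notation sstrip := (smooth_fun_strip S eps).
Local Notation w := (wfun gr).
Local Notation dR := (@dR R M).
Implicit Types (F G : M -> R -> R) (a b : chart S).

Lemma sstripD F G : sstrip F -> sstrip G -> sstrip (fun v s => F v s + G v s).
Proof. by move=> Fs Gs a; exact: (smoothD (@open_strip _ _ _ _ _ a) (Fs a) (Gs a)). Qed.

Lemma sstripM F G : sstrip F -> sstrip G -> sstrip (fun v s => F v s * G v s).
Proof. by move=> Fs Gs a; exact: (smoothM (@open_strip _ _ _ _ _ a) (Fs a) (Gs a)). Qed.

Lemma sstrip_cst (c : R) : sstrip (fun _ _ => c).
Proof. by move=> a; exact: (smooth_cst (@open_strip _ _ _ _ _ a) c). Qed.

Lemma sstripX : sstrip (fun _ s => s).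
Proof.
move=> a; have oS := @open_strip R n M S eps a.
by apply: (eq_smooth oS _ (smooth_coord (rshift n 0) oS)) => z _; rewrite mxE.
Qed.

Lemma sstripV F : sstrip F -> (forall v s, `|s| < eps -> F v s != 0) ->
  sstrip (fun v s => (F v s)^-1).
Proof.
move=> Fs F0 a; apply: (smoothV (@open_strip _ _ _ _ _ a) (Fs a)).
by move=> z [_ re]; exact: F0.
Qed.

Lemma sstrip_const (f : M -> R) : smooth_fun S f -> sstrip (fun u _ => f u).
Proof. by move=> fs a; exact: (smooth_pullback eps (fs a)). Qed.

Lemma eq_sstrip F G : (forall v s, `|s| < eps -> F v s = G v s) -> sstrip F -> sstrip G.
Proof.
move=> FG Fs a; apply: (eq_smooth (@open_strip _ _ _ _ _ a) _ (Fs a)).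
by move=> z [_ re]; exact: FG.
Qed.

Lemma w_neq0 u r : `|r| < eps -> w u r != 0.
Proof. by move=> re; rewrite gt_eqF // (wfun_gt0 eps0 fam). Qed.

Lemma wV_smooth : sstrip (fun v s => (w v s)^-1).
Proof. by apply: sstripV; [exact: (wfun_smooth eps0 fam)|exact: w_neq0]. Qed.

Lemma eq_dR F G u r : `|r| < eps -> (forall s, `|s| < eps -> F u s = G u s) ->
  dR F u r = dR G u r.
Proof.
move=> re FG; rewrite /dR !derive1E; apply: near_eq_derive.
have : nbhs r (ball (0 : R) eps).
  apply: open_nbhs_nbhs; split; first exact: ball_open.
  by rewrite -ball_normE /= sub0r normrN.
by apply: filterS => s; rewrite -ball_normE /= sub0r normrN; exact: FG.
Qed.

Lemma dRD F G u r : sstrip F -> sstrip G -> `|r| < eps ->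
  dR (fun v s => F v s + G v s) u r = dR F u r + dR G u r.
Proof.
move=> Fs Gs re.
have dF : derivable (F u) r 1 := derivable_dR Fs re.
have dG : derivable (G u) r 1 := derivable_dR Gs re.
by rewrite /dR !derive1E -deriveD.
Qed.

Lemma dRM F G u r : sstrip F -> sstrip G -> `|r| < eps ->
  dR (fun v s => F v s * G v s) u r = dR F u r * G u r + F u r * dR G u r.
Proof.
move=> Fs Gs re.
have dF : derivable (F u) r 1 := derivable_dR Fs re.
have dG : derivable (G u) r 1 := derivable_dR Gs re.
rewrite /dR !derive1E addrC [X in _ + X]mulrC.
exact: (deriveM dF dG).
Qed.

Lemma dR_const (f : M -> R) u r : dR (fun v _ => f v) u r = 0.
Proof. exact: derive1_cst. Qed.

Lemma dRX u r : dR (fun _ s => s) u r = 1.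
Proof. by rewrite /dR derive1E derive_id. Qed.

Lemma eq_ambient_laplacian (F G : R -> M -> R -> R) t u r : 0 < t -> `|r| < eps ->
  (forall t v s, 0 < t -> `|s| < eps -> F t v s = G t v s) ->
  ambient_laplacian gr F t u r = ambient_laplacian gr G t u r.
Proof.
move=> t0 re FG; rewrite /ambient_laplacian; set a := chart_at S u.
have au : chart_dom a u by exact: chart_atP.
apply: (eq_laplacian (open_amb (@open_strip R n M S eps a))) => //.
- rewrite /= row_mxKl mxE eqxx mulr1n; split=> //.
  by rewrite row_mxKr; apply: strip_row => //; exact: chart_coP.
- by move=> z [z0 [_ ze]]; exact: FG.
Qed.

Lemma ambient_sep (h dh : R -> R) F t u r :
  (forall t : R, 0 < t -> is_derive t (1 : R) h (dh t)) ->
  sstrip F -> 0 < t -> `|r| < eps ->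
  ambient_laplacian gr (fun t v s => h t * F v s) t u r =
  t ^- 2 * (h t * Lap gr F u r + 2 * t * dh t * dR F u r
    - 2 * r * h t * dR (dR F) u r + (n%:R - 2) * h t * dR F u r
    + 2 * (dR w u r / w u r) * (t * dh t * F u r - 2 * r * h t * dR F u r)).
Proof.
move=> hd Fs t0 re; rewrite /ambient_laplacian; set a := chart_at S u.
have au : chart_dom a u by exact: chart_atP.
have az := strip_row (chart_coP au) re.
set z : 'rV[R]_(1 + (n + 1)) := row_mx t%:M (row_mx (chart_co a u) r%:M).
have e1 (c : R) : (c%:M : 'M[R]_1) 0 0 = c by rewrite mxE eqxx.
have Uz : [set z : 'rV[R]_(1 + (n + 1)) | 0 < lsubmx z 0 0 /\ strip eps a (rsubmx z)] z.
  by rewrite /= row_mxKl row_mxKr e1; split.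
have := @laplacian_ambient R n (strip eps a) (fun r => gr r a)
  (@open_strip R n M S eps a) (met_smooth fam a)
  (@met_sym R n M S p q eps gr fam a) (@met_unit R n M S p q eps gr fam a)
  h dh (loc F a) hd (Fs a) z Uz.
rewrite /z /= row_mxKr row_mxKl row_mxKr row_mxKl !e1 => LE.
apply: (etrans LE).
have -> : laplacian (gr r a) (fun x => loc F a (row_mx x r%:M)) (chart_co a u)
   = Lap gr F u r.
  rewrite /Lap -/a; congr laplacian; apply/funext => x.
  by rewrite loc_row.
have := tr_dmetric eps0 fam az.
rewrite /met row_mxKr row_mxKl e1 !loc_row => ->.
by rewrite -!loc_dR !loc_row chart_coK.
Qed.

Definition MOp F u r : R :=
  w u r * Lap gr (fun v s => (w v s)^-1 * F v s) u r
  + (2 * r * dR (dR w) u r - (n%:R - 2) * dR w u r) * (w u r)^-1 * F u r.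

Definition Dop (c : R) F u r : R :=
  - 2 * (r * dR (dR F) u r) + 2 * c * dR F u r + MOp F u r.

Let ws : sstrip w := wfun_smooth eps0 fam.

(* [x ^ g F / w] is mapped to [x ^ (g - 2) D F / w]: conjugation by [w] makes
   the zeroth-order term independent of the degree of homogeneity. *)
Lemma ambient_conj (h dh : R -> R) F t u r (c : R) :
  (forall t : R, 0 < t -> is_derive t (1 : R) h (dh t)) ->
  t * dh t = (c - n%:R / 2 + 1) * h t ->
  sstrip F -> 0 < t -> `|r| < eps ->
  ambient_laplacian gr (fun t v s => h t * ((w v s)^-1 * F v s)) t u r =
  t ^- 2 * h t * ((w u r)^-1 * Dop c F u r).
Proof.
move=> hd th Fs t0 re.
have w0 := w_neq0 u re.
pose f := fun v s => (w v s)^-1 * F v s.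
have fs : sstrip f := sstripM wV_smooth Fs.
have Ff v s : `|s| < eps -> F v s = w v s * f v s.
  by move=> se; rewrite /f mulrA mulfV ?mul1r ?w_neq0.
have dws := dR_smooth ws; have dfs := dR_smooth fs.
have d1 s : `|s| < eps -> dR F u s = dR w u s * f u s + w u s * dR f u s.
  by move=> se; rewrite (eq_dR (G := fun v s => w v s * f v s) se (Ff u)) dRM.
have d2 : dR (dR F) u r = dR (dR w) u r * f u r + dR w u r * dR f u r
   + (dR w u r * dR f u r + w u r * dR (dR f) u r).
  rewrite (eq_dR (G := fun v s => dR w v s * f v s + w v s * dR f v s) re d1).
  by rewrite (dRD _ (sstripM dws fs) (sstripM ws dfs) re) (dRM _ dws fs re) (dRM _ ws dfs re).
(* With [F = w f], the term [4 rho w' f'] in the expansion of [-2 rho w f''] cancels against the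
   trace term, and so does the part of [-2 c w' f] that depends on the degree. Both cancellations
   rely on [w] being the fourth root of the ratio of determinants. *)
rewrite (ambient_sep u hd fs t0 re) /Dop /MOp -/f d2 (d1 r re) (Ff u r re).
rewrite -(mulrA 2 t (dh t)) th.
set a := Lap gr f u r; set b := dR (dR w) u r; set e := dR w u r.
set f0 := f u r; set f1 := dR f u r; set f2 := dR (dR f) u r; set w1 := w u r in w0 *.
have t1 : t != 0 by rewrite gt_eqF.
by field; rewrite w0 t1.
Qed.

End Conjugation.

(** * Taylor coefficients at rho = 0 *)

Section Jets.
Variables (R : realType) (n : nat) (M : topologicalType) (S : manifold R n M).
Variables (p q : nat) (eps : R) (gr : R -> tensor2 S).
Hypothesis eps0 : 0 < eps.
Hypothesis fam : smooth_metric_family p q eps gr.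

Local Notation sstrip := (smooth_fun_strip S eps).
Local Notation vanish := (@vanish R n M S eps).
Local Notation w := (wfun gr).
Local Notation dR := (@dR R M).
Local Notation MOp := (MOp gr).
Local Notation Dop := (Dop gr).
Implicit Types (F G H : M -> R -> R) (f : M -> R).

Let ws : sstrip w := wfun_smooth eps0 fam.

Lemma vanishD k F G : vanish k F -> vanish k G -> vanish k (fun v s => F v s + G v s).
Proof.
move=> Fk Gk a; have oS := @open_strip R n M S eps a.
exact: (vanishingD oS (@strip0 R n M S eps eps0 a) (Fk a) (Gk a)).
Qed.

Lemma vanishM k F G : sstrip F -> vanish k G -> vanish k (fun v s => F v s * G v s).
Proof.
move=> Fs Gk a; have oS := @open_strip R n M S eps a.
exact: (vanishingM oS (@strip0 R n M S eps eps0 a) (Fs a) (Gk a)).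
Qed.

Lemma MOp_vanish k F : vanish k F -> vanish k (MOp F).
Proof.
move=> Fk; apply: vanishD.
  by apply: vanishM => //; apply: (Lap_vanish eps0 fam); apply: vanishM => //; exact: (wV_smooth eps0 fam).
apply: vanishM => //; apply: sstripM; last exact: (wV_smooth eps0 fam).
have d1 := dR_smooth ws; have d2 := dR_smooth d1.
apply: (eq_sstrip (F := fun v s => 2 * s * dR (dR w) v s + - (n%:R - 2) * dR w v s)).
  by move=> v s _; ring.
apply: sstripD; apply: sstripM => //; last exact: sstrip_cst.
by apply: sstripM; [exact: sstrip_cst|exact: sstripX].
Qed.

Lemma MOp_smooth F : sstrip F -> sstrip (MOp F).
Proof. by move=> Fs; apply: (@vanish_smooth _ _ _ _ _ 0); apply: MOp_vanish => a; exact: vanishing0. Qed.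

Lemma Dop_smooth c F : sstrip F -> sstrip (Dop c F).
Proof.
move=> Fs; have d1 := dR_smooth Fs; have d2 := dR_smooth d1.
apply: sstripD; last exact: MOp_smooth.
apply: sstripD; apply: sstripM => //; try exact: sstrip_cst.
by apply: sstripM => //; exact: sstripX.
Qed.

Lemma MOp_lin F G (c : R -> R) u r : sstrip F -> sstrip G -> `|r| < eps ->
  MOp (fun v s => F v s + c s * G v s) u r = MOp F u r + c r * MOp G u r.
Proof.
move=> Fs Gs re; rewrite /MOp.
have wF := sstripM (wV_smooth eps0 fam) Fs; have wG := sstripM (wV_smooth eps0 fam) Gs.
rewrite (eq_Lap _ (G := fun v s => (w v s)^-1 * F v s + c s * ((w v s)^-1 * G v s))).
  by rewrite (Lap_lin gr c u wF wG re); ring.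
by move=> v; ring.
Qed.

Lemma eq_MOp F G u r : (forall v, F v r = G v r) -> MOp F u r = MOp G u r.
Proof.
move=> FG; rewrite /MOp FG; congr (_ * _ + _).
by apply: eq_Lap => v; rewrite FG.
Qed.

Lemma MOp0 u r : MOp (fun _ _ => 0) u r = 0.
Proof.
rewrite /MOp mulr0 addr0 (eq_Lap _ (G := fun=> fun=> 0)).
  by rewrite Lap_cst mulr0.
by move=> v; rewrite mulr0.
Qed.

Definition jet F (k : nat) (u : M) : R := iter k dR F u 0 / (k`!)%:R.

Lemma eq_iter_dR k F G u r : (forall v s, `|s| < eps -> F v s = G v s) ->
  `|r| < eps -> iter k dR F u r = iter k dR G u r.
Proof.
move=> FG; elim: k u r => [|k IH] u r re; first exact: FG.
by apply: (eq_dR (eps := eps)) => // s se; exact: IH.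
Qed.

Lemma eq_jet F G k u : (forall v s, `|s| < eps -> F v s = G v s) ->
  jet F k u = jet G k u.
Proof. by move=> FG; rewrite /jet (eq_iter_dR _ _ FG) // normr0. Qed.

Lemma iter_dR_smooth k F : sstrip F -> sstrip (iter k dR F).
Proof. by elim: k => [|k IH] //= /IH /dR_smooth. Qed.

Lemma jet_smooth F k : sstrip F -> smooth_fun S (jet F k).
Proof.
move=> Fs a; have oA := @open_img R n M S a.
have e0 : `|0 : R| < eps by rewrite normr0.
have := @smooth_slice R n M S eps (iter k dR F) a 0 (iter_dR_smooth k Fs) e0.
by move=> /(smoothZ oA (k`!)%:R^-1); apply: eq_smooth => // x _; rewrite mulrC.
Qed.

Lemma jet_dR F k u : jet (dR F) k u = k.+1%:R * jet F k.+1 u.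
Proof.
by rewrite /jet iterSr factS natrM invfM mulrCA mulVKf ?pnatr_eq0.
Qed.

Lemma jet0 F u : jet F 0 u = F u 0.
Proof. by rewrite /jet divr1. Qed.

Lemma jet_lin F G (c : R) k u : sstrip F -> sstrip G ->
  jet (fun v s => F v s + c * G v s) k u = jet F k u + c * jet G k u.
Proof.
move=> Fs Gs; rewrite /jet; suff -> : iter k dR (fun v s => F v s + c * G v s) u 0
    = iter k dR F u 0 + c * iter k dR G u 0 by ring.
have : `|0 : R| < eps by rewrite normr0.
elim: k u (0 : R) => [|k IH] u r re //.
rewrite /= (eq_dR (eps := eps) (G := fun v s => iter k dR F v s + c * iter k dR G v s)) //; last first.
  by move=> s se; exact: IH.
have dF := iter_dR_smooth k Fs; have dG := iter_dR_smooth k Gs.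
rewrite (dRD _ dF (sstripM (@sstrip_cst R n M S eps c) dG) re).
by rewrite (dRM _ (@sstrip_cst R n M S eps c) dG re) dR_const mul0r add0r.
Qed.

Lemma jet_X F k u : sstrip F ->
  jet (fun v s => s * F v s) k u = if k is k'.+1 then jet F k' u else 0.
Proof.
move=> Fs; have H m r : `|r| < eps -> iter m dR (fun v s => s * F v s) u r
    = r * iter m dR F u r + m%:R * iter m.-1 dR F u r.
  elim: m r => [|m IH] r re; first by rewrite /= mul0r addr0.
  rewrite iterS (eq_dR (eps := eps) (G := fun v s => s * iter m dR F v s + m%:R * iter m.-1 dR F v s)) //.
  have dF := iter_dR_smooth m Fs; have dF' := iter_dR_smooth m.-1 Fs.
  have sc := @sstrip_cst R n M S eps m%:R.
  rewrite (dRD _ (sstripM (@sstripX R n M S eps) dF) (sstripM sc dF') re).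
  rewrite (dRM _ (@sstripX R n M S eps) dF re) (dRM _ sc dF' re) dRX dR_const mul0r add0r mul1r.
  case: m {IH dF dF' sc} => [|m]; first by rewrite mul0r /=; ring.
  by rewrite -[m.+2%:R]natr1 /=; ring.
rewrite /jet H ?normr0 // mul0r add0r; case: k => [|k]; first by rewrite !mul0r.
by rewrite factS natrM invfM -mulrA mulrCA mulVKf ?pnatr_eq0.
Qed.

Lemma jet_const f k u : jet (fun v _ => f v) k u = if k is 0 then f u else 0.
Proof.
case: k => [|k]; first by rewrite jet0.
rewrite /jet iterSr (@eq_iter_dR k _ (fun _ _ => 0)) ?normr0 //; last first.
  by move=> v s _; rewrite dR_const.
rewrite (_ : iter k dR _ = fun _ _ => 0) ?mul0r //.
elim: k => //= k ->; apply/funext => v; apply/funext => s; exact: dR_const.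
Qed.

Lemma vanish_jet k F : vanish k F <-> sstrip F /\ forall j u, (j < k)%N -> jet F j u = 0.
Proof.
elim: k F => [|k IH] F.
  split=> [Fk|[Fs _] a]; last exact: vanishing0.
  by split=> //; exact: vanish_smooth Fk.
split=> [/(vanishS S eps)[Fs F0 /IH[_ Fk]]|[Fs Fk]].
  split=> // -[|j] u jk; first by rewrite jet0.
  have := Fk j u jk; rewrite jet_dR => /eqP.
  by rewrite mulf_eq0 pnatr_eq0 /= => /eqP.
apply/vanishS; split=> //; first by move=> u; rewrite -jet0 Fk.
apply/IH; split=> [|j u jk]; first exact: dR_smooth.
by rewrite jet_dR Fk ?mulr0.
Qed.

End Jets.

(** * Smooth functions as a module, and the coefficients of the conjugated operator *)

Section SmoothFunctions.
Variables (R : realType) (n : nat) (M : topologicalType) (S : manifold R n M).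

Definition smoothp : {pred M -> R} := fun f => `[<smooth_fun S f>].

Lemma smoothp_submod_closed : submod_closed smoothp.
Proof.
split=> [|c f g /asboolP fs /asboolP gs]; apply/asboolP => a.
  exact: (smooth_cst (@open_img _ _ _ _ a)).
have oA := @open_img R n M S a.
exact: (smoothD oA (smoothZ oA c (fs a)) (gs a)).
Qed.

HB.instance Definition _ :=
  GRing.isSubmodClosed.Build R (M -> R) smoothp smoothp_submod_closed.

(** The power series algebra requires maps that are linear on a whole module, whereas the operators
    here are additive only on smooth functions; hence the bundled type. *)
Record smfun := SmFun { smfun_val : M -> R; smfun_prop : smfun_val \in smoothp }.

HB.instance Definition _ := [isSub for smfun_val].
HB.instance Definition _ := [Choice of smfun by <:].
HB.instance Definition _ := [SubChoice_isSubLmodule of smfun by <:].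

Lemma smfun_smooth (f : smfun) : smooth_fun S (val f).
Proof. by have := valP f => /asboolP. Qed.

Definition mksmfun (f : M -> R) (fs : smooth_fun S f) : smfun := SmFun (asboolT fs).

Lemma smfunD (f g : smfun) u : val (f + g) u = val f u + val g u.
Proof. by []. Qed.

Lemma smfunN (f : smfun) u : val (- f) u = - val f u.
Proof. by []. Qed.

Lemma smfunZ c (f : smfun) u : val (c *: f) u = c * val f u.
Proof. by []. Qed.

Lemma smfun_sum (I : Type) (r : seq I) (F : I -> smfun) u :
  val (\sum_(i <- r) F i) u = \sum_(i <- r) val (F i) u.
Proof. by elim/big_ind2: _ => // f x g y <- <-. Qed.

End SmoothFunctions.

Section JetConvolution.
Variables (R : realType) (n : nat) (M : topologicalType) (S : manifold R n M).
Variables (p q : nat) (eps : R) (gr : R -> tensor2 S).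
Hypothesis eps0 : 0 < eps.
Hypothesis fam : smooth_metric_family p q eps gr.

Local Notation sstrip := (smooth_fun_strip S eps).
Local Notation vanish := (@vanish R n M S eps).
Local Notation MOp := (MOp gr).
Local Notation jet := (@jet R M).
Implicit Types (F G H : M -> R -> R) (f : M -> R).

Let abs_eps0 : `|0 : R| < eps. Proof. by rewrite normr0. Qed.

Lemma sstripXn m H : sstrip H -> sstrip (fun v s => s ^+ m * H v s).
Proof.
move=> Hs; elim: m => [|m IH].
  by apply: eq_sstrip Hs => v s _; rewrite mul1r.
apply: eq_sstrip (sstripM (@sstripX R n M S eps) IH) => v s _.
by rewrite exprS mulrA.
Qed.

Lemma jet_Xn m H k u : sstrip H ->
  jet (fun v s => s ^+ m * H v s) k u = if (m <= k)%N then jet H (k - m) u else 0.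
Proof.
move=> Hs; elim: m k => [|m IH] k.
  by rewrite subn0; apply: (eq_jet eps0) => v s _; rewrite mul1r.
rewrite (eq_jet eps0 (G := fun v s => s * (s ^+ m * H v s))); last first.
  by move=> v s _; rewrite exprS mulrA.
rewrite (jet_X eps0 _ _ (sstripXn m Hs)); by case: k.
Qed.

Definition taylor (m : nat) (F : M -> R -> R) (v : M) (s : R) : R :=
  \sum_(i < m) s ^+ i * jet F i v.

Lemma taylorS m F v s :
  taylor m.+1 F v s = taylor m F v s + 1 * (s ^+ m * jet F m v).
Proof. by rewrite /taylor big_ord_recr mul1r. Qed.

Lemma taylorE m F : taylor m.+1 F = fun v s => taylor m F v s + 1 * (s ^+ m * jet F m v).
Proof. by apply/funext => v; apply/funext => s; exact: taylorS. Qed.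

Lemma jet_const_smooth F m : sstrip F -> sstrip (fun v _ => jet F m v).
Proof. by move=> Fs; apply: sstrip_const; exact: (jet_smooth eps0). Qed.

Lemma taylor_smooth m F : sstrip F -> sstrip (taylor m F).
Proof.
move=> Fs; elim: m => [|m IH].
  by apply: eq_sstrip (@sstrip_cst R n M S eps 0) => v s _; rewrite /taylor big_ord0.
rewrite taylorE; apply: sstripD => //; apply: sstripM; first exact: sstrip_cst.
exact/sstripXn/jet_const_smooth.
Qed.

Lemma jet_taylor m F k u : sstrip F ->
  jet (taylor m F) k u = if (k < m)%N then jet F k u else 0.
Proof.
move=> Fs; elim: m => [|m IH].
  rewrite (eq_jet eps0 (G := fun v _ => (fun=> 0) v)).
    by rewrite (jet_const eps0); case: k.
  by move=> v s _; rewrite /taylor big_ord0.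
have Fm := jet_const_smooth m Fs.
rewrite taylorE (jet_lin eps0 _ _ _ (taylor_smooth m Fs) (sstripXn m Fm)).
rewrite IH mul1r (jet_Xn _ _ _ Fm) (jet_const eps0) ltnS.
have [km|mk|->] := ltngtP k m.
- by rewrite addr0.
- by case E : (k - m)%N => [|j]; [lia|rewrite addr0].
- by rewrite subnn add0r.
Qed.

Lemma MOp_taylor m F u r : sstrip F -> `|r| < eps ->
  MOp (taylor m F) u r = \sum_(i < m) r ^+ i * MOp (fun v _ => jet F i v) u r.
Proof.
move=> Fs re; elim: m => [|m IH].
  rewrite big_ord0 (eq_MOp _ _ (G := fun _ _ => 0)) ?MOp0 // => v.
  by rewrite /taylor big_ord0.
rewrite big_ord_recr -IH /=.
rewrite (eq_MOp _ _ (G := fun v s => taylor m F v s + s ^+ m * jet F m v)).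
  by rewrite (MOp_lin eps0 fam (fun s => s ^+ m) _ (taylor_smooth m Fs) (jet_const_smooth m Fs) re).
by move=> v; rewrite taylorS mul1r.
Qed.

Lemma jet_sum m (F : nat -> M -> R -> R) k u : (forall i, sstrip (F i)) ->
  jet (fun v s => \sum_(i < m) F i v s) k u = \sum_(i < m) jet (F i) k u
  /\ sstrip (fun v s => \sum_(i < m) F i v s).
Proof.
move=> Fs; elim: m => [|m [IH IHs]].
  rewrite big_ord0 (eq_jet eps0 (G := fun v _ => (fun=> 0) v)).
    split; first by rewrite (jet_const eps0); case: k.
    by apply: eq_sstrip (@sstrip_cst R n M S eps 0) => v s _; rewrite big_ord0.
  by move=> v s _; rewrite big_ord0.
have E v s : `|s| < eps -> \sum_(i < m.+1) F i v s = \sum_(i < m) F i v s + 1 * F m v s.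
  by move=> _; rewrite big_ord_recr mul1r.
rewrite (eq_jet eps0 _ _ E) (jet_lin eps0 _ _ _ IHs (Fs m)) IH big_ord_recr mul1r.
split=> //; apply: eq_sstrip (sstripD IHs (Fs m)) => v s _.
by rewrite big_ord_recr.
Qed.

(** [F] differs from its Taylor polynomial of degree [k] by a function vanishing to order [k + 1],
    which [MOp] maps to one of the same kind. On the polynomial, powers of [rho] pass through [MOp],
    and the coefficients convolve. *)
Lemma jet_MOp F k u : sstrip F ->
  jet (MOp F) k u = \sum_(j < k.+1) jet (MOp (fun v _ => jet F (k - j) v)) j u.
Proof.
move=> Fs; have Ts := taylor_smooth k.+1 Fs.
pose G v s := F v s + (-1) * taylor k.+1 F v s.
have Gs : sstrip G by apply: sstripD => //; apply: sstripM => //; exact: sstrip_cst.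
have Gk : vanish k.+1 G.
  apply/(vanish_jet S eps); split=> // j v jk.
  by rewrite /G (jet_lin eps0 _ _ _ Fs Ts) jet_taylor // jk mulN1r subrr.
have [_ /(_ k u (ltnSn k)) G0] := (vanish_jet S eps _ _).1 (MOp_vanish eps0 fam Gk).
have MFs := MOp_smooth eps0 fam Fs; have MTs := MOp_smooth eps0 fam Ts.
have E v s : `|s| < eps -> MOp G v s = MOp F v s + (-1) * MOp (taylor k.+1 F) v s.
  by move=> se; rewrite /G (MOp_lin eps0 fam (fun=> -1) _ Fs Ts se).
move: G0; rewrite (eq_jet eps0 _ _ E) (jet_lin eps0 _ _ _ MFs MTs) mulN1r => /subr0_eq ->.
have E' v s : `|s| < eps -> MOp (taylor k.+1 F) v s
    = \sum_(i < k.+1) s ^+ i * MOp (fun v _ => jet F i v) v s.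
  by move=> se; exact: MOp_taylor.
have MFi i : sstrip (MOp (fun v _ => jet F i v)) by exact/(MOp_smooth eps0 fam)/jet_const_smooth.
rewrite (eq_jet eps0 _ _ E').
have [-> _] := jet_sum k.+1 (F := fun i v s => s ^+ i * MOp (fun v _ => jet F i v) v s) k u (fun i => sstripXn i (MFi i)).
rewrite (reindex_inj rev_ord_inj) /=; apply: eq_bigr => -[j jk] _ /=.
rewrite subSS (jet_Xn _ _ _ (MFi _)) leq_subr.
by rewrite subKn.
Qed.

End JetConvolution.

(** * GJMS operators and Q-curvatures *)

Section AmbientIterates.
Variables (R : realType) (n : nat) (M : topologicalType) (S : manifold R n M).
Variables (p q : nat) (eps : R) (gr : R -> tensor2 S).
Hypothesis eps0 : 0 < eps.
Hypothesis fam : smooth_metric_family p q eps gr.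

Local Notation sstrip := (smooth_fun_strip S eps).
Local Notation w := (wfun gr).
Local Notation dR := (@dR R M).
Local Notation MOp := (MOp gr).
Local Notation Dop := (Dop gr).
Local Notation jet := (@jet R M).
Implicit Types (F G H : M -> R -> R) (f : smfun S).

Lemma MOp_const_smooth f : sstrip (MOp (fun v _ => val f v)).
Proof. exact/(MOp_smooth eps0 fam)/sstrip_const/smfun_smooth. Qed.

Definition Mfun j f : smfun S := mksmfun (jet_smooth eps0 j (MOp_const_smooth f)).

Lemma Mfun_linear j : linear (Mfun j).
Proof.
move=> c f g; apply/val_inj/funext => u.
have cs h : sstrip (fun v _ => val h v) := sstrip_const eps (smfun_smooth h).
rewrite smfunD smfunZ /= [RHS]addrC.
rewrite -(jet_lin eps0 c j u (MOp_const_smooth g) (MOp_const_smooth f)).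
apply: (eq_jet eps0) => v s se.
rewrite -(MOp_lin eps0 fam (fun=> c) v (cs g) (cs f) se).
by apply: eq_MOp => z; exact: addrC.
Qed.

HB.instance Definition _ j := GRing.isLinear.Build R (smfun S) (smfun S) *:%R
  (Mfun j) (Mfun_linear j).

Definition Mlin j : {linear smfun S -> smfun S} := Mfun j.

Definition jets F (Fs : sstrip F) (k : nat) : smfun S := mksmfun (jet_smooth eps0 k Fs).

(** The bridge from analysis to algebra: taking Taylor coefficients intertwines the differential
    operator [Dop] with the formal operator [serD] for the maps [Mlin j]. *)
Lemma serD_jets c F (Fs : sstrip F) :
  serD Mlin c (jets Fs) = jets (Dop_smooth eps0 fam c Fs).
Proof.
apply/funext => k; apply/val_inj/funext => u.
rewrite /serD smfunD smfunZ smfun_sum /=.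
have d1 := dR_smooth Fs; have d2 := dR_smooth d1.
have Xd2 : sstrip (fun v s => s * dR (dR F) v s) := sstripM (@sstripX R n M S eps) d2.
have Ms := MOp_smooth eps0 fam Fs.
have MXs : sstrip (fun v s => MOp F v s + (-2) * (s * dR (dR F) v s)).
  by apply: sstripD => //; apply: sstripM => //; exact: sstrip_cst.
rewrite (eq_jet eps0 (F := Dop c F) (G := fun v s =>
   (MOp F v s + (-2) * (s * dR (dR F) v s)) + (2 * c) * dR F v s)); last first.
  by move=> v s _; rewrite /Dop; ring.
rewrite (jet_lin eps0 _ _ _ MXs d1) (jet_lin eps0 _ _ _ Ms Xd2) (jet_MOp eps0 fam _ _ Fs).
rewrite (jet_X eps0 _ _ d2) jet_dR.
have -> : (match k with 0 => 0 | k'.+1 => jet (dR (dR F)) k' u end) =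
    k%:R * (k.+1%:R * jet F k.+1 u) :> R.
  by case: k => [|k]; rewrite ?mul0r // !jet_dR.
set T := \sum_(_ < _) _; rewrite -/T; ring.
Qed.

Fixpoint Dopn m c F : M -> R -> R :=
  if m is m'.+1 then Dopn m' (c - 2) (Dop c F) else F.

Lemma serDn_jets m c F (Fs : sstrip F) u :
  val (serDn Mlin m c (jets Fs) 0%N) u = Dopn m c F u 0.
Proof.
elim: m c F Fs => [|m IH] c F Fs /=; first exact: jet0.
by rewrite serD_jets IH.
Qed.

Lemma eq_iter_ambient m (F G : R -> M -> R -> R) t u r : 0 < t -> `|r| < eps ->
  (forall t v s, 0 < t -> `|s| < eps -> F t v s = G t v s) ->
  iter m (ambient_laplacian gr) F t u r = iter m (ambient_laplacian gr) G t u r.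
Proof.
move=> t0 re FG; elim: m t u r t0 re => [|m IH] t u r t0 re; first exact: FG.
by rewrite !iterS; apply: (eq_ambient_laplacian gr u t0 re).
Qed.

(** [ambient_conj] for [t^b]: the degree drops by 2 at every step, and the index [c = b + n / 2 - 1]
    drops with it, as [Dopn] requires. *)
Lemma iter_ambient m (b : R) F t u r : sstrip F -> 0 < t -> `|r| < eps ->
  iter m (ambient_laplacian gr) (fun t v s => t `^ b * ((w v s)^-1 * F v s)) t u r
  = t `^ (b - 2 * m%:R) * ((w u r)^-1 * Dopn m (b + n%:R / 2 - 1) F u r).
Proof.
move=> Fs t0 re; elim: m b F Fs => [|m IH] b F Fs; first by rewrite mulr0 subr0.
rewrite iterSr (@eq_iter_ambient m _ (fun t v s => t `^ (b - 2)
   * ((w v s)^-1 * Dop (b + n%:R / 2 - 1) F v s)) t u r t0 re); last first.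
  move=> x v s x0 se.
  rewrite (@ambient_conj _ _ _ _ _ _ _ _ eps0 fam _ (fun t => b * t `^ (b - 1)) _ _ _ _
    (b + n%:R / 2 - 1)) //.
  - rewrite (powRB (r := b)) ?(gt_eqF x0) ?implybT //.
    by rewrite (powR_mulrn 2) ?ltW // [x ^- 2 * _]mulrC.
  - rewrite powRB ?(gt_eqF x0) ?implybT // powRr1 ?ltW //.
    by rewrite mulrC -mulrA (mulfVK (lt0r_neq0 x0)); congr (_ * _); ring.
rewrite (IH _ _ (Dop_smooth eps0 fam _ Fs)).
have -> : b - 2 + n%:R / 2 - 1 = b + n%:R / 2 - 1 - 2 by ring.
by congr (_ `^ _ * _); rewrite -natr1; ring.
Qed.

End AmbientIterates.

Section GJMS.
Variables (R : realType) (n : nat) (M : topologicalType) (S : manifold R n M).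
Variables (p q : nat) (eps : R) (gr : R -> tensor2 S).
Hypothesis eps0 : 0 < eps.
Hypothesis fam : smooth_metric_family p q eps gr.

Local Notation sstrip := (smooth_fun_strip S eps).
Local Notation w := (wfun gr).
Local Notation dR := (@dR R M).
Local Notation Dop := (Dop gr).
Local Notation Dopn := (Dopn gr).
Local Notation jet := (@jet R M).
Local Notation Mlin := (Mlin eps0 fam).
Local Notation jets := (jets eps0).
Implicit Types (F G H : M -> R -> R) (f : smfun S).

Let ws : sstrip w := wfun_smooth eps0 fam.
Let abs_eps0 : `|0 : R| < eps. Proof. by rewrite normr0. Qed.

Lemma eq_Dopn m c F G u r : (forall v s, `|s| < eps -> F v s = G v s) ->
  `|r| < eps -> Dopn m c F u r = Dopn m c G u r.
Proof.
elim: m c F G => [|m IH] c F G FG re; first exact: FG.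
apply: IH => // v s se; rewrite /Dop.
rewrite (eq_dR (eps := eps) se (FG v)) (eq_MOp gr v (fun z => FG z s se)).
have dE x : `|x| < eps -> dR F v x = dR G v x.
  by move=> xe; exact: (eq_dR (eps := eps) xe (FG v)).
by rewrite (eq_dR (eps := eps) se dE).
Qed.

Variables (ext : nat -> (M -> R) -> M -> R -> R).
Hypothesis hext : extension_operator S eps ext.

(** The exponent [b = N - n / 2] makes [c = N - 1], from which the dimension has disappeared. *)
Lemma gjms_Dopn N (f : M -> R) u : smooth_fun S f ->
  gjms gr ext N f u = Dopn N (N%:R - 1) (fun v s => w v s * ext N f v s) u 0.
Proof.
move=> fs; have [es e0] := hext N fs.
rewrite /gjms (@eq_iter_ambient _ _ _ S eps gr N _ (fun t v s => t `^ (N%:R - n%:R / 2)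
   * ((w v s)^-1 * (w v s * ext N f v s)))) //; last first.
  by move=> t v s t0 se; rewrite mulKf ?(w_neq0 eps0 fam).
rewrite (iter_ambient eps0 fam N _ _ (sstripM ws es)) // powR1 mul1r.
rewrite (wfun0 eps0 fam) invr1 mul1r.
by have -> : N%:R - n%:R / 2 + n%:R / 2 - 1 = N%:R - 1 :> R by ring.
Qed.

Lemma gjms_serP N f u : (0 < N)%N -> gjms gr ext N (val f) u = val (serP Mlin N f) u.
Proof.
case: N => // N _; have fs := smfun_smooth f; have [es e0] := hext N.+1 fs.
have wes := sstripM ws es.
rewrite gjms_Dopn // -(serDn_jets eps0 fam N.+1 _ wes) -natr1 addrK serDn_serP.
congr (val (serP _ _ _) u); apply/val_inj/funext => v.
by rewrite /= jet0 e0 (wfun0 eps0 fam) mul1r.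
Qed.

Lemma Dop_w c u r : `|r| < eps ->
  Dop c w u r = (2 * c - (n%:R - 2)) * dR w u r.
Proof.
move=> re; rewrite /Dop /MOp (eq_Lap gr u (G := fun=> fun=> 1)); last first.
  by move=> v; rewrite mulVf ?(w_neq0 eps0 fam).
rewrite Lap_cst mulr0 add0r divfK ?(w_neq0 eps0 fam) //; ring.
Qed.

Lemma jetZ c F k u : sstrip F -> jet (fun v s => c * F v s) k u = c * jet F k u.
Proof.
move=> Fs; have zs : sstrip (fun v _ => (fun=> 0) v) := @sstrip_cst R n M S eps 0.
rewrite (eq_jet eps0 (G := fun v s => (fun=> 0) v + c * F v s)); last first.
  by move=> v s _; rewrite add0r.
by rewrite (jet_lin eps0 _ _ _ zs Fs) (jet_const eps0); case: k => [|k]; rewrite add0r.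
Qed.

Lemma sstripZ c F : sstrip F -> sstrip (fun v s => c * F v s).
Proof. by apply: sstripM; exact: sstrip_cst. Qed.

Lemma DopnZ m c a F u : sstrip F ->
  Dopn m c (fun v s => a * F v s) u 0 = a * Dopn m c F u 0.
Proof.
move=> Fs; rewrite -(serDn_jets eps0 fam m c (sstripZ a Fs)) -(serDn_jets eps0 fam m c Fs).
have /(congr1 (fun h : nat -> smfun S => h 0%N)) /= E := serDnZ Mlin m c a (jets Fs).
rewrite -smfunZ -E; congr (val (serDn _ _ _ _ _) u).
by apply/funext => k; apply/val_inj/funext => v; rewrite smfunZ /= jetZ.
Qed.

Definition phi (v : M) (s : R) : R := -2 * dR w v s.

Lemma phi_smooth : sstrip phi.
Proof. exact/sstripZ/dR_smooth. Qed.

Lemma jet_phi k u : jet phi k u = -2 * (k.+1%:R * jet w k.+1 u).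
Proof. by rewrite (jetZ _ _ _ (dR_smooth ws)) jet_dR. Qed.

Lemma serL_phi N u : val (serL Mlin N.+1 (jets phi_smooth)) u
  = Dopn N (N%:R - 2) phi u 0.
Proof.
rewrite /serL (serDn_jets eps0 fam) /=.
by rewrite (_ : N.+1%:R - 3 = N%:R - 2 :> R) // -natr1; ring.
Qed.

(** [w] times the extension of 1 equals [w] at [rho = 0] and may be replaced by it. Then
    [D_N w = (2 N - (n - 2)) w'] produces the factor [2 (N + 1) - n] that the definition of the
    Q-curvature removes. *)
Lemma gjms1 N u : gjms gr ext N.+1 (fun=> 1) u = (2 * N.+1%:R - n%:R) * Dopn N (N%:R - 2) (dR w) u 0.
Proof.
have ones : smooth_fun S (fun=> 1) by move=> a; exact: (smooth_cst (@open_img R n M S a)).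
have [es e0] := hext N.+1 ones; have wes := sstripM ws es.
rewrite gjms_Dopn // -(serDn_jets eps0 fam N.+1 _ wes) -natr1 addrK.
rewrite (@serDn_congr _ _ _ _ _ (jets ws)); last first.
  by apply/val_inj/funext => v; rewrite /= !jet0 e0 mulr1.
rewrite (serDn_jets eps0 fam N.+1 _ ws) -DopnZ; last exact: dR_smooth.
by rewrite /=; apply: eq_Dopn => // v s se; rewrite Dop_w //; congr (_ * _); rewrite -?natr1; ring.
Qed.

Lemma iter_ambient_ln N u : (N.+1.*2 = n)%N ->
  iter N.+1 (ambient_laplacian gr) (fun t _ _ => ln t) 1 u 0
  = 2 * Dopn N (N%:R - 2) (dR w) u 0.
Proof.
move=> nE; have ds := sstripZ 2 (dR_smooth ws).
(* Only the trace term survives in the first Laplacian of [ln t] and gives [t^-2 2 w' / w]. This is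
   homogeneous of degree [-2], and [n = 2 (N + 1)] makes [-2 + n / 2 - 1] equal to [N - 2]. *)
rewrite iterSr (@eq_iter_ambient _ _ _ S eps gr N _ (fun t v s => t `^ (- 2)
   * ((w v s)^-1 * (2 * dR w v s)))) //; last first.
  move=> t v s t0 se.
  have := @ambient_sep R n M S p q eps gr eps0 fam (@ln R) (fun t => t^-1) (fun _ _ => 1) t v s.
  move=> /(_ (fun x x0 => is_derive1_ln x0) (@sstrip_cst R n M S eps 1) t0 se).
  have d0 x : dR (fun _ _ => 1) v x = 0 by exact: (dR_const (fun=> 1)).
  have d00 : dR (dR (fun _ _ => 1)) v s = 0.
    by rewrite (eq_dR (eps := eps) se (fun x _ => d0 x)) (dR_const (fun=> 0)).
  rewrite d00 d0 (Lap_cst gr (fun=> 1)) !(mulr0, add0r, addr0, subr0, mulr1).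
  rewrite divff ?gt_eqF // mulr1 => E.
  transitivity (ambient_laplacian gr (fun t _ _ => ln t * 1) t v s).
    by apply: (eq_ambient_laplacian (eps := eps)) => // *; rewrite mulr1.
  rewrite E powRN (powR_mulrn 2) ?ltW //; ring.
rewrite (iter_ambient eps0 fam N _ _ ds) // powR1 mul1r (wfun0 eps0 fam) invr1 mul1r.
have nR : n%:R = 2 * (N%:R + 1) :> R by rewrite natr1 -natrM mul2n nE.
rewrite (DopnZ _ _ _ _ (dR_smooth ws)).
by have -> : -2 + n%:R / 2 - 1 = N%:R - 2 :> R by rewrite nR; field.
Qed.

Lemma Qcurv_serL N u :
  (-1) ^+ N.+1 * Qcurv gr ext N.+1 u = val (serL Mlin N.+1 (jets phi_smooth)) u.
Proof.
rewrite serL_phi (DopnZ _ _ _ _ (dR_smooth ws)) /Qcurv; case: eqP => [nE|nE].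
  rewrite iter_ambient_ln // mulrA -exprMn mulrNN mulr1 expr1n mul1r; ring.
rewrite gjms1 !mulrA -exprMn mulrNN mulr1 expr1n mul1r.
have nN : n%:R / 2 - N.+1%:R != 0 :> R.
  apply/negP => /eqP H; apply: nE; apply/eqP; rewrite -(eqr_nat R) -muln2 natrM.
  by apply/eqP; lra.
rewrite (_ : 2 * N.+1%:R - n%:R = -2 * (n%:R / 2 - N.+1%:R)); last by field.
by rewrite -!mulrA; congr (_ * _); rewrite mulrCA mulrA mulfK // mulrC.
Qed.

End GJMS.

(** * From [rho] to [r]: the invariants [W_2N] *)

Section Even.
Variables (R : realType) (n : nat) (M : topologicalType) (S : manifold R n M).
Variables (eps : R).
Hypothesis eps0 : 0 < eps.

Local Notation sstrip := (smooth_fun_strip S).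
Local Notation dR := (@dR R M).
Local Notation jet := (@jet R M).
Implicit Types (F : M -> R -> R).

(* The substitution [rho = - s^2 / 2], relating [g_rho] to [h_r]. *)
Definition sqsubst F : M -> R -> R := fun v s => F v (- (s ^+ 2) / 2).

(** For [|s| < 1] one has [s^2 / 2 <= |s|], so the bound by [eps] passes to [rho]. *)
Let eps1 : R := Num.min 1 eps.

Lemma eps1_gt0 : 0 < eps1.
Proof. by rewrite lt_min ltr01. Qed.

Lemma sqsubst_bound s : `|s| < eps1 -> `|- (s ^+ 2) / 2| < eps.
Proof.
rewrite lt_min => /andP[s1 se]; rewrite mulNr normrN normrM normrX.
rewrite [`|2^-1|]ger0_norm ?invr_ge0 //.
have := normr_ge0 s; nra.
Qed.

Lemma sqsubst_smooth F : sstrip eps F -> sstrip eps1 (sqsubst F).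
Proof.
move=> Fs a; have oS := @open_strip R n M S eps a; have oS1 := @open_strip R n M S eps1 a.
pose psi (z : 'rV[R]_(n + 1)) : 'rV[R]_(n + 1) :=
  row_mx (lsubmx z) (- (rsubmx z 0 0 ^+ 2) / 2)%:M.
apply: (eq_smooth oS1 (f := fun z => loc F a (psi z))).
  by move=> z _; rewrite /loc row_mxKl row_mxKr mxE eqxx.
apply: (smooth_comp oS1 oS) (Fs a) => [z [az ze]|c].
  by apply: strip_row => //; exact: sqsubst_bound.
case: (split_ordP c) => j ->.
  apply: (eq_smooth oS1 _ (smooth_coord (lshift 1 j) oS1)) => z _.
  by rewrite row_mxEl mxE.
have cs := smooth_coord (rshift n j) oS1.
apply: (eq_smooth oS1 _ (smoothZ oS1 (- 2^-1) (smoothM oS1 cs cs))) => z _.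
by rewrite row_mxEr !mxE !ord1 eqxx mulr1n; ring.
Qed.

Lemma dR_sqsubst F v s : sstrip eps F -> `|s| < eps1 ->
  dR (sqsubst F) v s = - (s * sqsubst (dR F) v s).
Proof.
move=> Fs se; have dF : derivable (F v) (- (s ^+ 2) / 2) 1 := derivable_dR Fs (sqsubst_bound se).
have H : is_derive s 1 (fun s : R => - (s ^+ 2) / 2) (- s).
  rewrite (_ : (fun s => _) = (- 2^-1) \*: (fun s => s * s)).
    have := is_deriveM (is_derive_id s (1 : R)) (is_derive_id s 1).
    move=> /(is_deriveZ (- 2^-1)) D; apply: is_derive_eq D _.
    by rewrite /GRing.scale /=; field.
  by apply/funext => x; rewrite /= /GRing.scale /=; ring.
have := @is_derive1_comp _ (F v) (fun s : R => - (s ^+ 2) / 2) s _ _ (derivableP dF) H.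
rewrite /dR derive1E => -[_ E]; rewrite [LHS]E /sqsubst /dR derive1E; ring.
Qed.

(** Since [d/ds F(-s^2/2) = - s F'(-s^2/2)], the coefficient of order [2 N + 2], times [2 N + 2], is
    minus that of [F'] at order [2 N]; induction on [N] is applied to [F']. *)
Lemma jet_sqsubst F N u : sstrip eps F ->
  jet (sqsubst F) N.*2 u = (- 2^-1) ^+ N * jet F N u.
Proof.
elim: N F => [|N IH] F Fs.
  by rewrite !jet0 /sqsubst expr0n oppr0 mul0r mul1r.
have ds := dR_smooth Fs; have hs := sqsubst_smooth ds.
have E1 : N.*2.+2%:R * jet (sqsubst F) N.*2.+2 u = - jet (sqsubst (dR F)) N.*2 u.
  rewrite -jet_dR (eq_jet eps1_gt0 (G := fun v s => -1 * (s * sqsubst (dR F) v s))).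
    rewrite (jetZ eps1_gt0 _ _ _ (sstripM (@sstripX R n M S eps1) hs)).
    by rewrite (jet_X eps1_gt0 _ _ hs) mulN1r.
  by move=> v s se; rewrite dR_sqsubst // mulN1r.
move: E1; rewrite IH // jet_dR doubleS => E1.
have n0 : N.*2.+2%:R != 0 :> R by rewrite pnatr_eq0.
apply: (mulfI n0); rewrite E1 exprS -doubleS -muln2 natrM; by field.
Qed.

End Even.

Section W2.
Variables (R : realType) (n : nat) (M : topologicalType) (S : manifold R n M).
Variables (p q : nat) (eps : R) (gr : R -> tensor2 S).
Hypothesis eps0 : 0 < eps.
Hypothesis fam : smooth_metric_family p q eps gr.

Lemma W2_jet N u : jet (wfun gr) N u = (-2) ^+ N * W2 gr N u.
Proof.
have -> : W2 gr N u = jet (sqsubst (wfun gr)) N.*2 u.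
  rewrite /W2 /jet; congr (_ / _).
  have -> : Wfun gr u = sqsubst (wfun gr) u.
    apply/funext => r; rewrite /Wfun /Vfun /hr /sqsubst /wfun /vol.
    by rewrite expr0n oppr0 mul0r.
  rewrite /derive1n; elim: N.*2 (0 : R) => // m IH r.
  by rewrite !iterS /dR; congr (derive1 _ r); apply/funext => s.
rewrite (jet_sqsubst eps0 _ _ (wfun_smooth eps0 fam)) mulrA -exprMn.
by rewrite (_ : -2 * - 2^-1 = 1 :> R) ?expr1n ?mul1r //; field.
Qed.

End W2.

(** * The constants [m_I] and the recursion for the Q-curvatures *)

Lemma prod_pairs_rcons (R : realType) (I : seq nat) (a b : nat) :
  \prod_(j < (size (rcons (rcons I b) a)).-1)
    (nth 0%N (rcons (rcons I b) a) j + nth 0%N (rcons (rcons I b) a) j.+1)%:R^-1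
  = \prod_(j < (size (rcons I b)).-1)
      (nth 0%N (rcons I b) j + nth 0%N (rcons I b) j.+1)%:R^-1
    * (a + b)%:R^-1 :> R.
Proof.
rewrite !size_rcons /= big_ord_recr /=; congr (_ * _).
  apply: eq_bigr => -[j jI] _ /=; congr ((_ + _)%:R^-1).
    by rewrite nth_rcons size_rcons ltnS ltnW.
  by rewrite nth_rcons size_rcons ltnS jI.
by rewrite !nth_rcons !size_rcons ltnSn ltnn eqxx ltnn eqxx addnC.
Qed.

Lemma seralpha_serw (R : realType) (I : seq nat) (a : nat) :
  seralpha R a * serw R a (rev I) =
  (-1) ^+ size I / (-2) ^+ (sumn I + a)
  * (\prod_(i <- rcons I a) (i`! * i.-1`!)%:R^-1)
  * (\prod_(j < (size (rcons I a)).-1)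
      (nth 0%N (rcons I a) j + nth 0%N (rcons I a) j.+1)%:R^-1).
Proof.
elim/last_ind: I a => [|I b IH] a.
  rewrite /= big_seq1 big_ord0 !mulr1 mul1r /seralpha natrM -!mulrA.
  by rewrite !invfM.
rewrite rev_rcons prod_pairs_rcons -[in X in _ * X * _]cats1 big_cat big_seq1 /=.
have := IH b; move: (serw R b (rev I)) => W E.
transitivity (seralpha R a * - (seralpha R b * W) * (a + b)%:R^-1); first by ring.
rewrite E /seralpha sumn_rcons size_rcons exprS !exprD natrM !invfM.
ring.
Qed.

(** Both [seralpha N] and the product of the [seralpha] of the entries carry [(-2)^-N], so the
    powers of 2 cancel. The factorials of [N] in [m_I] come from [1 / seralpha N], and its sign from
    the minus sign in each step of [serw]. *)
Lemma mcoef_serw (R : realType) (N a : nat) (I : seq nat) : (sumn I + a = N)%N ->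
  mcoef R (rcons I a) = seralpha R a / seralpha R N * serw R a (rev I).
Proof.
move=> <-; rewrite mulrAC seralpha_serw /mcoef size_rcons sumn_rcons /seralpha.
rewrite invrK; set P := \prod_(_ <- _) _; set Q := \prod_(_ < _) _.
have n0 : (-2) ^+ (sumn I + a) != 0 :> R by rewrite expf_neq0 // oppr_eq0 pnatr_eq0.
rewrite !exprS; by field.
Qed.

Section Main.
Variables (R : realType) (n : nat) (M : topologicalType) (S : manifold R n M).
Variables (p q : nat) (eps : R) (gr : R -> tensor2 S).
Hypothesis eps0 : 0 < eps.
Hypothesis fam : smooth_metric_family p q eps gr.
Variables (ext : nat -> (M -> R) -> M -> R -> R).
Hypothesis hext : extension_operator S eps ext.

Lemma foldr_gjms (f : smfun S) I : all (leq 1) I ->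
  foldr (gjms gr ext) (val f) I = val (foldr (serP (Mlin eps0 fam)) f I).
Proof.
elim: I => //= N I IH /andP[N0 /IH ->]; apply/funext => u.
exact: gjms_serP.
Qed.

Lemma Qcurv_recursion N u :
  (-1) ^+ N.+1 * Qcurv gr ext N.+1 u =
  - (\sum_(I : {bseq N.+1 of 'I_N.+2})
      \sum_(a < N.+1 | is_composition N.+1 (rcons (map val I) a))
        mcoef R (rcons (map val I) a) * (-1) ^+ a *
        foldr (gjms gr ext) (Qcurv gr ext a) (map val I) u)
  + (N.+1`!)%:R * (N`!)%:R * 2 ^+ (N.+1.*2) * W2 gr N.+1 u.
Proof.
rewrite (Qcurv_serL eps0 fam hext) serL_recursion smfunD addrC; congr (_ + _).
  rewrite smfunN smfun_sum; congr (- _).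
  (* The index [a = 0] is excluded by positivity of the entries; the remaining [a] are shifted by
     one to match [serL a.+1]. *)
  rewrite (exchange_big_dep xpredT) //= big_ord_recl [X in _ = X + _]big_pred0 ?add0r; last first.
    by move=> I; rewrite /is_composition all_rcons.
  apply: eq_bigr => -[a aN] _ /=; rewrite smfun_sum /bump leq0n add1n.
  rewrite -(@sum_compositions _ N.+1 (N - a) (fun I => _ * _)); last by lia.
  apply: eq_big => [I|I /andP[I1 /eqP Is]].
    rewrite /is_composition all_rcons sumn_rcons /=; congr (_ && _).
    by apply/eqP/eqP; lia.
  have -> : Qcurv gr ext a.+1
      = val ((-1) ^+ a.+1 *: serL (Mlin eps0 fam) a.+1 (jets eps0 (phi_smooth eps0 fam))).
    by apply/funext => v; rewrite smfunZ -(Qcurv_serL eps0 fam hext) signrMK.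
  rewrite foldr_gjms // foldr_serPZ smfunZ -[RHS]mulrA signrMK.
  by rewrite (@mcoef_serw _ N.+1) // Is; lia.
(* The constant is [serkappa (N + 1)] times [-2 (N + 1)] from [phi = -2 w'], times [(-2)^(N+1)] from
   the passage to [W_2N]; the powers of [-2] add up to the even exponent [2 (N + 1)]. *)
rewrite smfunZ /= (jet_phi eps0 fam) (W2_jet eps0 fam) /serkappa factS natrM.
have -> : 2 ^+ N.+1.*2 = ((-2) ^+ N.+1) ^+ 2 :> R.
  by rewrite -exprM mulnC exprM sqrrN -exprM mul2n.
by rewrite !(exprS _ N) -?natr1; ring.
Qed.

End Main.

Theorem theorem1p4 (R : realType) (n : nat) (hn : (3 <= n)%N)
  (M : topologicalType) (S : manifold R n M)
  (p q : nat) (g : tensor2 S) (hg : is_metric p q g)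
  (eps : R) (gr : R -> tensor2 S) (hgr : poincare_family gr p q g eps)
  (ext : nat -> (M -> R) -> M -> R -> R)
  (hext : extension_operator S eps ext)
  (N : nat) (hN : (1 <= N)%N) (hNn : ~~ odd n -> (N.*2 <= n)%N) (u : M) :
  (-1) ^+ N * Qcurv gr ext N u =
  - (\sum_(I : {bseq N of 'I_N.+1})
      \sum_(a < N | is_composition N (rcons (map val I) a))
        mcoef R (rcons (map val I) a) * (-1) ^+ a *
        foldr (gjms gr ext) (Qcurv gr ext a) (map val I) u)
  + (N`!)%:R * (N.-1`!)%:R * 2 ^+ (N.*2) * W2 gr N u.
Proof.
have [eps0 fam _ _] := hgr.
by case: N hN hNn => // N _ _; exact: (Qcurv_recursion eps0 fam hext N u).
Qed.
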